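(* Let $\alpha\in(1,2)$, let $c\in\mathbb{R}$ and let $m$ be a finite signed Borel measure on $\mathbb{R}$, and set $u_0(x)=c+\int_{-\infty}^x m(dy)=c+m((-\infty,x])$ for a.e. $x\in\mathbb{R}$. Put $u_-=c$ and $u_+=c+m(\mathbb{R})$, and assume $$u_0-u_-\in L^1((-\infty,0)),\qquad u_0-u_+\in L^1((0,\infty)),\qquad u_-<u_+.$$ Let $u$ be the unique solution of the Cauchy problem $u_t+\Lambda^\alpha u+uu_x=0$ on $\mathbb{R}\times(0,\infty)$, $u(\cdot,0)=u_0$, and let $w^R$ be the rarefaction wave $$w^R(x,t)=\begin{cases}u_-, & x/t\le u_-,\\ x/t, & u_-\le x/t\le u_+,\\ u_+, & x/t\ge u_+.\end{cases}$$ Then for every $p\in\big((3-\alpha)/(\alpha-1),\infty\big]$ there exists $C>0$ independent of $t$ such that $$\|u(t)-w^R(t)\|_p\le C\,t^{-[\alpha-1-(3-\alpha)/p]/2}\log(2+t)\qquad\text{for all } t>0.$$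
   Context: $\Lambda^\alpha=(-\partial_x^2)^{\alpha/2}$ is defined by $\widehat{\Lambda^\alpha v}(\xi)=|\xi|^\alpha\widehat v(\xi)$; for bounded smooth (not necessarily decaying) functions and $\alpha\in(1,2)$ it is given by $\Lambda^\alpha w(x)=-C(\alpha)\int_{\mathbb{R}}\frac{w(x+z)-w(x)-w_x(x)z}{|z|^{1+\alpha}}dz$ for a suitable constant $C(\alpha)>0$. For $u_0\in L^\infty(\mathbb{R})$ and $\alpha\in(1,2)$, ''the solution'' means the unique function $u$ such that for all $T>0$: $u\in C_b((0,T)\times\mathbb{R})$, $u\in C_b^\infty((a,T)\times\mathbb{R})$ for every $a\in(0,T)$, $u$ satisfies the equation on $(0,T)\times\mathbb{R}$, and $u(\cdot,t)\to u_0$ weak-$*$ in $L^\infty(\mathbb{R})$ as $t\to0$ (existence and uniqueness of such a solution is known). $\|\cdot\|_p$ is the $L^p(\mathbb{R})$ norm in $x$. *)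

(* Defs.v *)
From mathcomp Require Import all_boot all_algebra.
From mathcomp Require Import all_classical all_reals all_analysis.
Import numFieldNormedType.Exports.
Import GRing.Theory Num.Theory.
Set Implicit Arguments. Unset Strict Implicit. Unset Printing Implicit Defensive.
Local Open Scope ring_scope.
Local Open Scope classical_set_scope.

Section Defs.
Context {R : realType}.

(* Functions u : R -> R -> R are read as u t x (time first, then space). *)
Definition pdt (u : R -> R -> R) : R -> R -> R :=
  fun t x => derive1 (fun s => u s x) t.
Definition pdx (u : R -> R -> R) : R -> R -> R :=
  fun t x => derive1 (fun y => u t y) x.
Definition pd (b : bool) (u : R -> R -> R) := if b then pdt u else pdx u.
Definition pderiv (w : seq bool) (u : R -> R -> R) := foldr pd u w.

Definition strip (a T : R) : set (R * R) := [set tx | a < tx.1 < T].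

Definition Cb_on (A : set (R * R)) (u : R -> R -> R) : Prop :=
  (forall tx, A tx -> {for tx, continuous (fun y : R * R => u y.1 y.2)}) /\
  (exists M : R, forall tx, A tx -> `|u tx.1 tx.2| <= M).

Definition Cbinf_on (A : set (R * R)) (u : R -> R -> R) : Prop :=
  forall w : seq bool,
    Cb_on A (pderiv w u) /\
    (forall tx, A tx ->
       derivable (fun s => pderiv w u s tx.2) tx.1 1 /\
       derivable (fun y => pderiv w u tx.1 y) tx.2 1).

(* normalising constant C(alpha) = (int_R (1 - cos z)/|z|^(1+alpha) dz)^-1,
   chosen so that the symbol of Lambda^alpha is |xi|^alpha *)
Definition frac_const (alpha : R) : R :=
  (fine (\int[lebesgue_measure]_z ((1 - cos z) / `|z| `^ (1 + alpha))%:E))^-1.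

(* Lambda^alpha w (x) for bounded smooth w, alpha in (1,2) *)
Definition fraclap (alpha : R) (w : R -> R) (x : R) : R :=
  - frac_const alpha *
    Rintegral lebesgue_measure setT
      (fun z => (w (x + z) - w x - derive1 w x * z) / `|z| `^ (1 + alpha)).

Definition is_solution (alpha : R) (u0 : R -> R) (u : R -> R -> R) : Prop :=
  (forall T, 0 < T ->
     Cb_on (strip 0 T) u /\
     (forall a, 0 < a < T -> Cbinf_on (strip a T) u) /\
     (forall t x, 0 < t < T ->
        pdt u t x + fraclap alpha (u t) x + u t x * pdx u t x = 0)) /\
  (forall phi : R -> R,
     lebesgue_measure.-integrable setT (EFin \o phi) ->
     (fun t => Rintegral lebesgue_measure setT (fun x => u t x * phi x))
       @ 0^'+ --> Rintegral lebesgue_measure setT (fun x => u0 x * phi x)).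

Definition init_datum (c : R) (m : {charge set R -> \bar R}) (x : R) : R :=
  c + fine (m `]-oo, x]).

Definition rarefaction (um up t x : R) : R :=
  if x / t <= um then um else if x / t <= up then x / t else up.

Definition invp (p : \bar R) : R :=
  match p with EFin r => r^-1 | _ => 0 end.

End Defs.

(* Main.v *)
Require Import Defs.
From mathcomp Require Import all_boot all_order all_algebra.
From mathcomp Require Import all_classical all_reals all_analysis.
From mathcomp Require Import measurable_realfun ess_sup_inf.
From mathcomp Require Import ring lra.
Import numFieldNormedType.Exports.
Import Order.TTheory GRing.Theory Num.Theory.
Set Implicit Arguments. Unset Strict Implicit. Unset Printing Implicit Defensive.
Local Open Scope ring_scope.
Local Open Scope classical_set_scope.

(** Oleinik's inequality [u t (x + h) - u t x <= h / t] follows from the maximum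
    principle for [(t - a) * (u t (x + h) - u t x) - h] as a function of
    [(t, x, h)]: at an interior maximum the first order conditions cancel the
    convection term, and [Lambda^alpha] has a sign.  Since [w^R] is nondecreasing
    in [x], [v := u - w^R] satisfies the same one-sided bound, so that
    [|v| >= |v x| / 2] on an interval of length [t * |v x| / 2] ending or starting
    at [x], whence [t * sup |v| ^ 2 <= 4 * |v|_1].

    It remains to see that [|v|_1] grows at most like [t^(2 - alpha)].  The smooth
    profile [w = c + (softplus (x - c s) - softplus (x - d s)) / s], [s = 1 + t],
    is at bounded [L^1] distance from [w^R], and [w_t + w w_x + Lambda^alpha w] has
    [L^1] norm of order [s^(1 - alpha)].  A Kato inequality for [u - w], localised
    by the weight [bump (l x)], [l -> 0], gives
    [|u t - w t|_1 <= |u 0 - w 0|_1 + C t^(2 - alpha)].  The datum being attained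
    only weakly-*, the initial value of the localised norm is controlled along a
    sequence of times: the energy estimate makes [t] times the weighted dissipation
    small along some [t -> 0], so that [u t] is close to its mollification at scale
    [t^(1/alpha)], and the latter is close to that of [u 0] by the weak form of the
    equation.  Interpolation between [L^1] and [L^oo] concludes. *)

(** * Softplus, sigmoid and bump *)

(** The obstacle is that at the outset [u t - w t] is only known to be bounded, not integrable, and
    that the bounds on derivatives may blow up as [t -> 0]. The estimates needed near [t = 0] are
    therefore arranged to use the sup of [u] alone: derivatives and increments are moved onto the
    weight, which dominates its own derivatives. The nonlocal term then costs a multiple of
    [l^(alpha - 1)], which vanishes with [l] because [alpha > 1]. A bound on [u_x] enters the L1
    estimate only with a factor [m], the scale at which the absolute value is smoothed, and goes
    away when [m -> 0] before the starting time tends to 0. The wave [w^R] itself is unsuitable as a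
    comparison function, since the integral defining Lambda^alpha diverges at its corners; smoothing
    at unit length removes them. As for the exponents, a bound of order [t^(2 - alpha)] on
    [t * sup |v|^2] gives decay [t^(-(alpha - 1)/2)] of the sup; the power [1 - 1/p] of this times
    the power [1/p] of [t^(2 - alpha)] is the rate claimed. *)

Section PointwiseDerivatives.
Context {R : realType}.
Implicit Types (f g : R -> R) (x a b k : R).

Lemma derive_cst k x : is_derive x 1 (fun _ : R => k) 0.
Proof. exact: is_derive_cst. Qed.

Lemma derive_idfun x : is_derive x 1 (fun y : R => y) 1.
Proof. exact: is_derive_id. Qed.

Lemma derive_add f g x a b : is_derive x 1 f a -> is_derive x 1 g b ->
  is_derive x 1 (fun y => f y + g y) (a + b).
Proof. by move=> *; apply: is_deriveD. Qed.

Lemma derive_opp f x a : is_derive x 1 f a -> is_derive x 1 (fun y => - f y) (- a).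
Proof. by move=> *; apply: is_deriveN. Qed.

Lemma derive_sub f g x a b : is_derive x 1 f a -> is_derive x 1 g b ->
  is_derive x 1 (fun y => f y - g y) (a - b).
Proof. by move=> *; apply: is_deriveB. Qed.

Lemma derive_mul f g x a b : is_derive x 1 f a -> is_derive x 1 g b ->
  is_derive x 1 (fun y => f y * g y) (f x * b + g x * a).
Proof. by move=> *; apply: is_deriveM. Qed.

Lemma derive_compose f g x a b : is_derive (g x) 1 f a -> is_derive x 1 g b ->
  is_derive x 1 (fun y => f (g y)) (a * b).
Proof. by move=> *; apply: is_derive1_comp. Qed.

Lemma derive_eq f x a b : is_derive x 1 f a -> a = b -> is_derive x 1 f b.
Proof. by move=> h <-. Qed.

Lemma derive_inv f x a : f x != 0 -> is_derive x 1 f a ->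
  is_derive x 1 (fun y => (f y)^-1) (- a / f x ^+ 2).
Proof.
move=> f0 Df; have H : is_derive x 1 (fun y => (f y)^-1) (- f x ^- 2 * a).
  exact: is_deriveV.
by apply: derive_eq H _; field.
Qed.

Lemma derive_continuous f f' : (forall x, is_derive x 1 f (f' x)) -> continuous f.
Proof.
by move=> Df x; apply/differentiable_continuous/derivable1_diffP; case: (Df x).
Qed.

Lemma derive1_is_derive f x a : is_derive x 1 f a -> derive1 f x = a.
Proof. by move=> Df; rewrite derive1E; apply: derive_val. Qed.

Lemma derivable_is_derive f x : derivable f x 1 -> is_derive x 1 f (derive1 f x).
Proof. by move=> Df; rewrite derive1E; apply: derivableP. Qed.

End PointwiseDerivatives.

Section Sigmoid.
Context {R : realType}.
Implicit Types x y z : R.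

Definition softplus x : R := ln (1 + expR x).
Definition sigmoid x : R := (1 + expR (- x))^-1.
(** The logistic density, [1 / (4 cosh^2 (x / 2))]. As a weight it has an advantage over compactly
    supported cutoffs: it is positive, and its derivatives and translates are bounded by multiples
    of itself. *)
Definition bump x : R := sigmoid x * (1 - sigmoid x).

Lemma sigmoid_gt0 x : 0 < sigmoid x.
Proof. by rewrite invr_gt0 addr_gt0// expR_gt0. Qed.

Lemma sigmoidE x : sigmoid x = expR x / (1 + expR x).
Proof.
have e0 := expR_gt0 x; rewrite /sigmoid expRN.
by field; rewrite ?gt_eqF//; lra.
Qed.

Lemma onem_sigmoid x : 1 - sigmoid x = sigmoid (- x).
Proof.
have e0 := expR_gt0 x; rewrite sigmoidE /sigmoid opprK.
by field; rewrite gt_eqF//; lra.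
Qed.

Lemma sigmoid_lt1 x : sigmoid x < 1.
Proof. by rewrite -subr_gt0 onem_sigmoid sigmoid_gt0. Qed.

Lemma bump_gt0 x : 0 < bump x.
Proof. by rewrite mulr_gt0 ?sigmoid_gt0// subr_gt0 sigmoid_lt1. Qed.

Lemma bump_le x : bump x <= 4^-1.
Proof. by rewrite /bump; have := sqr_ge0 (sigmoid x - 2^-1); rewrite expr2; lra. Qed.

Lemma bumpN x : bump (- x) = bump x.
Proof. by rewrite /bump -onem_sigmoid; ring. Qed.

Lemma bumpE x : bump x = (2 + expR x + expR (- x))^-1.
Proof.
have e0 := expR_gt0 x; rewrite /bump sigmoidE expRN.
by field; apply/andP; split; rewrite gt_eqF//; nra.
Qed.

(** In the reciprocal [2 + expR x + expR (- x)] given by [bumpE], each term shrinks by at most the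
    factor exp(-|y|) under translation by [y]. *)
Lemma bump_shift x y : bump (x + y) <= expR `|y| * bump x.
Proof.
rewrite !bumpE -[expR `|y|]invrK -expRN -invfM lef_pV2 ?posrE; last 2 first.
- by rewrite !addr_gt0 ?expR_gt0.
- by rewrite mulr_gt0 ?expR_gt0// !addr_gt0 ?expR_gt0.
have h1 : expR (- `|y|) <= 1 by rewrite -[leRHS]expR0 ler_expR oppr_le0.
have h2 : expR (- `|y|) * expR x <= expR (x + y).
  by rewrite -expRD ler_expR; have := ler_norm (- y); rewrite normrN; lra.
have h3 : expR (- `|y|) * expR (- x) <= expR (- (x + y)).
  by rewrite -expRD ler_expR; have := ler_norm y; lra.
lra.
Qed.

Lemma bump_ub x : bump x <= expR (- `|x|).
Proof.
rewrite bumpE [X in _ <= X]expRN lef_pV2 ?posrE ?addr_gt0 ?expR_gt0//.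
have := expR_gt0 x; have := expR_gt0 (- x).
by case: (ger0P x) => _; lra.
Qed.

Lemma bump_lb x : expR (- `|x|) <= 4 * bump x.
Proof.
have h1 : 4 * bump x = (4^-1 * (2 + expR x + expR (- x)))^-1.
  by rewrite bumpE invfM invrK.
rewrite h1 [X in X <= _]expRN lef_pV2 ?posrE ?mulr_gt0 ?addr_gt0 ?expR_gt0//.
have : 1 <= expR `|x| by rewrite -expR0 ler_expR.
have : expR x <= expR `|x| by rewrite ler_expR ler_norm.
have : expR (- x) <= expR `|x| by rewrite ler_expR -normrN ler_norm.
lra.
Qed.

Lemma softplus_ge0 x : 0 <= softplus x.
Proof. by rewrite ln_ge0// lerDl expR_ge0. Qed.

Lemma softplusN x : softplus (- x) = softplus x - x.
Proof.
have e0 := expR_gt0 x.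
rewrite /softplus; transitivity (ln (1 + expR x) - ln (expR x)); last by rewrite expRK.
rewrite expRN -ln_div ?posrE ?addr_gt0//.
by congr ln; field; rewrite gt_eqF.
Qed.

Lemma is_derive_softplus x : is_derive x 1 softplus (sigmoid x).
Proof.
have e0 := expR_gt0 x.
have h : 0 < 1 + expR x by lra.
refine (derive_eq (derive_compose (g := fun y => 1 + expR y) (is_derive1_ln h)
  (derive_add (derive_cst 1 x) (is_derive_expR x))) _).
by rewrite sigmoidE add0r mulrC.
Qed.

Lemma is_derive_expRN x : is_derive x 1 (fun y => expR (- y)) (- expR (- x)).
Proof.
refine (derive_eq (derive_compose (g := fun y => - y) (is_derive_expR (- x)) (derive_opp (derive_idfun x))) _).
by rewrite mulrN1.
Qed.

Lemma is_derive_sigmoid x : is_derive x 1 sigmoid (bump x).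
Proof.
have e0 := expR_gt0 x.
have h : 1 + expR (- x) != 0 by rewrite gt_eqF// addr_gt0// expR_gt0.
refine (derive_eq (derive_inv (f := fun y => 1 + expR (- y)) h (derive_add (derive_cst 1 x) (is_derive_expRN x))) _).
by rewrite /bump sigmoidE expRN; field; rewrite !gt_eqF//; lra.
Qed.

(** The first and second derivatives of [bump], in the closed form that the logistic equation
    [s' = s (1 - s)] provides. The second factors lie in [[-1, 1]], so both are dominated by
    [bump]. *)
Definition bump1 x := bump x * (1 - 2 * sigmoid x).
Definition bump2 x := bump x * (1 - 6 * bump x).

Lemma is_derive_bump x : is_derive x 1 bump (bump1 x).
Proof.
have D := is_derive_sigmoid x.
refine (derive_eq (derive_mul D (derive_sub (derive_cst 1 x) D)) _).
by rewrite /bump1 /bump; ring.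
Qed.

Lemma is_derive_bump1 x : is_derive x 1 bump1 (bump2 x).
Proof.
have D := is_derive_sigmoid x.
refine (derive_eq (derive_mul (is_derive_bump x)
  (derive_sub (derive_cst 1 x) (derive_mul (derive_cst 2 x) D))) _).
by rewrite /bump2 /bump1 /bump; ring.
Qed.

Lemma bump1_bound x : `|bump1 x| <= bump x.
Proof.
have := bump_gt0 x; have := sigmoid_gt0 x; have := sigmoid_lt1 x => *.
by rewrite normrM gtr0_norm// -[leRHS]mulr1 ler_pM2l// ler_norml; apply/andP; split; lra.
Qed.

Lemma bump2_bound x : `|bump2 x| <= bump x.
Proof.
have := bump_gt0 x; have := bump_le x => *.
by rewrite normrM gtr0_norm// -[leRHS]mulr1 ler_pM2l// ler_norml; apply/andP; split; lra.
Qed.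

Lemma continuous_softplus : continuous softplus.
Proof. exact: derive_continuous is_derive_softplus. Qed.
Lemma continuous_sigmoid : continuous sigmoid.
Proof. exact: derive_continuous is_derive_sigmoid. Qed.
Lemma continuous_bump : continuous bump.
Proof. exact: derive_continuous is_derive_bump. Qed.
End Sigmoid.

(** * Integration over the real line *)

Section LineIntegrals.
Context {R : realType}.
Notation mu := (@lebesgue_measure R).
Implicit Types (f F : R -> R) (x y z c : R).

Lemma measurable_fun_shift c : measurable_fun (T := measurableTypeR R)
  (U := measurableTypeR R) [set: R] (fun x : R => x + c).
Proof. exact: measurable_funD. Qed.

(** Lebesgue measure is determined by its values on half-open intervals, where its image under the
    translation is computed. *)
Lemma lebesgue_measure_shift c (A : set (measurableTypeR R)) :
  measurable A -> mu ((fun x : R => x + c) @^-1` A) = mu A.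
Proof.
move=> mA; apply/esym.
refine (@lebesgue_measure_unique R
  (measure_function_pushforward__canonical__measure_function_Measure mu (measurable_fun_shift c)) _ A mA) => X /ocitvP[->|[[a b] /= ab ->]].
  by rewrite measure0 /= /pushforward preimage_set0 measure0.
rewrite /pushforward.
have -> : (fun x : R => x + c) @^-1` `]a, b] = `]a - c, b - c]%classic.
  by apply/seteqP; split => x /=; rewrite !in_itv/= ltrBlDr lerBrDr.
by rewrite !lebesgue_measure_itv/= !lte_fin ltrD2r ab -!EFinB; congr EFin; ring.
Qed.

Lemma ge0_integral_shift (f : R -> \bar R) c :
  measurable_fun [set: R] f -> (forall x, (0 <= f x)%E) ->
  (\int[mu]_x (f \o (fun y => y + c)%R) x = \int[mu]_x f x)%E.
Proof.
move=> mf f0.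
have h := ge0_integral_pushforward (measurable_fun_shift c) mu measurableT mf (fun x _ => f0 x).
rewrite preimage_setT in h; rewrite -h.
apply: eq_measure_integral; first exact: measurable_fun_shift.
move=> ? A mA _; exact: lebesgue_measure_shift.
Qed.

Notation itg f := (mu.-integrable [set: R] (EFin \o f)).

Lemma measurable_shift f c : measurable_fun [set: R] f ->
  measurable_fun [set: R] (fun x => f (x + c)).
Proof. by move=> mf; apply: measurableT_comp mf (measurable_fun_shift c). Qed.

Lemma integrable_shift f c : itg f -> itg (fun x => f (x + c)).
Proof.
move=> /integrableP[/measurable_EFinP mf foo]; apply/integrableP; split.
  by apply/measurable_EFinP; exact: measurable_shift.
rewrite (ge0_integral_shift (f := fun x => `|(f x)%:E|%E))//.
by apply/measurableT_comp => //; apply/measurable_EFinP.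
Qed.

Lemma Rintegral_shift f c : itg f ->
  \int[mu]_x f (x + c) = \int[mu]_x f x.
Proof.
move=> itf; rewrite /Rintegral; congr fine.
have mf : measurable_fun [set: R] (EFin \o f) by case/integrableP : itf.
rewrite [LHS]integralE [RHS]integralE.
have hp := ge0_integral_shift c (measurable_funepos mf) (funepos_ge0 (EFin \o f)).
have hn := ge0_integral_shift c (measurable_funeneg mf) (funeneg_ge0 (EFin \o f)).
by congr (_ - _)%E; [rewrite -[RHS]hp|rewrite -[RHS]hn]; apply: eq_integral => x _; rewrite /= ?funeposE ?funenegE.
Qed.

Lemma integral_FTC F f (r : R) : 0 <= r ->
  (forall x, is_derive x 1 F (f x)) -> continuous f ->
  (\int[mu]_(x in `[(- r)%R, r]) (f x)%:E = (F r - F (- r)%R)%:E)%E.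
Proof.
rewrite le_eqVlt => /predU1P[<- _ _|r0 DF cf].
  by rewrite oppr0 set_itv1 integral_set1 subrr.
have cF : continuous F := derive_continuous DF.
rewrite (@continuous_FTC2 _ _ F)//.
- lra.
- exact: continuous_subspaceT.
- split; last 2 first.
  + by apply: cvg_at_right_filter; exact: cF.
  + by apply: cvg_at_left_filter; exact: cF.
  + by move=> x _; case: (DF x).
- by move=> x _; exact: derive1_is_derive.
Qed.

Lemma near_in_symitv x : \forall n \near \oo, `[(- n%:R : R), n%:R]%classic x.
Proof.
near=> n; rewrite /= in_itv/=.
have : `|x| <= n%:R by near: n; exact: nbhs_infty_ger.
by rewrite ler_norml.
Unshelve. all: by end_near. Qed.

Lemma cvg_integral_FTC F f : (forall x, is_derive x 1 F (f x)) ->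
  continuous f -> (forall x, 0 <= f x) ->
  (F n%:R - F (- n%:R))%:E @[n --> \oo] --> (\int[mu]_x (f x)%:E)%E.
Proof.
move=> DF cf f0.
pose g (n : nat) x := ((f \_ `[(- n%:R : R), n%:R]) x)%:E.
have mf : measurable_fun [set: R] f by exact: continuous_measurable_fun.
have gE n : (\int[mu]_x g n x = (F n%:R - F (- n%:R))%:E)%E.
  rewrite -(integral_FTC _ DF cf)// [RHS]integral_mkcond.
  by apply: eq_integral => x _; rewrite /g restrict_EFin.
rewrite (_ : (fun n => _) = (fun n => \int[mu]_x g n x)%E); last exact/funext.
have -> : (\int[mu]_x (f x)%:E = \int[mu]_x (fun x => limn (g ^~ x)) x)%E.
  apply: eq_integral => x _; apply/esym/cvg_lim => //.
  apply: cvg_near_cst; apply: filterS (near_in_symitv x) => n xn.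
  by rewrite /g patchT// inE.
apply: cvg_monotone_convergence => //.
- move=> n; apply/measurable_EFinP/(measurable_restrictT f) => //.
  exact: measurable_funTS.
- by move=> n x _; rewrite lee_fin /patch; case: ifP.
- move=> x _ m n mn; rewrite lee_fin /patch; case: ifPn => [xm|_]; last by case: ifP.
  case: ifPn => // /negP; rewrite !inE/= in xm *; case.
  have mnR : m%:R <= n%:R :> R by rewrite ler_nat.
  by move: xm; rewrite !in_itv/=; lra.
Qed.

Lemma ge0_integral_FTC_le F f (b : R) : (forall x, is_derive x 1 F (f x)) ->
  continuous f -> (forall x, 0 <= f x) -> (forall x y, F x - F y <= b) ->
  (\int[mu]_x (f x)%:E <= b%:E)%E.
Proof.
move=> DF cf f0 Fb; have h := cvg_integral_FTC DF cf f0.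
rewrite -(cvg_lim _ h)//; apply: lime_le; first exact: cvgP h.
by apply: nearW => n; rewrite lee_fin.
Qed.

(** Dominated convergence along [[-n, n]]. It serves for primitives that carry the weight and hence
    vanish at both ends. *)
Lemma Rintegral_FTC_eq0 F f : (forall x, is_derive x 1 F (f x)) ->
  continuous f -> itg f -> F n%:R @[n --> \oo] --> (0 : R) ->
  F (- n%:R) @[n --> \oo] --> (0 : R) -> \int[mu]_x f x = 0.
Proof.
move=> DF cf itf Fy FNy.
pose g (n : nat) x := ((f \_ `[(- n%:R : R), n%:R]) x)%:E.
have mf : measurable_fun [set: R] f by exact: continuous_measurable_fun.
have gE n : (\int[mu]_x g n x = (F n%:R - F (- n%:R))%:E)%E.
  rewrite -(integral_FTC _ DF cf)// [RHS]integral_mkcond.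
  by apply: eq_integral => x _; rewrite /g restrict_EFin.
have [_ _] : [/\ mu.-integrable [set: R] (EFin \o f),
   (\int[mu]_x `|g n x - (f x)%:E|)%E @[n --> \oo] --> 0%E &
   (\int[mu]_x g n x)%E @[n --> \oo] --> (\int[mu]_x (f x)%:E)%E].
  apply: (@dominated_convergence _ _ _ mu _ measurableT g _ (fun x => `|(f x)%:E|%E)) => //.
  - move=> n; apply/measurable_EFinP/(measurable_restrictT f) => //.
    exact: measurable_funTS.
  - exact/measurable_EFinP.
  - apply: aeW => x _; apply: cvg_near_cst; apply: filterS (near_in_symitv x) => n xn.
    by rewrite /g patchT// inE.
  - exact: integrable_abse.
  - apply: aeW => x n _; rewrite lee_fin /patch; case: ifP => // _.
    by rewrite normr0.
rewrite (_ : (fun n => _) = (fun n => (F n%:R - F (- n%:R))%:E)); last exact/funext.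
move=> h.
have h0 : (F n%:R - F (- n%:R))%:E @[n --> \oo] --> (0 : R)%:E.
  apply: cvg_EFin; first exact: nearW.
  by rewrite -[X in _ --> X]subr0; exact: cvgB.
by rewrite /Rintegral -(cvg_lim _ h)// (cvg_lim _ h0).
Qed.

End LineIntegrals.

(** * Mean values and first-order Taylor remainders *)

Section Taylor.
Context {R : realType}.
Notation mu := (@lebesgue_measure R).
Implicit Types (f F : R -> R) (x y z c : R).

(** The increment [z] of the singular integral has either sign, hence [Num.min] and [Num.max]. The
    position of the intermediate point, and not only its distance to [x], is what monotonicity
    arguments on [sigmoid] use. *)
Lemma mean_value f f' x z : (forall y, is_derive y 1 f (f' y)) ->
  exists y, [/\ Num.min x (x + z) <= y, y <= Num.max x (x + z) & f (x + z) - f x = f' y * z].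
Proof.
move=> Df; have cf : continuous f := derive_continuous Df.
have [z0|z0] := leP 0 z.
  have xz : x <= x + z by lra.
  have [y] := MVT_segment xz (fun y _ => Df y) (continuous_subspaceT cf).
  rewrite in_itv/= => /andP[y1 y2] ->; exists y.
  by rewrite (min_idPl xz) (max_idPr xz); split=> //; congr (_ * _); ring.
have xz : x + z <= x by lra.
have [y] := MVT_segment xz (fun y _ => Df y) (continuous_subspaceT cf).
rewrite in_itv/= => /andP[y1 y2] h; exists y.
rewrite (min_idPr xz) (max_idPl xz); split=> //.
by rewrite -[LHS]opprB h; ring.
Qed.

Lemma between_dist x y z : Num.min x (x + z) <= y -> y <= Num.max x (x + z) ->
  `|y - x| <= `|z|.
Proof.
rewrite ler_norml ge_min le_max => /orP h1 /orP h2.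
have := ler_norm z; have := ler_norm (- z); rewrite normrN => *.
by apply/andP; split; case: h1; case: h2; have := normr_ge0 z; lra.
Qed.

Lemma mean_value_dist f f' x z : (forall y, is_derive y 1 f (f' y)) ->
  exists2 y, `|y - x| <= `|z| & f (x + z) - f x = f' y * z.
Proof.
by move=> /(mean_value x z)[y [y1 y2 h]]; exists y => //; exact: between_dist.
Qed.

(** The numerator of the integrand of Lambda^alpha. The derivative is a separate argument, so that
    product and convexity formulas become algebraic identities in [f] and [f']. *)
Definition taylor1 f f' x z : R := f (x + z) - f x - f' x * z.

(** Two applications of the mean value theorem. They give [B] where Taylor's formula would give
    [B / 2], and they ask for a bound on [f''] only within distance |z| of [x]. *)
Lemma taylor1_le2 f f' f'' (B : R) x z : (forall y, is_derive y 1 f (f' y)) ->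
  (forall y, is_derive y 1 f' (f'' y)) ->
  (forall y, `|y - x| <= `|z| -> `|f'' y| <= B) ->
  `|taylor1 f f' x z| <= B * z ^+ 2.
Proof.
move=> Df Df' HB; rewrite /taylor1.
have [y yx ->] := mean_value_dist x z Df; rewrite -mulrBl normrM.
have [y' yx' h] := mean_value_dist x (y - x) Df'.
have -> : f' y - f' x = f'' y' * (y - x) by rewrite -h; congr (f' _ - _); ring.
have yz' : `|y' - x| <= `|z| by exact: le_trans yx' yx.
rewrite normrM -(real_normK (num_real z)) expr2 mulrA ler_wpM2r//.
by rewrite ler_pM// HB.
Qed.

Lemma lipschitz_derive f f' (B : R) x z : (forall y, is_derive y 1 f (f' y)) ->
  (forall y, `|f' y| <= B) -> `|f (x + z) - f x| <= B * `|z|.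
Proof.
by move=> Df HB; have [y _ ->] := mean_value_dist x z Df; rewrite normrM ler_wpM2r.
Qed.

Lemma taylor1_le1 f f' (B : R) x z : (forall y, is_derive y 1 f (f' y)) ->
  (forall y, `|f' y| <= B) -> `|taylor1 f f' x z| <= 2 * B * `|z|.
Proof.
move=> Df HB; rewrite /taylor1 (le_trans (ler_normB _ _))//.
rewrite [2 * B]mulr_natl mulr2n mulrDl lerD ?(lipschitz_derive _ _ Df)//.
by rewrite normrM ler_wpM2r.
Qed.

End Taylor.

(** * Integrals of the logistic weight *)

Section BumpIntegrals.
Context {R : realType}.
Notation mu := (@lebesgue_measure R).
Notation itg f := (mu.-integrable [set: R] (EFin \o f)).
Implicit Types (f F : R -> R) (l b x y z c : R).

Lemma derive_affine l b x : is_derive x 1 (fun y => l * y + b) l.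
Proof.
refine (derive_eq (derive_add (derive_mul (derive_cst l x) (derive_idfun x)) (derive_cst b x)) _).
by ring.
Qed.

Lemma continuous_affine l b : continuous (fun y : R => l * y + b).
Proof. exact: derive_continuous (derive_affine l b). Qed.

Lemma continuous_bump_affine l b : continuous (fun x => bump (l * x + b)).
Proof.
move=> x; apply: (@continuous_comp _ _ _ (fun y => l * y + b) bump).
  exact: continuous_affine.
exact: continuous_bump.
Qed.

Lemma is_derive_sigmoid_affine l b x : l != 0 ->
  is_derive x 1 (fun y => l^-1 * sigmoid (l * y + b)) (bump (l * x + b)).
Proof.
move=> l0.
refine (derive_eq (derive_mul (derive_cst l^-1 x)
  (derive_compose (g := fun y => l * y + b) (is_derive_sigmoid _) (derive_affine l b x))) _).
by field.
Qed.

Lemma sigmoid_cvg1 l b : 0 < l -> sigmoid (l * n%:R + b) @[n --> \oo] --> (1 : R).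
Proof.
move=> l0.
have h : expR (- (l * n%:R + b)) @[n --> \oo] --> (0 : R).
  apply/cvgrPdist_le => e e0; near=> n.
  rewrite sub0r normrN gtr0_norm ?expR_gt0// -[e]lnK ?posrE// ler_expR.
  have : (- ln e - b) / l <= n%:R by near: n; exact: nbhs_infty_ger.
  by rewrite ler_pdivrMr//; lra.
have -> : nbhs (1 : R) = nbhs ((1 + 0)^-1 : R) by rewrite addr0 invr1.
apply: cvgV; first by rewrite addr0 oner_neq0.
by apply: cvgD => //; exact: cvg_cst.
Unshelve. all: by end_near. Qed.

Lemma sigmoid_cvg0 l b : 0 < l -> sigmoid (l * - n%:R + b) @[n --> \oo] --> (0 : R).
Proof.
move=> l0; have h := sigmoid_cvg1 (- b) l0.
have -> : (fun n => sigmoid (l * - n%:R + b)) = (fun n => 1 - sigmoid (l * n%:R + - b)).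
  by apply/funext => n; rewrite onem_sigmoid; congr sigmoid; ring.
have -> : nbhs (0 : R) = nbhs (1 - 1 : R) by rewrite subrr.
by apply: cvgB => //; exact: cvg_cst.
Qed.

Lemma integral_bump l b : 0 < l -> (\int[mu]_x (bump (l * x + b))%:E = (l^-1)%:E)%E.
Proof.
move=> l0; have ln0 : l != 0 by rewrite gt_eqF.
have h := cvg_integral_FTC (fun x => is_derive_sigmoid_affine b x ln0)
  (@continuous_bump_affine l b) (fun x => ltW (bump_gt0 _)).
rewrite -(cvg_lim _ h)//; apply/cvg_lim => //; apply: cvg_EFin; first exact: nearW.
rewrite /comp/=.
have -> : nbhs (l^-1) = nbhs (l^-1 * 1 - l^-1 * 0) by congr nbhs; ring.
by apply: cvgB; apply: cvgM; [exact: cvg_cst|exact: sigmoid_cvg1|exact: cvg_cst|exact: sigmoid_cvg0].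
Qed.

Lemma measurable_continuous f : continuous f -> measurable_fun [set: R] f.
Proof. exact: continuous_measurable_fun. Qed.

Lemma integrable_bump l b : 0 < l -> itg (fun x => bump (l * x + b)).
Proof.
move=> l0; apply/integrableP; split.
  by apply/measurable_EFinP; apply: measurable_continuous; exact: continuous_bump_affine.
under eq_integral do rewrite /= ger0_norm ?ltW ?bump_gt0//.
by rewrite integral_bump// ltry.
Qed.

(** A monotone function of total variation 1 moves in L1 by the length of the shift. The primitive
    is an increment of [softplus], which lies between 0 and [z]. *)
Lemma integral_sigmoid_incr b z : 0 <= z ->
  (\int[mu]_x (sigmoid (x + b + z) - sigmoid (x + b))%:E <= z%:E)%E.
Proof.
move=> z0.
have D c x : is_derive x 1 (fun y => softplus (y + c)) (sigmoid (x + c)).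
  refine (derive_eq (derive_compose (g := fun y => y + c) (is_derive_softplus _)
    (derive_add (derive_idfun x) (derive_cst c x))) _).
  by ring.
have Cs c : continuous (fun y : R => sigmoid (y + c)).
  move=> x; apply: (@continuous_comp _ _ _ (fun y => y + c) sigmoid).
    by apply: cvgD; [exact: cvg_id|exact: cvg_cst].
  exact: continuous_sigmoid.
have sz x : sigmoid x <= sigmoid (x + z).
  have [y _ h] := mean_value_dist x z (@is_derive_sigmoid R).
  by rewrite -subr_ge0 h mulr_ge0// ltW// bump_gt0.
apply: (@ge0_integral_FTC_le _ (fun y => softplus (y + (b + z)) - softplus (y + b))).
- by move=> x; rewrite -addrA; apply: derive_sub.
- by move=> x; apply: cvgB; [rewrite -(addrA x); under eq_fun do rewrite -addrA; exact: Cs|exact: Cs].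
- by move=> x; rewrite subr_ge0.
- have h x : 0 <= softplus (x + (b + z)) - softplus (x + b) <= z.
    rewrite addrA; have [y _ ->] := mean_value_dist (x + b) z (@is_derive_softplus R).
    by rewrite mulr_ge0 ?(ltW (sigmoid_gt0 _))//= ler_piMl// ltW// sigmoid_lt1.
  by move=> x y; have := h x; have := h y; lra.
Qed.

Lemma is_derive_bump_affine l b x :
  is_derive x 1 (fun y => bump (l * y + b)) (l * bump1 (l * x + b)).
Proof.
refine (derive_eq (derive_compose (g := fun y => l * y + b) (is_derive_bump _) (derive_affine l b x)) _).
by ring.
Qed.

Lemma is_derive_bump1_affine l b x :
  is_derive x 1 (fun y => l * bump1 (l * y + b)) (l ^+ 2 * bump2 (l * x + b)).
Proof.
refine (derive_eq (derive_mul (derive_cst l x)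
  (derive_compose (g := fun y => l * y + b) (is_derive_bump1 _) (derive_affine l b x))) _).
by ring.
Qed.

Lemma expR1_le4 : expR 1 <= 4 :> R.
Proof.
have h := @expR_ge1Dx R (- 2^-1).
have -> : expR 1 = (expR (- 2^-1) ^+ 2)^-1 :> R.
  by rewrite -expRM_natl -expRN; congr expR; field.
rewrite -[X in _ <= X]invrK; rewrite lef_pV2 ?posrE ?exprn_gt0 ?expR_gt0// expr2; nra.
Qed.

(** If [l |z| <= 1], the second derivative controls the remainder, and [bump] varies by at most a
    factor [expR 1 <= 4] over the distance concerned. If [l |z| > 1], the three terms are bounded
    separately, with total [(2 + l |z|) / l <= 3 |z|]. *)
Lemma integral_taylor1_bump l b z : 0 < l ->
  (\int[mu]_x `|taylor1 (fun y => bump (l * y + b)) (fun y => l * bump1 (l * y + b)) x z|%:E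
   <= (4 * Num.min `|z| (l * z ^+ 2))%:E)%E.
Proof.
move=> l0.
set f := fun y => bump (l * y + b); set f' := fun y => l * bump1 (l * y + b).
have cf : continuous f := @continuous_bump_affine l b.
have cf' : continuous f' := derive_continuous (is_derive_bump1_affine l b).
have mt : measurable_fun [set: R] (fun x => `|taylor1 f f' x z|).
  apply: measurableT_comp => //; apply: measurable_funB.
    apply: measurable_funB; last exact: measurable_continuous.
    by apply: measurable_shift; exact: measurable_continuous.
  by apply: measurable_funM => //; exact: measurable_continuous.
have mb k c : measurable_fun [set: R] (fun x => (k * bump (l * x + c))%:E).
  apply/measurable_EFinP; apply: measurable_funM => //.
  by apply: measurable_continuous; exact: continuous_bump_affine.
have ib k c : 0 <= k -> (\int[mu]_x (k * bump (l * x + c))%:E = (k * l^-1)%:E)%E.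
  move=> k0; under eq_integral do rewrite EFinM.
  rewrite ge0_integralZl//.
  - by rewrite integral_bump.
  - by apply/measurable_EFinP; apply: measurable_continuous; exact: continuous_bump_affine.
  - by move=> x _; rewrite lee_fin ltW// bump_gt0.
have [lz|lz] := leP (l * `|z|) 1.
  have e3 : expR 1 <= 4 :> R by exact: expR1_le4.
  apply: (@le_trans _ _ (\int[mu]_x ((4 * l ^+ 2 * z ^+ 2) * bump (l * x + b))%:E)%E).
    apply: ge0_le_integral => //; [by apply/measurable_EFinP|exact: mb|].
    move=> x _; rewrite lee_fin.
    have -> : 4 * l ^+ 2 * z ^+ 2 * bump (l * x + b) = (l ^+ 2 * (bump (l * x + b) * 4)) * z ^+ 2 by ring.
    apply: (@taylor1_le2 R f f' (fun y => l ^+ 2 * bump2 (l * y + b)) _ x z).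
    + exact: is_derive_bump_affine.
    + exact: is_derive_bump1_affine.
    + move=> y yx; rewrite normrM ger0_norm ?sqr_ge0// ler_wpM2l ?sqr_ge0//.
      apply: le_trans (bump2_bound _) _.
      have -> : l * y + b = (l * x + b) + l * (y - x) by ring.
      apply: le_trans (bump_shift _ _) _; rewrite mulrC ler_wpM2l ?(ltW (bump_gt0 _))//.
      apply: le_trans e3; rewrite ler_expR normrM gtr0_norm//.
      by apply: le_trans lz; rewrite ler_wpM2l// ltW.
  rewrite ib; last by apply: mulr_ge0; [apply: mulr_ge0|]; rewrite ?sqr_ge0.
  rewrite lee_fin.
  have -> : 4 * l ^+ 2 * z ^+ 2 / l = 4 * (l * z ^+ 2) by field; rewrite gt_eqF.
  rewrite ler_pM2l// le_min lexx andbT -(real_normK (num_real z)).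
  by rewrite expr2 mulrA ler_piMl.
apply: (@le_trans _ _ (\int[mu]_x ((1 * bump (l * x + (l * z + b)))%:E
    + ((1 + l * `|z|) * bump (l * x + b))%:E))%E).
  apply: ge0_le_integral => //.
  - by apply/measurable_EFinP.
  - by apply: emeasurable_funD; exact: mb.
  - move=> x _; rewrite -EFinD lee_fin /taylor1 mul1r mulrDl mul1r addrA.
    apply: le_trans (ler_normB _ _) _; apply: lerD.
      apply: le_trans (ler_normB _ _) _.
      rewrite /f !gtr0_norm ?bump_gt0// lerD2r.
      by rewrite le_eqVlt; apply/orP; left; apply/eqP; congr bump; ring.
    rewrite /f' 2!normrM (gtr0_norm l0) mulrAC.
    by apply: ler_wpM2l; [rewrite mulr_ge0// ltW|exact: bump1_bound].
have lz0 : 0 <= 1 + l * `|z| by rewrite addr_ge0// mulr_ge0// ltW.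
rewrite ge0_integralD//; first rewrite !ib//.
all: try by move=> x _; rewrite lee_fin mulr_ge0// ltW// bump_gt0.
all: try exact: mb.
rewrite -EFinD lee_fin -mulrDl ler_pdivrMr// (_ : 4 * _ * l = 4 * (Num.min `|z| (l * z ^+ 2) * l)); last by ring.
have -> : Num.min `|z| (l * z ^+ 2) = `|z|.
  apply/min_idPl; rewrite -(real_normK (num_real z)) expr2 mulrA ler_peMl//.
  exact: ltW.
by rewrite [`|z| * l]mulrC; lra.
Qed.

End BumpIntegrals.

(** * The kernel of the fractional Laplacian *)

Section Kernel.
Context {R : realType}.
Notation mu := (@lebesgue_measure R).
Notation itg f := (mu.-integrable [set: R] (EFin \o f)).
Implicit Types (f F h J : R -> R) (a b s x y z c : R).

Lemma measurable_fun_opp : measurable_fun (T := measurableTypeR R)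
  (U := measurableTypeR R) [set: R] (fun x : R => - x).
Proof. exact: oppr_measurable. Qed.

Lemma lebesgue_measure_opp (A : set (measurableTypeR R)) :
  measurable A -> mu ((fun x : R => - x) @^-1` A) = mu A.
Proof.
move=> mA; apply/esym.
refine (@lebesgue_measure_unique R
  (measure_function_pushforward__canonical__measure_function_Measure mu measurable_fun_opp) _ A mA) => X.
move=> /ocitvP[->|[[p q] /= pq ->]].
  by rewrite measure0 /= /pushforward preimage_set0 measure0.
rewrite /= /pushforward.
have -> : (fun x : R => - x) @^-1` `]p, q] = `[- q, - p[%classic.
  by apply/seteqP; split => x /=; rewrite !in_itv/=; lra.
by rewrite !lebesgue_measure_itv/= !lte_fin ltrN2 pq -!EFinB; congr EFin; ring.
Qed.

Lemma ge0_integral_opp (f : R -> \bar R) :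
  measurable_fun [set: R] f -> (forall x, (0 <= f x)%E) ->
  (\int[mu]_x (f \o (fun y => - y)%R) x = \int[mu]_x f x)%E.
Proof.
move=> mf f0.
have h := ge0_integral_pushforward measurable_fun_opp mu measurableT mf (fun x _ => f0 x).
rewrite preimage_setT in h; rewrite -h.
apply: eq_measure_integral; first exact: measurable_fun_opp.
move=> ? A mA _; exact: lebesgue_measure_opp.
Qed.

Lemma ge0_integral_halves (f : R -> \bar R) (B : \bar R) :
  measurable_fun [set: R] f -> (forall x, (0 <= f x)%E) ->
  (\int[mu]_(x in `]0%R, +oo[) f x <= B)%E ->
  (\int[mu]_(x in `]0%R, +oo[) (f \o (fun y => - y)%R) x <= B)%E ->
  (\int[mu]_x f x <= B + B)%E.
Proof.
move=> mf f0 h1 h2.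
have -> : [set: R] = `]-oo, 0%R] `|` `]0%R, +oo[.
  by rewrite itv_setU_setT.
rewrite ge0_integral_setU//=; last 2 first.
- exact: measurable_funTS.
- apply/disj_setPS => x /=; rewrite !in_itv/= andbT; lra.
apply: leeD => //; apply: le_trans h2; rewrite le_eqVlt; apply/orP; left; apply/eqP.
rewrite -integral_itv_bndo_bndc//; last exact: measurable_funTS.
rewrite integral_mkcond [in RHS]integral_mkcond -ge0_integral_opp; last 2 first.
- apply/(measurable_restrictT f) => //; exact: measurable_funTS.
- by move=> x; apply: erestrict_ge0.
apply: eq_integral => x _ /=; rewrite /patch.
have -> : ((- x)%R \in `]-oo, 0%R[%classic) = (x \in `]0%R, +oo[%classic).
  by rewrite !mem_setE !in_itv/= andbT oppr_lt0.
by [].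
Qed.

Lemma integral_powR_segment_le h (c e p q : R) : 0 < p -> p < q -> 0 <= c -> e != 0 ->
  measurable_fun [set: R] h -> (forall z, 0 <= h z) ->
  (forall z, p <= z <= q -> h z <= c * z `^ (e - 1)) ->
  (\int[mu]_(z in `[p, q]) (h z)%:E <= (c * (q `^ e - p `^ e) / e)%:E)%E.
Proof.
move=> p0 pq c0 e0 mh h0 hle.
pose F z := c / e * z `^ e.
have DF z : 0 < z -> is_derive z 1 F (c * z `^ (e - 1)).
  move=> z0; refine (derive_eq (derive_mul (derive_cst (c / e) z) (is_derive1_powR e z0)) _).
  by field.
have DG z : 0 < z -> is_derive z 1 (fun y => c * y `^ (e - 1)) (c * ((e - 1) * z `^ (e - 1 - 1))).
  move=> z0; refine (derive_eq (derive_mul (derive_cst c z) (is_derive1_powR (e-1) z0)) _).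
  by ring.
have cF z : 0 < z -> {for z, continuous F}.
  by move=> z0; apply/differentiable_continuous/derivable1_diffP; case: (DF z z0).
have cG : {within `[p, q], continuous (fun y => c * y `^ (e - 1))}.
  apply: continuous_in_subspaceT => z; rewrite mem_setE in_itv/= => /andP[pz _].
  have z0 : 0 < z by lra.
  by apply/differentiable_continuous/derivable1_diffP; case: (DG z z0).
have FTC : (\int[mu]_(z in `[p, q]) (c * z `^ (e - 1))%:E = (F q - F p)%:E)%E.
  rewrite (@continuous_FTC2 _ _ F)//.
  - split.
    + by move=> z; rewrite in_itv/= => /andP[pz _]; case: (DF z _) => //; lra.
    + by apply: cvg_at_right_filter; exact: cF.
    + by apply: cvg_at_left_filter; apply: cF; lra.
  - move=> z; rewrite in_itv/= => /andP[pz _]; apply: derive1_is_derive; apply: DF; lra.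
have -> : c * (q `^ e - p `^ e) / e = F q - F p by rewrite /F; field.
rewrite -FTC; apply: ge0_le_integral => //.
- by move=> z _; rewrite lee_fin.
- by apply/measurable_EFinP; exact: measurable_funTS.
- apply/measurable_EFinP; apply: measurable_funTS.
  by apply: measurable_funM => //; exact: measurable_powR.
Qed.

(** The bound with [a] is integrated beyond [s], the one with [b] below it; [1 < al < 2] makes both
    integrals converge. *)
Lemma half_kernel_integral h (al s a b : R) : 1 < al < 2 -> 0 < s -> 0 <= a -> 0 <= b ->
  measurable_fun [set: R] h -> (forall z, 0 <= h z) ->
  (forall z, 0 < z -> h z <= a * z `^ (1 - al - 1)) ->
  (forall z, 0 < z -> h z <= b * z `^ (2 - al - 1)) ->
  (\int[mu]_(z in `]0%R, +oo[) (h z)%:E <=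
    (a * s `^ (1 - al) / (al - 1) + b * s `^ (2 - al) / (2 - al))%:E)%E.
Proof.
move=> /andP[al1 al2] s0 a0 b0 mh h0 ha hb.
(* Segments on which the powers are smooth exhaust the half-line. The shifts [n.+2] and [n.+1] keep
   [s] strictly inside already for [n = 0]. *)
pose F (n : nat) : set R := `[s / n.+2%:R, s + n.+1%:R]%classic.
have Fs (n : nat) : 0 < s / n.+2%:R < s.
  rewrite divr_gt0//= ltr_pdivrMr// ltr_pMr// ltr1n//.
have -> : `]0%R, +oo[%classic = \bigcup_n F n :> set R.
  apply/seteqP; split=> z /=; last first.
    by move=> [n _]; rewrite /F/= !in_itv/= andbT => /andP[g _]; have /andP[q0 _] := Fs n; exact: lt_le_trans q0 g.
  rewrite in_itv/= andbT => z0.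
  have [n nz] : exists n, s / z + z <= n%:R :> R.
    by exists (Num.truncn (s / z + z)).+1; rewrite ltW// truncnS_gt.
  have sz0 : 0 < s / z by rewrite divr_gt0.
  have n2 : n%:R + 2 = n.+2%:R :> R by rewrite -[n.+2]addn2 natrD.
  have n1 : n%:R + 1 = n.+1%:R :> R by rewrite -[n.+1]addn1 natrD.
  exists n => //; rewrite /F/= in_itv/= ler_pdivrMr// mulrC -ler_pdivrMr// -n2 -n1.
  by apply/andP; split; lra.
have cv := @ge0_nondecreasing_set_cvg_integral _ (measurableTypeR R) _ F (EFin \o h) mu.
have mF i : measurable (F i) by exact: measurable_itv.
have {cv} cv : (\int[mu]_(x in F i) (h x)%:E)%E @[i --> \oo] -->
    (\int[mu]_(x in \bigcup_i F i) (h x)%:E)%E.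
  apply: cv => //.
  - apply/nondecreasing_seqP => n; rewrite subsetEset => z; rewrite /F/= !in_itv/=.
    have h1 : n.+1%:R <= n.+2%:R :> R by rewrite ler_nat.
    have h2 : s / n.+3%:R <= s / n.+2%:R by rewrite ler_pM2l// lef_pV2 ?posrE// ler_nat.
    move=> /andP[g1 g2]; rewrite (le_trans h2 g1) (le_trans g2)//; lra.
  - by move=> i; apply/measurable_EFinP; exact: measurable_funTS.
  - by move=> i x _; rewrite lee_fin.
rewrite -(cvg_lim _ cv)//; apply: lime_le; first exact: cvgP cv.
apply: nearW => n; have /andP[Fs0 Fs1] := Fs n.
have sM : s < s + n.+1%:R by rewrite ltrDl.
rewrite /F; set q := s / _ in Fs0 Fs1 *; set r := s + _ in sM *.
have e1 : (\int[mu]_(x in `[q, r]) (h x)%:E <= \int[mu]_(x in `[q, s]) (h x)%:E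
   + \int[mu]_(x in `[s, r]) (h x)%:E)%E.
  have -> : `[q, r]%classic = `[q, s[ `|` `[s, r].
    by apply/seteqP; split=> z /=; rewrite !in_itv/=; lra.
  rewrite ge0_integral_setU//=.
  - rewrite leeD2r// ge0_subset_integral//.
    + by apply/measurable_EFinP; exact: measurable_funTS.
    + by move=> x _; rewrite lee_fin.
    + by move=> z /=; rewrite !in_itv/=; lra.
  - by apply/measurable_EFinP; exact: measurable_funTS.
  - by move=> x _; rewrite lee_fin.
  - by apply/disj_setPS => z /=; rewrite !in_itv/=; lra.
apply: (le_trans e1); rewrite EFinD addeC.
apply: leeD.
  apply: le_trans (integral_powR_segment_le (e := 1 - al) s0 sM a0 _ mh h0 _) _.
  - by rewrite subr_eq0 lt_eqF.
  - by move=> z /andP[sz _]; apply: ha; lra.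
  rewrite lee_fin -subr_ge0.
  have -> : a * s `^ (1 - al) / (al - 1) - a * (r `^ (1 - al) - s `^ (1 - al)) / (1 - al)
     = a * r `^ (1 - al) / (al - 1).
    by field; apply/andP; split; apply/eqP => ?; lra.
  by rewrite divr_ge0 ?mulr_ge0 ?powR_ge0//; lra.
apply: le_trans (integral_powR_segment_le (e := 2 - al) Fs0 Fs1 b0 _ mh h0 _) _.
- by rewrite subr_eq0 gt_eqF.
- by move=> z /andP[sz _]; apply: hb; lra.
rewrite lee_fin ler_pM2r ?invr_gt0; last by lra.
by rewrite ler_wpM2l// lerBlDr lerDl powR_ge0.
Qed.

Definition kernel (al z : R) : R := (`|z| `^ (1 + al))^-1.

Lemma kernel_ge0 al z : 0 <= kernel al z.
Proof. by rewrite invr_ge0 powR_ge0. Qed.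

Lemma measurable_kernel al : measurable_fun [set: R] (kernel al).
Proof.
have -> : kernel al = (fun z => `|z| `^ (- (1 + al))).
  by apply/funext => z; rewrite powRN.
by apply: (measurableT_comp (measurable_powR _)).
Qed.

Definition kernel_cst (al : R) : R := 2 * ((al - 1)^-1 + (2 - al)^-1).

Lemma kernel_cst_gt0 al : 1 < al < 2 -> 0 < kernel_cst al.
Proof. by move=> /andP[? ?]; rewrite mulr_gt0// addr_gt0// invr_gt0; lra. Qed.

(** The splitting point [s] stays free: it will be 1 in crude bounds, [l^-1] against the weight of
    parameter [l], and [tau] for the profile. *)
Lemma integral_kernel_le J (al s a b : R) : 1 < al < 2 -> 0 < s -> 0 <= a -> 0 <= b ->
  measurable_fun [set: R] J -> (forall z, 0 <= J z) ->
  (forall z, J z <= a * `|z|) -> (forall z, J z <= b * z ^+ 2) ->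
  (\int[mu]_z (J z * kernel al z)%:E <=
    (kernel_cst al * (a * s `^ (1 - al) + b * s `^ (2 - al)))%:E)%E.
Proof.
move=> al12 s0 a0 b0 mJ J0 Ja Jb; have /andP[al1 al2] := al12.
have mh : measurable_fun [set: R] (fun z => J z * kernel al z).
  by apply: measurable_funM => //; exact: measurable_kernel.
have h0 z : 0 <= J z * kernel al z by rewrite mulr_ge0// kernel_ge0.
have kE z : z != 0 -> kernel al z = kernel al (- z) /\
    (0 < z -> z * kernel al z = z `^ (1 - al - 1) /\ z ^+ 2 * kernel al z = z `^ (2 - al - 1)).
  move=> z0; split; first by rewrite /kernel normrN.
  move=> zp; rewrite /kernel gtr0_norm//.
  have -> : 1 - al - 1 = 1 - (1 + al) by ring.
  have -> : 2 - al - 1 = 2%:R - (1 + al) by ring.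
  have pB r : z `^ (r - (1 + al)) = z `^ r / z `^ (1 + al) by rewrite powRB// z0 implybT.
  by rewrite !pB powRr1 ?ltW// powR_mulrn// ltW.
set B := a * s `^ (1 - al) / (al - 1) + b * s `^ (2 - al) / (2 - al).
have hB : (\int[mu]_z (J z * kernel al z)%:E <= B%:E + B%:E)%E.
  apply: ge0_integral_halves.
  - exact/measurable_EFinP.
  - by move=> z; rewrite lee_fin.
  - apply: half_kernel_integral => // z z0.
    + have [|_ /(_ z0)[<- _]] := kE z; rewrite ?gt_eqF//.
      by rewrite mulrA ler_wpM2r ?kernel_ge0// (le_trans (Ja z))// gtr0_norm.
    + have [|_ /(_ z0)[_ <-]] := kE z; rewrite ?gt_eqF//.
      by rewrite mulrA ler_wpM2r ?kernel_ge0.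
  - rewrite /comp; apply: (@half_kernel_integral (fun z => J (- z) * kernel al (- z))) => //.
    + exact: (measurableT_comp mh).
    + move=> z z0; have [|<- /(_ z0)[<- _]] := kE z; rewrite ?gt_eqF//.
      by rewrite mulrA ler_wpM2r ?kernel_ge0// (le_trans (Ja _))// normrN gtr0_norm.
    + move=> z z0; have [|<- /(_ z0)[_ <-]] := kE z; rewrite ?gt_eqF//.
      by rewrite mulrA ler_wpM2r ?kernel_ge0// (le_trans (Jb _))// sqrrN.
apply: (le_trans hB); rewrite -EFinD lee_fin /B /kernel_cst.
have i1 : 0 < (al - 1)^-1 by rewrite invr_gt0; lra.
have i2 : 0 < (2 - al)^-1 by rewrite invr_gt0; lra.
have := mulr_ge0 a0 (powR_ge0 s (1 - al)); have := mulr_ge0 b0 (powR_ge0 s (2 - al)).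
set p := a * _; set q := b * _ => q0 p0.
have := mulr_ge0 q0 (ltW i1); have := mulr_ge0 p0 (ltW i2); lra.
Qed.

Lemma integrable_kernel J (al a b : R) : 1 < al < 2 -> 
  measurable_fun [set: R] J ->
  (forall z, `|J z| <= a * `|z|) -> (forall z, `|J z| <= b * z ^+ 2) ->
  itg (fun z => J z * kernel al z).
Proof.
move=> al12 mJ Ja Jb; apply/integrableP; split.
  by apply/measurable_EFinP/measurable_funM => //; exact: measurable_kernel.
have a0 : 0 <= a by have := le_trans (normr_ge0 _) (Ja 1); rewrite normr1 mulr1.
have b0 : 0 <= b by have := le_trans (normr_ge0 _) (Jb 1); rewrite expr1n mulr1.
under eq_integral do rewrite /= normrM [X in _ * X]ger0_norm ?kernel_ge0//.
apply: le_lt_trans (integral_kernel_le al12 (@ltr01 R) a0 b0 _ _ Ja Jb) _ => //.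
- exact: measurableT_comp.
- exact: ltry.
Qed.

(** If the integral were infinite, [fine] would return 0 and so would the inverse; hence finiteness
    is needed as well as positivity. The former holds because [1 - cos z] is at most |z| and at most
    z^2. *)
Lemma frac_const_gt0 (al : R) : 1 < al < 2 -> 0 < frac_const al.
Proof.
move=> al12; rewrite /frac_const invr_gt0; apply: fine_gt0.
have Dcos (y : R) : is_derive y 1 (@cos R) (- sin y) := is_derive_cos y.
have Dsin (y : R) : is_derive y 1 (fun y => - sin y) (- cos y).
  by apply: derive_opp; exact: is_derive_sin.
have sin1 (y : R) : `|- sin y| <= 1 by rewrite normrN ler_norml sin_geN1 sin_le1.
have cos1 (y : R) : `|- cos y| <= 1 by rewrite normrN ler_norml cos_geN1 cos_le1.
have J1 (z : R) : 1 - cos z <= 1 * `|z|.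
  have := lipschitz_derive 0 z Dcos sin1; rewrite add0r cos0 ler_norml => /andP[]; lra.
have J2 (z : R) : 1 - cos z <= 1 * z ^+ 2.
  have := taylor1_le2 (x := 0) (z := z) Dcos Dsin (fun y _ => cos1 y).
  by rewrite /taylor1 add0r cos0 sin0 oppr0 mul0r subr0 ler_norml => /andP[]; lra.
have J0 (z : R) : 0 <= 1 - cos z by rewrite subr_ge0 cos_le1.
have mJ : measurable_fun [set: R] (fun z : R => 1 - cos z).
  apply: measurable_funB => //; apply: measurable_continuous; exact: continuous_cos.
have up := integral_kernel_le al12 (@ltr01 R) ler01 ler01 mJ J0 J1 J2.
apply/andP; split; last by apply: le_lt_trans up _; exact: ltry.
(* On [[1, 2]], which is inside [[0, pi]], the factor [1 - cos z] increases and the kernel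
   decreases, so [c] bounds the integrand from below. *)
pose c := (1 - cos 1) * kernel al 2.
have k0 : 0 < kernel al 2 by rewrite invr_gt0 powR_gt0// normr_gt0.
have pi2 := @pi_ge2 R.
have c0 : 0 < c.
  rewrite mulr_gt0// subr_gt0 -[X in _ < X](@cos0 R) ltr_cos ?in_itv/= ?lexx ?pi_ge0//; lra.
apply: (@lt_le_trans _ _ (\int[mu]_(z in `[1%R, 2%R]) c%:E)%E).
  rewrite integral_cst//= lebesgue_measure_itv/= lte_fin ifT; last by lra.
  by rewrite -EFinB -EFinM lte_fin mulr_gt0//; lra.
apply: (@le_trans _ _ (\int[mu]_(z in `[1%R, 2%R]) ((1 - cos z) * kernel al z)%:E)%E).
  apply: ge0_le_integral => //.
  - by move=> z _; rewrite lee_fin ltW.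
  - apply/measurable_EFinP/measurable_funTS/measurable_funM => //.
    exact: measurable_kernel.
  - move=> z /=; rewrite in_itv/= => /andP[z1 z2]; rewrite lee_fin.
    have /andP[al1 al2] := al12.
    apply: ler_pM; [by rewrite subr_ge0 cos_le1|exact: kernel_ge0| |].
    + rewrite lerD2l lerN2; have [<-//|z1'] := eqVneq 1 z.
      by rewrite ltW// ltr_cos ?in_itv/=; lra.
    + rewrite /kernel lef_pV2 ?posrE ?powR_gt0 ?normr_gt0 ?gt_eqF//; last by lra.
      rewrite !gtr0_norm//; last by lra.
      by rewrite ge0_ler_powR ?nnegrE//; lra.
apply: ge0_subset_integral => //.
- apply/measurable_EFinP/measurable_funM => //; exact: measurable_kernel.
- by move=> z _; rewrite lee_fin mulr_ge0// kernel_ge0.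
Qed.

End Kernel.

(** * The singular integral tested against the weight *)

Section Levy.
Context {R : realType}.
Notation mu := (@lebesgue_measure R).
Notation itg f := (mu.-integrable [set: R] (EFin \o f)).
Implicit Types (f g h J : R -> R) (a b s x y z c l B K M : R).

Lemma integrableRD f g : itg f -> itg g -> itg (fun x => f x + g x).
Proof.
move=> jf jg; have -> : EFin \o (fun x => f x + g x) = (fun x => (f x)%:E + (g x)%:E)%E.
  by apply/funext => x; rewrite /= EFinD.
exact: integrableD.
Qed.

Lemma integrableRB f g : itg f -> itg g -> itg (fun x => f x - g x).
Proof.
move=> jf jg; have -> : EFin \o (fun x => f x - g x) = (fun x => (f x)%:E - (g x)%:E)%E.
  by apply/funext => x; rewrite /= EFinB.
exact: integrableB.
Qed.

Lemma integrableRZ c f : itg f -> itg (fun x => c * f x).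
Proof.
move=> jf; have -> : EFin \o (fun x => c * f x) = (fun x => c%:E * (f x)%:E)%E.
  by apply/funext => x; rewrite /= EFinM.
exact: integrableZl.
Qed.

Lemma integrable_le_bump g K l b : 0 < l -> measurable_fun [set: R] g ->
  (forall x, `|g x| <= K * bump (l * x + b)) -> itg g.
Proof.
move=> l0 mg gK; apply: (@le_integrable _ _ _ mu _ _ _ (EFin \o (fun x => K * bump (l * x + b)))) => //.
- exact/measurable_EFinP.
- by move=> x _; rewrite lee_fin (le_trans (gK x))// ler_norm.
- by apply: integrableRZ; exact: integrable_bump.
Qed.

Lemma integral_le_bump g K l b : 0 < l -> measurable_fun [set: R] g ->
  (forall x, `|g x| <= K * bump (l * x + b)) -> (\int[mu]_x `|g x|%:E <= (K / l)%:E)%E.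
Proof.
move=> l0 mg gK.
have K0 : 0 <= K.
  have := le_trans (normr_ge0 _) (gK 0); rewrite pmulr_lge0//; exact: bump_gt0.
apply: (@le_trans _ _ (\int[mu]_x (K * bump (l * x + b))%:E)%E).
  apply: ge0_le_integral => //.
  - by apply/measurable_EFinP; exact: measurableT_comp.
  - apply/measurable_EFinP/measurable_funM => //.
    by apply: measurable_continuous; exact: continuous_bump_affine.
  - by move=> x _; rewrite lee_fin.
under eq_integral do rewrite EFinM.
rewrite ge0_integralZl//.
- by rewrite integral_bump// -EFinM.
- by apply/measurable_EFinP; apply: measurable_continuous; exact: continuous_bump_affine.
- by move=> x _; rewrite lee_fin ltW// bump_gt0.
Qed.

Lemma norm_Rintegral_le g (B : R) : itg g -> (\int[mu]_x `|g x|%:E <= B%:E)%E ->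
  `|\int[mu]_x g x| <= B.
Proof.
move=> ig gB; rewrite -lee_fin EFin_normr_Rintegral//.
apply: le_trans gB; apply: le_abse_integral => //.
by case/integrableP : ig.
Qed.

Lemma norm_Rintegral_le_bump g K l b : 0 < l -> measurable_fun [set: R] g ->
  (forall x, `|g x| <= K * bump (l * x + b)) -> `|\int[mu]_x g x| <= K / l.
Proof.
move=> l0 mg gK; apply: norm_Rintegral_le; first exact: integrable_le_bump gK.
exact: integral_le_bump gK.
Qed.

Lemma integrable_mul_bump g B l b : 0 < l -> measurable_fun [set: R] g ->
  (forall x, `|g x| <= B) -> itg (fun x => g x * bump (l * x + b)).
Proof.
move=> l0 mg gB; apply: (integrable_le_bump l0 (b := b) (K := B)).
  apply: measurable_funM => //.
  by apply: measurable_continuous; exact: continuous_bump_affine.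
by move=> x; rewrite normrM (gtr0_norm (bump_gt0 _)) ler_wpM2r// ltW// bump_gt0.
Qed.

Lemma bump_affine_cvg0 l b : 0 < l ->
  bump (l * n%:R + b) @[n --> \oo] --> (0 : R) /\
  bump (l * - n%:R + b) @[n --> \oo] --> (0 : R).
Proof.
move=> l0; split.
  apply: (@squeeze_cvgr _ _ _ _ (cst 0) (fun n => 1 - sigmoid (l * n%:R + b))).
  - apply: nearW => n /=; rewrite ltW ?bump_gt0//= /bump ler_piMl// ?subr_ge0 ltW//.
      exact: sigmoid_lt1.
    exact: sigmoid_lt1.
  - exact: cvg_cst.
  - have -> : nbhs (0 : R) = nbhs (1 - 1 : R) by rewrite subrr.
    by apply: cvgB; [exact: cvg_cst|exact: sigmoid_cvg1].
apply: (@squeeze_cvgr _ _ _ _ (cst 0) (fun n => sigmoid (l * - n%:R + b))).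
- apply: nearW => n /=; rewrite ltW ?bump_gt0//= /bump ler_piMr ?(ltW (sigmoid_gt0 _))//.
  by rewrite lerBlDr lerDl ltW// sigmoid_gt0.
- exact: cvg_cst.
- exact: sigmoid_cvg0.
Qed.

Lemma measurable_bump1_affine l b : measurable_fun [set: R] (fun x => l * bump1 (l * x + b)).
Proof.
by apply: measurable_continuous; exact: derive_continuous (is_derive_bump1_affine l b).
Qed.

Lemma bump1_affine_bound l b x : 0 < l -> `|l * bump1 (l * x + b)| <= l * bump (l * x + b).
Proof. by move=> l0; rewrite normrM (gtr0_norm l0) ler_pM2l// bump1_bound. Qed.

Lemma integrable_mul_bump1 g B l b : 0 < l -> measurable_fun [set: R] g ->
  (forall x, `|g x| <= B) -> itg (fun x => g x * (l * bump1 (l * x + b))).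
Proof.
move=> l0 mg gB; apply: (integrable_le_bump l0 (b := b) (K := B * l)).
  by apply: measurable_funM => //; exact: measurable_bump1_affine.
by move=> x; rewrite normrM -mulrA ler_pM// bump1_affine_bound.
Qed.

(** There is no boundary term: [f] is bounded and the weight vanishes at infinity. *)
Lemma integration_by_parts_bump f f' B B' l b : 0 < l ->
  (forall x, is_derive x 1 f (f' x)) -> continuous f' ->
  (forall x, `|f x| <= B) -> (forall x, `|f' x| <= B') ->
  \int[mu]_x (f' x * bump (l * x + b)) = - \int[mu]_x (f x * (l * bump1 (l * x + b))).
Proof.
move=> l0 Df cf' fB f'B.
have cf : continuous f := derive_continuous Df.
have cb1 : continuous (fun x => l * bump1 (l * x + b)) := derive_continuous (is_derive_bump1_affine l b).
have i1 : itg (fun x => f' x * bump (l * x + b)).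
  by apply: integrable_mul_bump f'B => //; exact: measurable_continuous.
have i2 : itg (fun x => f x * (l * bump1 (l * x + b))).
  by apply: integrable_mul_bump1 fB => //; exact: measurable_continuous.
apply/eqP; rewrite -addr_eq0 -RintegralD//; apply/eqP.
have [b1 b2] := bump_affine_cvg0 b l0.
have v (w : nat -> R) : bump (l * w n + b) @[n --> \oo] --> (0 : R) ->
    (fun x => f x * bump (l * x + b)) (w n) @[n --> \oo] --> (0 : R).
  move=> h; apply/norm_cvg0P.
  apply: (@squeeze_cvgr _ _ _ _ (cst 0) (fun n => B * bump (l * w n + b))).
  - apply: nearW => n /=; rewrite normr_ge0/= normrM (gtr0_norm (bump_gt0 _)).
    by rewrite ler_wpM2r// ltW// bump_gt0.
  - exact: cvg_cst.
  - have -> : nbhs (0 : R) = nbhs (B * 0) by rewrite mulr0.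
    by apply: cvgM => //; exact: cvg_cst.
apply: (@Rintegral_FTC_eq0 _ (fun x => f x * bump (l * x + b))) => //.
- move=> x; refine (derive_eq (derive_mul (Df x) (is_derive_bump_affine l b x)) _); ring.
- move=> x; apply: cvgD; apply: cvgM; [exact: cf'|exact: continuous_bump_affine|exact: cf|exact: cb1].
- exact: integrableRD.
- exact: v.
- exact: (v (fun n => - n%:R)).
Qed.

Lemma taylor1_bump_bound l b x z : 0 < l ->
  `|taylor1 (fun y => bump (l * y + b)) (fun y => l * bump1 (l * y + b)) x z|
    <= (expR `|l * z| + 1 + l * `|z|) * bump (l * x + b).
Proof.
move=> l0; rewrite /taylor1 2!mulrDl mul1r.
apply: le_trans (ler_normB _ _) _; apply: lerD; last first.
  by rewrite normrM mulrAC ler_wpM2r// bump1_affine_bound.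
apply: le_trans (ler_normB _ _) _; rewrite !(gtr0_norm (bump_gt0 _)); apply: lerD => //.
have -> : l * (x + z) + b = l * x + b + l * z by ring.
exact: bump_shift.
Qed.

(* The last clause stands in for a bound on the second derivative. *)
Definition nice f f' (M : R) := [/\ forall x, is_derive x 1 f (f' x), continuous f',
  forall x, `|f x| <= M, forall x, `|f' x| <= M &
  forall x z, `|taylor1 f f' x z| <= M * z ^+ 2].

Lemma nice_continuous f f' M : nice f f' M -> continuous f.
Proof. by case=> Df _ _ _ _; exact: derive_continuous Df. Qed.

Lemma nice_taylor1 f f' M x z : nice f f' M -> `|taylor1 f f' x z| <= 2 * M * `|z|.
Proof. by case=> Df _ _ f'M _; exact: taylor1_le1. Qed.

Lemma nice_ge0 f f' M : nice f f' M -> 0 <= M.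
Proof. by case=> _ _ fM *; exact: le_trans (fM 0). Qed.

Lemma measurable_taylor1 f f' x : continuous f -> measurable_fun [set: R] (taylor1 f f' x).
Proof.
move=> cf; apply: measurable_funB; last exact: measurable_funM.
apply: measurable_funB => //.
under eq_fun do rewrite addrC.
by apply: measurable_shift; exact: measurable_continuous.
Qed.

Lemma measurable_taylor1_left f f' z : continuous f -> continuous f' ->
  measurable_fun [set: R] (fun x => taylor1 f f' x z).
Proof.
move=> cf cf'; apply: measurable_funB; last first.
  by apply: measurable_funM => //; exact: measurable_continuous.
apply: measurable_funB; last exact: measurable_continuous.
by apply: measurable_shift; exact: measurable_continuous.
Qed.

Section Adjoint.
Variables (f f' : R -> R) (M B l b : R).
Hypothesis nf : nice f f' M.
Hypothesis fB : forall x, `|f x| <= B.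
Hypothesis l0 : 0 < l.

Let bm x := bump (l * x + b).
Let bm' x := l * bump1 (l * x + b).
Let cf : continuous f. Proof. exact: nice_continuous nf. Qed.
Let cf' : continuous f'. Proof. by case: nf. Qed.
Let Df x : is_derive x 1 f (f' x). Proof. by case: nf. Qed.
Let f'M x : `|f' x| <= M. Proof. by case: nf. Qed.
Let B0 : 0 <= B. Proof. exact: le_trans (normr_ge0 _) (fB 0). Qed.
Let mf : measurable_fun [set: R] f. Proof. exact: measurable_continuous. Qed.
Let mf' : measurable_fun [set: R] f'. Proof. exact: measurable_continuous. Qed.
Let cbm : continuous bm. Proof. exact: continuous_bump_affine. Qed.
Let cbm' : continuous bm'. Proof. exact: derive_continuous (is_derive_bump1_affine l b). Qed.
Let mt z : measurable_fun [set: R] (fun x => taylor1 bm bm' x z).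
Proof. exact: measurable_taylor1_left. Qed.

Lemma integrable_taylor1_mul_bump z : itg (fun x => taylor1 f f' x z * bump (l * x + b)).
Proof.
apply: (integrable_mul_bump (B := M * z ^+ 2)) => //; first exact: measurable_taylor1_left.
by move=> x; case: nf => _ _ _ _; exact.
Qed.

(** Self-adjointness of Lambda^alpha, at the level of a single increment: the translation passes to
    the weight with the opposite sign, and the gradient term is integrated by parts. *)
Lemma integral_taylor1_mul_bump z :
  \int[mu]_x (taylor1 f f' x z * bm x) = \int[mu]_x (f x * taylor1 bm bm' x (- z)).
Proof.
have bsh x : bm (x - z) = bump (l * x + (b - l * z)) by congr bump; ring.
have i1 : itg (fun x => f x * bm (x - z)).
  have -> : (fun x => f x * bm (x - z)) = (fun x => f x * bump (l * x + (b - l * z))).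
    by apply/funext => x; rewrite bsh.
  exact: integrable_mul_bump l0 mf fB.
have i1' : itg (fun x => f (x + z) * bm x).
  exact: (@integrable_mul_bump (fun x => f (x + z)) B l b l0 (measurable_shift z mf) (fun x => fB _)).
have i2 : itg (fun x => f x * bm x) := integrable_mul_bump b l0 mf fB.
have i3 : itg (fun x => f' x * bm x) := integrable_mul_bump b l0 mf' f'M.
have i4 : itg (fun x => f x * bm' x) := integrable_mul_bump1 b l0 mf fB.
have e1 : \int[mu]_x (taylor1 f f' x z * bm x) = \int[mu]_x (f (x + z) * bm x) - \int[mu]_x (f x * bm x)
    - z * \int[mu]_x (f' x * bm x).
  rewrite -(RintegralZl z measurableT i3) -(RintegralB measurableT i1' i2).
  rewrite -(RintegralB measurableT (integrableRB i1' i2) (integrableRZ z i3)).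
  by apply: eq_Rintegral => x _; rewrite /taylor1 /bm; ring.
have e2 : \int[mu]_x (f x * taylor1 bm bm' x (- z)) =
    \int[mu]_x (f x * bm (x - z)) - \int[mu]_x (f x * bm x) + z * \int[mu]_x (f x * bm' x).
  rewrite -(RintegralZl z measurableT i4) -(RintegralB measurableT i1 i2).
  rewrite -(RintegralD measurableT (integrableRB i1 i2) (integrableRZ z i4)).
  by apply: eq_Rintegral => x _; rewrite /taylor1 /bm; ring.
have ibp : \int[mu]_x (f' x * bm x) = - \int[mu]_x (f x * bm' x).
  exact: (integration_by_parts_bump b l0 Df cf' fB f'M).
have sh : \int[mu]_x (f (x + z) * bm x) = \int[mu]_x (f x * bm (x - z)).
  have h := Rintegral_shift z i1; rewrite -[RHS]h.
  by apply: eq_Rintegral => x _; rewrite addrK.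
by rewrite e1 e2 ibp sh mulrN opprK.
Qed.

(** Only the bound [B] on [f] itself survives. The derivative bound [M], which for [u t] may
    degenerate as [t -> 0], serves integrability alone. *)
Lemma integral_taylor1_mul_bump_le z :
  `|\int[mu]_x (taylor1 f f' x z * bm x)| <= B * (4 * Num.min `|z| (l * z ^+ 2)).
Proof.
rewrite integral_taylor1_mul_bump; apply: norm_Rintegral_le.
  apply: (integrable_le_bump l0 (b := b)
    (K := B * (expR `|l * z| + 1 + l * `|z|))).
    by apply: measurable_funM; [exact: mf|exact: mt].
  move=> x; rewrite normrM -mulrA; apply: ler_pM; [exact: normr_ge0|exact: normr_ge0|exact: fB|].
  by have := taylor1_bump_bound b x (- z) l0; rewrite mulrN !normrN; exact.
apply: (@le_trans _ _ (\int[mu]_x (B%:E * `|taylor1 bm bm' x (- z)|%:E))%E).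
  apply: ge0_le_integral => //.
  - apply/measurable_EFinP; apply: measurableT_comp => //.
    by apply: measurable_funM; [exact: mf|exact: mt].
  - by apply: emeasurable_funM => //; apply/measurable_EFinP; apply: measurableT_comp => //; exact: mt.
  - by move=> x _; rewrite -EFinM lee_fin normrM ler_wpM2r.
rewrite ge0_integralZl//; last first.
  by apply/measurable_EFinP; apply: measurableT_comp => //; exact: mt.
rewrite EFinM lee_pmul// ?lee_fin//.
- by apply: integral_ge0 => x _; rewrite lee_fin.
- by have := integral_taylor1_bump b (- z) l0; rewrite normrN sqrrN.
Qed.

End Adjoint.

Variable al : R.
Hypothesis al12 : 1 < al < 2.

Definition levy f f' x : R := \int[mu]_z (taylor1 f f' x z * kernel al z).

Lemma integrable_levy f f' M x : nice f f' M ->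
  itg (fun z => taylor1 f f' x z * kernel al z).
Proof.
move=> nf; apply: (integrable_kernel (a := 2 * M) (b := M)) => //.
- by apply: measurable_taylor1; exact: nice_continuous nf.
- by move=> z; exact: nice_taylor1.
- by case: nf => _ _ _ _; exact.
Qed.

Lemma fraclapE f f' x : (forall x, is_derive x 1 f (f' x)) ->
  fraclap al f x = - frac_const al * levy f f' x.
Proof.
move=> Df; rewrite /fraclap /levy; congr (_ * _); apply: eq_Rintegral => z _.
by rewrite (derive1_is_derive (Df x)).
Qed.

Lemma measurable_add2 : measurable_fun [set: (measurableTypeR R * measurableTypeR R)%type]
  (fun p : measurableTypeR R * measurableTypeR R => (p.1 + p.2 : R)).
Proof. exact: measurable_funD. Qed.

Lemma measurable_taylor1_2 f f' : continuous f -> continuous f' ->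
  measurable_fun [set: (measurableTypeR R * measurableTypeR R)%type]
  (fun p : measurableTypeR R * measurableTypeR R => taylor1 f f' p.1 p.2).
Proof.
move=> cf cf'.
have mf : measurable_fun [set: R] f := measurable_continuous cf.
have mf' : measurable_fun [set: R] f' := measurable_continuous cf'.
apply: measurable_funB; last first.
  by apply: measurable_funM => //; exact: measurableT_comp.
apply: measurable_funB; last exact: measurableT_comp.
apply: (measurableT_comp mf); exact: measurable_add2.
Qed.

Lemma integral_abs_levy f f' M x : nice f f' M ->
  (\int[mu]_z `|taylor1 f f' x z * kernel al z|%:E <= (kernel_cst al * (3 * M))%:E)%E.
Proof.
move=> nf; under eq_integral do rewrite normrM [X in _ * X]ger0_norm ?kernel_ge0//.
have M0 := nice_ge0 nf; have M20 : 0 <= 2 * M by rewrite mulr_ge0.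
have cf := nice_continuous nf.
apply: le_trans (integral_kernel_le al12 (@ltr01 R) M20 M0 _ _ _ _) _ => //.
- by apply: measurableT_comp => //; exact: measurable_taylor1.
- by move=> z; exact: nice_taylor1.
- by case: nf => _ _ _ _; exact.
- by rewrite !powR1 lee_fin ler_wpM2l ?(ltW (kernel_cst_gt0 al12))//; lra.
Qed.

Lemma measurable_min_sqr c l : measurable_fun [set: R] (fun z => c * Num.min `|z| (l * z ^+ 2)).
Proof.
apply: measurable_funM => //; apply: measurable_minr => //.
by apply: measurable_funM => //; exact: measurable_funX.
Qed.

Lemma measurable_kernel_min c l :
  measurable_fun [set: R] (fun z => (c * Num.min `|z| (l * z ^+ 2) * kernel al z)%:E).
Proof.
apply/measurable_EFinP; apply: measurable_funM; first exact: measurable_min_sqr.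
exact: measurable_kernel.
Qed.

(** The two arguments of the minimum cross at |z| = [l^-1], which is the splitting point chosen. *)
Lemma integral_kernel_min c l : 0 <= c -> 0 < l ->
  (\int[mu]_z (c * Num.min `|z| (l * z ^+ 2) * kernel al z)%:E <=
    (2 * c * kernel_cst al * l `^ (al - 1))%:E)%E.
Proof.
move=> c0 l0; have li0 : 0 < l^-1 by rewrite invr_gt0.
have cl0 : 0 <= c * l by rewrite mulr_ge0// ltW.
apply: le_trans (integral_kernel_le al12 li0 c0 cl0 (measurable_min_sqr c l) _ _ _) _.
- by move=> z; rewrite mulr_ge0// le_min normr_ge0/= mulr_ge0 ?sqr_ge0// ltW.
- by move=> z; rewrite ler_wpM2l// ge_min lexx.
- by move=> z; rewrite -mulrA ler_wpM2l// ge_min lexx orbT.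
have pw r : l^-1 `^ r = l `^ (- r) by rewrite -powR_inv1 ?(ltW l0)// -powRrM mulN1r.
rewrite lee_fin !pw.
have -> : - (1 - al) = al - 1 by ring.
have e : l * l `^ (- (2 - al)) = l `^ (al - 1).
  have al1 : 0 < al - 1 by case/andP: al12 => ? ?; lra.
  by rewrite -(mulr_powRB1 (ltW l0) al1); congr (_ * _ `^ _); ring.
rewrite -mulrA e le_eqVlt; apply/orP; left; apply/eqP; ring.
Qed.

Lemma norm_mul_kernel_le p q z : `|p| <= q -> `|p * kernel al z| <= q * kernel al z.
Proof.
by move=> pq; rewrite normrM [X in _ * X]ger0_norm ?kernel_ge0// ler_wpM2r ?kernel_ge0.
Qed.

(** Fubini exchanges [x] and [z], and the inner integral is then bounded by self-adjointness. The
    bound involves no derivative of [f] and vanishes as [l -> 0], although the weight itself has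
    integral [l^-1]. *)
Lemma levy_bump f f' M B l b : nice f f' M -> (forall x, `|f x| <= B) -> 0 < l ->
  itg (fun x => levy f f' x * bump (l * x + b)) /\
  `|\int[mu]_x (levy f f' x * bump (l * x + b))| <= 8 * kernel_cst al * B * l `^ (al - 1).
Proof.
move=> nf fB l0; have [Df cf' fM f'M _] := nf; have cf := nice_continuous nf.
have B0 : 0 <= B := le_trans (normr_ge0 _) (fB 0).
have mf : measurable_fun [set: R] f := measurable_continuous cf.
have mf' : measurable_fun [set: R] f' := measurable_continuous cf'.
have mbump k : measurable_fun [set: R] (fun x => bump (l * x + k)).
  by apply: measurable_continuous; exact: continuous_bump_affine.
pose G (p : measurableTypeR R * measurableTypeR R) : \bar R :=
  (taylor1 f f' p.1 p.2 * kernel al p.2 * bump (l * p.1 + b))%:E.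
have mG : measurable_fun setT G.
  apply/measurable_EFinP; apply: measurable_funM.
    apply: measurable_funM; first exact: measurable_taylor1_2.
    by apply: (measurableT_comp (measurable_kernel al)).
  exact: (measurableT_comp (mbump b)).
have Gx x z : G (x, z) = ((taylor1 f f' x z * kernel al z) * bump (l * x + b))%:E by [].
have mGx x : measurable_fun [set: R] (fun z => taylor1 f f' x z * kernel al z).
  by apply: measurable_funM; [exact: measurable_taylor1|exact: measurable_kernel].
have iG : (mu \x mu)%E.-integrable setT G.
  apply/integrable12ltyP => //.
  apply: (@le_lt_trans _ _ (\int[mu]_x ((kernel_cst al * (3 * M)) * bump (l * x + b))%:E)%E).
    apply: ge0_le_integral => //.
    - by move=> x _; exact: integral_ge0.
    - apply: (@measurable_fun_fubini_tonelli_F _ _ _ _ _ mu (fun p => `|G p|%E)) => //.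
      exact: measurableT_comp.
    - by apply/measurable_EFinP; apply: measurable_funM => //; exact: mbump.
    - move=> x _; under eq_integral do rewrite Gx abse_EFin normrM [X in _ * X]gtr0_norm ?bump_gt0// EFinM.
      rewrite ge0_integralZr//; last 2 first.
      + by apply/measurable_EFinP; apply: measurableT_comp => //; exact: mGx.
      + by rewrite lee_fin ltW// bump_gt0.
      rewrite [leRHS]EFinM; apply: lee_pmul; rewrite ?lee_fin ?(ltW (bump_gt0 _))//.
      * by apply: integral_ge0 => z _; rewrite lee_fin.
      * exact: integral_abs_levy.
  have K0 : 0 <= kernel_cst al * (3 * M).
    by apply: mulr_ge0; [exact: ltW (kernel_cst_gt0 al12)|apply: mulr_ge0 => //; exact: nice_ge0 nf].
  under eq_integral do rewrite EFinM.
  rewrite ge0_integralZl//.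
  - by rewrite integral_bump// -EFinM ltry.
  - by apply/measurable_EFinP; exact: mbump.
  - by move=> x _; rewrite lee_fin ltW// bump_gt0.
have Ez x : (\int[mu]_z G (x, z) = (levy f f' x * bump (l * x + b))%:E)%E.
  under eq_integral do rewrite Gx EFinM.
  rewrite integralZr//; last exact: integrable_levy nf.
  rewrite [RHS]EFinM; congr (_ * _)%E; rewrite /levy /Rintegral fineK//.
  by apply: integrable_fin_num => //; exact: integrable_levy nf.
pose J z := \int[mu]_x (taylor1 f f' x z * bump (l * x + b)).
have iJ z : itg (fun x => taylor1 f f' x z * bump (l * x + b)).
  exact: (integrable_taylor1_mul_bump b nf l0).
have Ex z : (\int[mu]_x G (x, z) = (J z * kernel al z)%:E)%E.
  under eq_integral do rewrite Gx mulrAC EFinM.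
  rewrite integralZr//; last exact: iJ.
  by rewrite [RHS]EFinM; congr (_ * _)%E; rewrite /J /Rintegral fineK//; apply: integrable_fin_num => //; exact: iJ.
have FG := Fubini iG.
have iF := integrable_fubini_F iG.
have EF : fubini_F mu G = (EFin \o (fun x => levy f f' x * bump (l * x + b))).
  by apply/funext => x; rewrite /fubini_F Ez.
have EG : fubini_G mu G = (EFin \o (fun z => J z * kernel al z)).
  by apply/funext => z; rewrite /fubini_G Ex.
have mG2 := measurable_fubini_G iG.
rewrite EF in iF; rewrite EG in mG2.
split; first exact: iF.
have -> : \int[mu]_x (levy f f' x * bump (l * x + b)) = \int[mu]_z (J z * kernel al z).
  rewrite /Rintegral; congr fine; transitivity (\int[mu]_x \int[mu]_z G (x, z))%E.
    by apply: eq_integral => x _; rewrite Ez.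
  by rewrite FG; apply: eq_integral => z _; rewrite Ex.
have Jb z : `|J z| <= 4 * B * Num.min `|z| (l * z ^+ 2).
  by rewrite -mulrA mulrCA; exact: (integral_taylor1_mul_bump_le b nf fB l0).
suff bnd : (\int[mu]_z `|J z * kernel al z|%:E <= (8 * kernel_cst al * B * l `^ (al - 1))%:E)%E.
  apply: norm_Rintegral_le; last exact: bnd.
  by apply/integrableP; split; [exact: mG2|apply: le_lt_trans bnd _; exact: ltry].
have -> : 8 * kernel_cst al * B * l `^ (al - 1) = 2 * (4 * B) * kernel_cst al * l `^ (al - 1) by ring.
have B40 : 0 <= 4 * B by rewrite mulr_ge0.
apply: le_trans (integral_kernel_min B40 l0).
apply: ge0_le_integral; first exact: measurableT.
- by move=> z _; rewrite lee_fin.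
- by apply/measurable_EFinP; apply: measurableT_comp; [exact: normr_measurable|apply/measurable_EFinP; exact: mG2].
- exact: measurable_kernel_min.
- by move=> z _; rewrite lee_fin; apply: norm_mul_kernel_le; exact: Jb.
Qed.

(** Fubini yields measurability of the product with the weight; division by that positive continuous
    function recovers [levy]. *)
Lemma measurable_levy f f' M : nice f f' M -> measurable_fun [set: R] (levy f f').
Proof.
move=> nf; have fM : forall x, `|f x| <= M by case: nf.
have [iL _] := levy_bump 0 nf fM (@ltr01 R).
have mL : measurable_fun [set: R] (fun x => levy f f' x * bump (1 * x + 0)).
  by case/integrableP : iL => /measurable_EFinP.
have mI : measurable_fun [set: R] (fun x : R => (bump (1 * x + 0))^-1).
  apply: measurable_continuous => x; apply: cvgV; first by rewrite gt_eqF// bump_gt0.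
  exact: continuous_bump_affine.
have -> : levy f f' = (fun x => levy f f' x * bump (1 * x + 0) * (bump (1 * x + 0))^-1).
  by apply/funext => x; rewrite mulfK// gt_eqF// bump_gt0.
exact: measurable_funM.
Qed.

Lemma niceB f f' g g' M K : nice f f' M -> nice g g' K ->
  nice (fun x => f x - g x) (fun x => f' x - g' x) (M + K).
Proof.
move=> [Df cf' fM f'M fT] [Dg cg' gK g'K gT]; split.
- by move=> x; exact: (derive_sub (Df x) (Dg x)).
- by move=> x; apply: cvgB; [exact: cf'|exact: cg'].
- by move=> x; apply: le_trans (ler_normB _ _) _; apply: lerD; [exact: fM|exact: gK].
- by move=> x; apply: le_trans (ler_normB _ _) _; apply: lerD; [exact: f'M|exact: g'K].
- move=> x z; have -> : taylor1 (fun x => f x - g x) (fun x => f' x - g' x) x z =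
    taylor1 f f' x z - taylor1 g g' x z by rewrite /taylor1; ring.
  by apply: le_trans (ler_normB _ _) _; rewrite mulrDl; apply: lerD; [exact: fT|exact: gT].
Qed.

Lemma levyB f f' g g' M K x : nice f f' M -> nice g g' K ->
  levy (fun x => f x - g x) (fun x => f' x - g' x) x = levy f f' x - levy g g' x.
Proof.
move=> nf ng; rewrite /levy -(RintegralB measurableT (integrable_levy x nf) (integrable_levy x ng)).
by apply: eq_Rintegral => z _; rewrite /taylor1; ring.
Qed.

End Levy.

(** * Smooth solutions *)

Section SmoothSolution.
Context {R : realType}.
Notation mu := (@lebesgue_measure R).
Notation itg f := (mu.-integrable [set: R] (EFin \o f)).
Implicit Types (f g h : R -> R) (a b s t x y z c l B K M T : R).

Lemma derive_nonincreasing g a b : a <= b ->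
  (forall s, a <= s <= b -> exists2 g', is_derive s 1 g g' & g' <= 0) -> g b <= g a.
Proof.
move=> ab Dg.
have DD s : a <= s <= b -> derivable g s 1 by move=> /Dg[g' [Dr _] _].
have cg : {within `[a, b], continuous g}.
  apply: continuous_in_subspaceT => s; rewrite mem_setE in_itv/= => sab.
  by apply/differentiable_continuous/derivable1_diffP; exact: DD.
have hD s : s \in `]a, b[%R -> is_derive s 1 g (derive1 g s).
  rewrite in_itv/= => /andP[sa sb]; apply: derivable_is_derive.
  by apply: DD; rewrite !ltW.
have [s] := MVT_segment ab hD cg.
rewrite in_itv/= => sab h; have [g' /derive1_is_derive Dr g'0] := Dg s sab.
by rewrite -subr_le0 h Dr mulr_le0_ge0// subr_ge0.
Qed.

Lemma pair_continuous_l (g : R * R -> R) t x :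
  {for (t, x), continuous g} -> {for x, continuous (fun y => g (t, y))}.
Proof.
move=> cg; apply: (@continuous_comp _ _ _ (fun y => (t, y)) g) => //.
exact: (cvg_pair (cvg_cst t) cvg_id).
Qed.

(** The form of [is_solution] on which the estimates rely: a bound on [u] uniform down to [t = 0],
    bounds on derivatives only away from it, and the equation solved for the time derivative. *)
Definition smooth_solution (al : R) (u ut ux : R -> R -> R) :=
  [/\ forall T, 0 < T -> exists M, forall t x, 0 < t < T -> `|u t x| <= M,
   forall a T, 0 < a < T -> exists M, forall t, a < t < T ->
     [/\ nice (u t) (ux t) M, forall x, is_derive t 1 (fun s => u s x) (ut t x),
       forall x, `|ut t x| <= M & continuous (ut t)],
   forall t x, 0 < t -> ut t x = frac_const al * levy al (u t) (ux t) x - u t x * ux t x &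
   forall t x, 0 < t -> {for (t, x), continuous (fun y : R * R => u y.1 y.2)}].

Lemma is_solution_smooth (al : R) u0 u : 1 < al < 2 -> is_solution al u0 u ->
  smooth_solution al u (pdt u) (pdx u).
Proof.
move=> al12 [H _].
have D1 a T : 0 < a < T -> forall t x, a < t < T ->
   is_derive x 1 (u t) (pdx u t x) /\ is_derive t 1 (fun s => u s x) (pdt u t x)
   /\ is_derive x 1 (pdx u t) (pdx (pdx u) t x).
  move=> aT t x atT; have T0 : 0 < T by case/andP: aT; lra.
  have [_ [S _]] := H T T0.
  have [_ d0] := S a aT [::]; have [_ d1] := S a aT [:: false].
  have [dt dx] := d0 (t, x) atT; have [_ dxx] := d1 (t, x) atT.
  split; first exact: (derivable_is_derive dx).
  split; first exact: (derivable_is_derive dt).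
  exact: (derivable_is_derive dxx).
split.
- move=> T T0; have [[_ [M HM]] _] := H T T0.
  by exists M => t x tT; exact: (HM (t, x)).
- move=> a T aT; have T0 : 0 < T by case/andP: aT; lra.
  have [_ [S _]] := H T T0.
  (* A word lists derivatives, [false] for [x] and [true] for [t]; the four words used give bounds
     on u, u_x, u_xx and u_t. *)
  have [[_ [M0 h0]] _] := S a aT [::]; have [[c1 [M1 h1]] _] := S a aT [:: false].
  have [[_ [M2 h2]] _] := S a aT [:: false; false]; have [[c3 [M3 h3]] _] := S a aT [:: true].
  exists (Num.max (Num.max M0 M1) (Num.max M2 M3)) => t atT.
  split.
  + split.
    * by move=> x; have [] := D1 a T aT t x atT.
    * by move=> x; exact: (@pair_continuous_l (fun p : R * R => pdx u p.1 p.2) t x (c1 (t, x) atT)).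
    * by move=> x; rewrite !le_max (h0 (t, x) atT).
    * by move=> x; rewrite !le_max (h1 (t, x) atT) orbT.
    * move=> x z.
      have hA y : is_derive y 1 (u t) (pdx u t y) by have [] := D1 a T aT t y atT.
      have hB y : is_derive y 1 (pdx u t) (pdx (pdx u) t y) by have [_ []] := D1 a T aT t y atT.
      have hC y : `|y - x| <= `|z| -> `|pdx (pdx u) t y| <= Num.max (Num.max M0 M1) (Num.max M2 M3).
        by move=> _; rewrite !le_max (h2 (t, y) atT) !orbT.
      exact: (taylor1_le2 hA hB hC).
  + by move=> x; have [_ []] := D1 a T aT t x atT.
  + by move=> x; rewrite !le_max (h3 (t, x) atT) !orbT.
  + by move=> x; exact: (@pair_continuous_l (fun p : R * R => pdt u p.1 p.2) t x (c3 (t, x) atT)).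
- move=> t x t0; have tt : 0 < t / 2 < t + 1 by apply/andP; split; lra.
  have T0 : 0 < t + 1 by lra.
  have [_ [_ E]] := H (t + 1) T0.
  have t1 : 0 < t < t + 1 by apply/andP; split; lra.
  have att : t / 2 < t < t + 1 by apply/andP; split; lra.
  have dx y : is_derive y 1 (u t) (pdx u t y) by have [] := D1 _ _ tt t y att.
  by have := E t x t1; rewrite (fraclapE al x dx); lra.
- move=> t x t0; have T0 : 0 < t + 1 by lra.
  have [[c _] _] := H (t + 1) T0.
  by apply: c; rewrite /strip/=; apply/andP; split; lra.
Qed.

Lemma is_derive_integral_bump (Phi Phit : R -> R -> R) a T M l b t : 0 < l -> a < t < T ->
  (forall s x, a < s < T -> is_derive s 1 (fun r => Phi r x) (Phit s x)) ->
  (forall s x, a < s < T -> `|Phi s x| <= M) ->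
  (forall s x, a < s < T -> `|Phit s x| <= M) ->
  (forall s, a < s < T -> measurable_fun [set: R] (Phi s)) ->
  is_derive t 1 (fun s => \int[mu]_x (Phi s x * bump (l * x + b)))
     (\int[mu]_x (Phit t x * bump (l * x + b))).
Proof.
move=> l0 atT D PM PtM mP.
have M0 : 0 <= M := le_trans (normr_ge0 _) (PM t 0 atT).
have itv s : `]a, T[%classic s -> a < s < T by rewrite /= in_itv.
pose f s x := Phi s x * bump (l * x + b).
have Df s x : a < s < T -> is_derive s 1 (f ^~ x) (Phit s x * bump (l * x + b)).
  move=> saT; refine (derive_eq (derive_mul (D s x saT) (derive_cst (bump (l * x + b)) s)) _).
  by ring.
have p1 s x : a < s < T -> partial1of2 f s x = Phit s x * bump (l * x + b).
  by move=> saT; rewrite /partial1of2; apply: derive1_is_derive; exact: Df.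
have Ia : `]a, T[%classic t by rewrite /= in_itv.
have intf s : `]a, T[%classic s -> itg (f s).
  move=> /itv saT; apply: (integrable_mul_bump (B := M)) => //; first exact: mP.
  by move=> x; exact: PM.
have df s x : `]a, T[%classic s -> [set: R] x -> derivable (f ^~ x) s 1.
  by move=> /itv saT _; case: (Df s x saT).
have G0 x : 0 <= M * bump (l * x + b) by rewrite mulr_ge0// ltW// bump_gt0.
have iG : itg (fun x => M * bump (l * x + b)).
  by apply: integrableRZ; exact: integrable_bump.
have Gub s x : `]a, T[%classic s -> [set: R] x -> `|partial1of2 f s x| <= M * bump (l * x + b).
  move=> /itv saT _; rewrite p1// normrM (gtr0_norm (bump_gt0 _)) ler_wpM2r//.
    exact: ltW (bump_gt0 _).
  exact: PtM.
have dd := derivable_under_integral measurableT Ia intf df G0 iG Gub.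
have E := differentiation_under_integral measurableT Ia intf df G0 iG Gub.
have := derivable_is_derive dd; rewrite E => h.
apply: derive_eq h _; apply: eq_Rintegral => x _.
by rewrite p1.
Qed.

Variables (al : R) (u ut ux : R -> R -> R).
Hypothesis al12 : 1 < al < 2.
Hypothesis Su : smooth_solution al u ut ux.

Lemma solution_continuous t : 0 < t -> continuous (u t).
Proof.
move=> t0; case: Su => _ _ _ c x.
exact: (@pair_continuous_l (fun p : R * R => u p.1 p.2) t x (c t x t0)).
Qed.

Lemma solution_measurable t : 0 < t -> measurable_fun [set: R] (u t).
Proof. by move=> t0; apply: measurable_continuous; exact: solution_continuous. Qed.

Lemma solution_at t : 0 < t -> exists M, 
     [/\ nice (u t) (ux t) M, forall x, is_derive t 1 (fun s => u s x) (ut t x),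
       forall x, `|ut t x| <= M & continuous (ut t)].
Proof.
move=> t0; case: Su => _ S _ _.
have [|M HM] := S (t / 2) (t + 1); first by apply/andP; split; lra.
by exists M; apply: HM; apply/andP; split; lra.
Qed.

Lemma is_derive_integral_solution t l b : 0 < t -> 0 < l ->
  is_derive t 1 (fun s => \int[mu]_x (u s x * bump (l * x + b)))
     (\int[mu]_x (ut t x * bump (l * x + b))).
Proof.
move=> t0 l0; case: Su => _ S _ _.
have [|M HM] := S (t / 2) (t + 1); first by apply/andP; split; lra.
apply: (@is_derive_integral_bump u ut (t / 2) (t + 1) M) => //.
- by apply/andP; split; lra.
- by move=> s x /HM[_ D _ _]; exact: D.
- by move=> s x /HM[[_ _ uM _ _] _ _ _]; exact: uM.
- by move=> s x /HM[_ _ utM _]; exact: utM.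
- by move=> s /andP[s1 _]; apply: solution_measurable; lra.
Qed.

Lemma derive_half_sqr f f' x : is_derive x 1 f (f' x) ->
  is_derive x 1 (fun y => f y ^+ 2 / 2) (f x * f' x).
Proof.
move=> Df; under eq_fun do rewrite expr2.
refine (derive_eq (derive_mul (derive_mul Df Df) (derive_cst 2^-1 x)) _).
by field.
Qed.

Lemma derive_third_cube f f' x : is_derive x 1 f (f' x) ->
  is_derive x 1 (fun y => f y ^+ 3 / 3) (f x ^+ 2 * f' x).
Proof.
move=> Df; under eq_fun do rewrite exprS expr2.
refine (derive_eq (derive_mul (derive_mul Df (derive_mul Df Df)) (derive_cst 3^-1 x)) _).
by field.
Qed.

(** By self-adjointness, and since [u u_x] is the derivative of [u^2 / 2], all derivatives fall on
    the weight. The bound sees the solution only through [M] and is therefore uniform as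
    [t -> 0]. *)
Lemma integral_ut_bound t l b M : 0 < t -> 0 < l -> (forall x, `|u t x| <= M) ->
  `|\int[mu]_x (ut t x * bump (l * x + b))| <=
    frac_const al * (8 * kernel_cst al * M * l `^ (al - 1)) + M ^+ 2 / 2.
Proof.
move=> t0 l0 uM; have [M' [nu _ utM cut]] := solution_at t0.
have [Df cux u1 ux1 _] := nu.
have M0 : 0 <= M := le_trans (normr_ge0 _) (uM 0).
have cu := solution_continuous t0.
have [i1 b1] := levy_bump al12 b nu uM l0.
have cuux : continuous (fun x => u t x * ux t x).
  by move=> x; apply: cvgM; [exact: cu|exact: cux].
have uuxb x : `|u t x * ux t x| <= M * M' by rewrite normrM ler_pM.
have u2 x : `|u t x ^+ 2 / 2| <= M ^+ 2 / 2.
  by rewrite normrM normrX [X in _ * X]gtr0_norm// ler_pM2r// lerXn2r ?nnegrE.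
have mu2 : measurable_fun [set: R] (fun x => u t x ^+ 2 / 2).
  by apply: measurable_funM => //; apply: measurable_funX; exact: measurable_continuous.
have i2 : itg (fun x => u t x * ux t x * bump (l * x + b)).
  exact: (integrable_mul_bump b l0 (measurable_continuous cuux) uuxb).
have ibp := integration_by_parts_bump b l0 (fun x => derive_half_sqr (Df x)) cuux u2 uuxb.
have -> : \int[mu]_x (ut t x * bump (l * x + b)) =
   frac_const al * \int[mu]_x (levy al (u t) (ux t) x * bump (l * x + b))
   - \int[mu]_x (u t x * ux t x * bump (l * x + b)).
  rewrite -(RintegralZl _ measurableT i1) -(RintegralB measurableT (integrableRZ _ i1) i2).
  apply: eq_Rintegral => x _; case: Su => _ _ pde _.
  by rewrite pde//; ring.
apply: le_trans (ler_normB _ _) _; apply: lerD.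
  rewrite normrM (gtr0_norm (frac_const_gt0 al12)) ler_wpM2l//.
  exact: ltW (frac_const_gt0 al12).
rewrite ibp normrN.
have -> : M ^+ 2 / 2 = (M ^+ 2 / 2 * l) / l by field; rewrite gt_eqF.
apply: (norm_Rintegral_le_bump (b := b)) => //.
  by apply: measurable_funM => //; exact: measurable_bump1_affine.
by move=> x; rewrite normrM -mulrA ler_pM ?bump1_affine_bound//.
Qed.

(** Weak-* convergence alone carries no rate. Here the weighted mean is Lipschitz in time between
    [s] and [t] with a constant independent of [s], and [s] tends to 0. *)
Lemma pairing_initial (u0 : R -> R) l b M T t : 0 < l -> 0 < t < T ->
  (forall s x, 0 < s < T -> `|u s x| <= M) ->
  (fun s => \int[mu]_x (u s x * bump (l * x + b))) s @[s --> 0^'+] -->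
     \int[mu]_x (u0 x * bump (l * x + b)) ->
  `|\int[mu]_x (u t x * bump (l * x + b)) - \int[mu]_x (u0 x * bump (l * x + b))|
   <= (frac_const al * (8 * kernel_cst al * M * l `^ (al - 1)) + M ^+ 2 / 2) * t.
Proof.
move=> l0 /andP[t0 tT] uM cv.
set K := (X in _ <= X * t); set A := fun s => \int[mu]_x (u s x * bump (l * x + b)).
have KA s : 0 < s < t -> `|A t - A s| <= K * t.
  move=> /andP[s0 st].
  have DA (r : R) : 0 < r -> is_derive r 1 A (\int[mu]_x (ut r x * bump (l * x + b))).
    by move=> r0; exact: is_derive_integral_solution.
  have cA : {within `[s, t], continuous A}.
    apply: continuous_in_subspaceT => r; rewrite mem_setE in_itv/= => /andP[sr _].
    have r0 : 0 < r by exact: lt_le_trans s0 sr.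
    by apply/differentiable_continuous/derivable1_diffP; case: (DA r r0).
  have hD (r : R) : r \in `]s, t[%R -> is_derive r 1 A (\int[mu]_x (ut r x * bump (l * x + b))).
    by rewrite in_itv/= => /andP[sr _]; apply: DA; exact: lt_trans s0 sr.
  have [r] := MVT_segment (ltW st) hD cA.
  rewrite in_itv/= => /andP[sr rt] ->; rewrite normrM (@ger0_norm _ (t - s)); last by rewrite subr_ge0 ltW.
  have r0 : 0 < r by lra.
  have rT : 0 < r < T by apply/andP; split=> //; lra.
  have hK := @integral_ut_bound r l b M r0 l0 (fun x => uM r x rT).
  by apply: ler_pM => //; lra.
have cv2 : `|A t - A s| @[s --> 0^'+] --> `|A t - \int[mu]_x (u0 x * bump (l * x + b))|.
  by apply: cvg_norm; apply: cvgB; [exact: cvg_cst|exact: cv].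
rewrite -(cvg_lim _ cv2)//; apply: limr_le; first exact: cvgP cv2.
near=> s; apply: KA; apply/andP; split.
  by near: s; exact: nbhs_right_gt.
by near: s; exact: nbhs_right_lt.
Unshelve. all: by end_near. Qed.

End SmoothSolution.

(** * Energy estimate and strong initial trace *)

Section Energy.
Context {R : realType}.
Notation mu := (@lebesgue_measure R).
Notation itg f := (mu.-integrable [set: R] (EFin \o f)).
Implicit Types (f g h : R -> R) (a b s t x y z c l B K M T : R).

Variable al : R.
Hypothesis al12 : 1 < al < 2.

Definition sqdiff f x z : R := (f (x + z) - f x) ^+ 2.
(** Twice the carré du champ of the operator [levy]. *)
Definition dissipation f x : R := \int[mu]_z (sqdiff f x z * kernel al z).

Lemma nice_dist f f' M x z : nice f f' M -> `|f (x + z) - f x| <= M * `|z|.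
Proof. by case=> Df _ _ f'M _; exact: lipschitz_derive. Qed.

Lemma nice_dist2 f f' M x z : nice f f' M -> `|f (x + z) - f x| <= 2 * M.
Proof.
case=> _ _ fM _ _; apply: le_trans (ler_normB _ _) _.
by rewrite mulr_natl mulr2n lerD.
Qed.

Lemma nice_half_sqr f f' M : nice f f' M ->
  nice (fun x => f x ^+ 2 / 2) (fun x => f x * f' x) (2 * M ^+ 2).
Proof.
move=> nf; have [Df cf' fM f'M fT] := nf; have cf := nice_continuous nf.
have M0 := nice_ge0 nf; have MM : 0 <= M ^+ 2 by rewrite sqr_ge0.
split.
- by move=> x; exact: derive_half_sqr.
- by move=> x; apply: cvgM; [exact: cf|exact: cf'].
- move=> x; rewrite normrM normrX [X in _ * X]gtr0_norm//.
  have : `|f x| ^+ 2 <= M ^+ 2 by rewrite lerXn2r ?nnegrE.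
  by have := sqr_ge0 `|f x|; lra.
- move=> x; rewrite normrM.
  have : `|f x| * `|f' x| <= M * M by rewrite ler_pM.
  by rewrite -expr2; lra.
- move=> x z.
  have -> : taylor1 (fun y => f y ^+ 2 / 2) (fun y => f y * f' y) x z =
      f x * taylor1 f f' x z + (f (x + z) - f x) ^+ 2 / 2.
    by rewrite /taylor1; field.
  apply: le_trans (ler_normD _ _) _.
  have h1 : `|f x * taylor1 f f' x z| <= M * (M * z ^+ 2) by rewrite normrM ler_pM.
  have h2 : `|(f (x + z) - f x) ^+ 2 / 2| <= M ^+ 2 * z ^+ 2 / 2.
    rewrite normrM [X in _ * X]gtr0_norm// ler_pM2r// normrX.
    rewrite -[z ^+ 2](real_normK (num_real z)) -exprMn lerXn2r ?nnegrE ?mulr_ge0//.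
    exact: nice_dist nf.
  have h3 : 0 <= M ^+ 2 * z ^+ 2 by rewrite mulr_ge0 ?sqr_ge0.
  by move: h1; rewrite mulrA -expr2; lra.
Qed.

Lemma measurable_sqdiff f x : continuous f -> measurable_fun [set: R] (sqdiff f x).
Proof.
move=> cf; apply: measurable_funX; apply: measurable_funB => //.
under eq_fun do rewrite addrC.
by apply: measurable_shift; exact: measurable_continuous.
Qed.

Lemma integrable_dissipation f f' M x : nice f f' M ->
  itg (fun z => sqdiff f x z * kernel al z).
Proof.
move=> nf; have M0 := nice_ge0 nf.
apply: (integrable_kernel (a := 2 * M * M) (b := M ^+ 2)) => //.
- by apply: measurable_sqdiff; exact: nice_continuous nf.
- move=> z; rewrite /sqdiff normrX expr2 -mulrA ler_pM//.
    exact: nice_dist2 nf.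
  exact: nice_dist nf.
- move=> z; rewrite /sqdiff normrX.
  rewrite -[z ^+ 2](real_normK (num_real z)) -exprMn lerXn2r ?nnegrE ?mulr_ge0//.
  exact: nice_dist nf.
Qed.

(** An algebraic identity between the integrands; the excess over [f * levy al f f'] is what the
    energy estimate gains. *)
Lemma levy_half_sqr f f' M x : nice f f' M ->
  levy al (fun y => f y ^+ 2 / 2) (fun y => f y * f' y) x =
  f x * levy al f f' x + 2^-1 * dissipation f x.
Proof.
move=> nf; have i1 := integrable_levy al12 x nf; have i2 := integrable_dissipation x nf.
rewrite /levy /dissipation -(RintegralZl _ measurableT i1) -(RintegralZl _ measurableT i2).
rewrite -(RintegralD measurableT (integrableRZ _ i1) (integrableRZ _ i2)).
by apply: eq_Rintegral => z _; rewrite /taylor1 /sqdiff; field.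
Qed.

Variables (u ut ux : R -> R -> R).
Hypothesis Su : smooth_solution al u ut ux.

Definition weighted_dissipation l b t : R := \int[mu]_x (dissipation (u t) x * bump (l * x + b)).

Lemma solution_levy t x : 0 < t -> levy al (u t) (ux t) x = (frac_const al)^-1 * (ut t x + u t x * ux t x).
Proof.
move=> t0; case: Su => _ _ pde _; rewrite pde//.
by field; rewrite gt_eqF// frac_const_gt0.
Qed.

(** The product rule is solved for the dissipation, and the equation turns [levy al (u t) (ux t)]
    into a bounded continuous function. What remains is the integrability of [levy] of the
    square. *)
Lemma integrable_weighted_dissipation l b t : 0 < t -> 0 < l ->
  itg (fun x => dissipation (u t) x * bump (l * x + b)).
Proof.
move=> t0 l0; have [M [nu _ utM cut]] := solution_at Su t0.
have [_ cux uM uxM _] := nu; have cu := solution_continuous Su t0.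
have M0 := nice_ge0 nu.
have nu2 := nice_half_sqr nu; have [_ _ u2M _ _] := nu2.
have [i1 _] := levy_bump al12 b nu2 u2M l0.
have i2 : itg (fun x => u t x * (ut t x + u t x * ux t x) * bump (l * x + b)).
  apply: (integrable_mul_bump (B := M * (M + M * M))) => //.
    by apply: measurable_continuous => x; apply: cvgM; [exact: cu|apply: cvgD;
      [exact: cut|apply: cvgM; [exact: cu|exact: cux]]].
  move=> x; rewrite normrM ler_pM// (le_trans (ler_normD _ _))// lerD//.
  by rewrite normrM ler_pM.
have := integrableRB (integrableRZ 2 i1) (integrableRZ (2 * (frac_const al)^-1) i2).
congr (mu.-integrable _ (EFin \o _)); apply/funext => x.
by rewrite (levy_half_sqr _ nu) (solution_levy _ t0); field; rewrite gt_eqF// frac_const_gt0.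
Qed.

(** The equation is tested with [u] times the weight: the nonlocal part splits into [levy] of
    [u^2 / 2], which self-adjointness bounds, minus half the dissipation, and the flux is the
    derivative of [u^3 / 3]. Again the remainder contains only the sup of [u]. *)
Lemma energy_derivative l b T M t : 0 < l -> 0 < t < T ->
  (forall s x, 0 < s < T -> `|u s x| <= M) ->
  exists e', is_derive t 1 (fun s => \int[mu]_x (u s x ^+ 2 / 2 * bump (l * x + b))) e' /\
   e' <= - (frac_const al / 2 * weighted_dissipation l b t) +
     (frac_const al * (8 * kernel_cst al * (M ^+ 2 / 2) * l `^ (al - 1)) + M ^+ 3 / 3).
Proof.
move=> l0 /andP[t0 tT] uMT.
have fc0 := frac_const_gt0 al12.
have t0T : 0 < t < T by rewrite t0.
have uM x : `|u t x| <= M := uMT t x t0T.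
have M0 : 0 <= M := le_trans (normr_ge0 _) (uM 0).
exists (\int[mu]_x (u t x * ut t x * bump (l * x + b))); split.
  case: (Su) => _ S _ _; have [|M1 HM] := S (t / 2) (t + 1); first by apply/andP; split; lra.
  apply: (@is_derive_integral_bump _ (fun s x => u s x ^+ 2 / 2) (fun s x => u s x * ut s x)
      (t / 2) (t + 1) (M1 ^+ 2)) => //.
  - by apply/andP; split; lra.
  - move=> s x /HM[_ D _ _]; exact: (@derive_half_sqr _ (fun r => u r x) (fun r => ut r x)).
  - move=> s x /HM[[_ _ uM1 _ _] _ _ _]; rewrite normrM normrX [X in _ * X]gtr0_norm//.
    have : `|u s x| ^+ 2 <= M1 ^+ 2.
      by rewrite lerXn2r ?nnegrE// (le_trans (normr_ge0 _) (uM1 x)).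
    by have := sqr_ge0 `|u s x|; lra.
  - move=> s x /HM[[_ _ uM1 _ _] _ utM1 _]; rewrite normrM expr2 ler_pM//.
  - move=> s /andP[s1 _]; apply: measurable_funM => //; apply: measurable_funX.
    apply: (solution_measurable Su); lra.
have [M1 [nu _ utM cut]] := solution_at Su t0.
have [Du cux uM1 uxM _] := nu; have cu := solution_continuous Su t0.
have M10 := nice_ge0 nu.
have u2M x : `|u t x ^+ 2 / 2| <= M ^+ 2 / 2.
  by rewrite normrM normrX [X in _ * X]gtr0_norm// ler_pM2r// lerXn2r ?nnegrE.
have [i1 b1] := levy_bump al12 b (nice_half_sqr nu) u2M l0.
have i2 := integrable_weighted_dissipation b t0 l0.
have cF : continuous (fun x => u t x ^+ 2 * ux t x).
  have -> : (fun x => u t x ^+ 2 * ux t x) = (fun x => u t x * u t x * ux t x).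
    by apply/funext => x; rewrite expr2.
  by move=> x; apply: cvgM; [apply: cvgM; exact: cu|exact: cux].
have FM x : `|u t x ^+ 2 * ux t x| <= M ^+ 2 * M1.
  by rewrite normrM normrX ler_pM ?exprn_ge0// lerXn2r ?nnegrE.
have i3 : itg (fun x => u t x ^+ 2 * ux t x * bump (l * x + b)).
  exact: (integrable_mul_bump b l0 (measurable_continuous cF) FM).
have u3M x : `|u t x ^+ 3 / 3| <= M ^+ 3 / 3.
  by rewrite normrM normrX [X in _ * X]gtr0_norm// ler_pM2r// lerXn2r ?nnegrE.
have ibp := integration_by_parts_bump b l0 (fun x => derive_third_cube (Du x)) cF u3M FM.
have b3 : `|\int[mu]_x (u t x ^+ 2 * ux t x * bump (l * x + b))| <= M ^+ 3 / 3.
  rewrite ibp normrN.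
  have -> : M ^+ 3 / 3 = (M ^+ 3 / 3 * l) / l by field; rewrite gt_eqF.
  apply: (norm_Rintegral_le_bump (b := b)) => //.
    apply: measurable_funM; last exact: measurable_bump1_affine.
    apply: measurable_funM => //; apply: measurable_funX; exact: measurable_continuous.
  move=> x; rewrite normrM -mulrA; apply: ler_pM => //; exact: bump1_affine_bound.
have -> : \int[mu]_x (u t x * ut t x * bump (l * x + b)) =
   frac_const al * \int[mu]_x (levy al (fun y => u t y ^+ 2 / 2) (fun y => u t y * ux t y) x * bump (l * x + b))
   - frac_const al / 2 * weighted_dissipation l b t
   - \int[mu]_x (u t x ^+ 2 * ux t x * bump (l * x + b)).
  rewrite /weighted_dissipation -(RintegralZl _ measurableT i1) -(RintegralZl _ measurableT i2).
  rewrite -(RintegralB measurableT (integrableRZ _ i1) (integrableRZ _ i2)).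
  rewrite -(RintegralB measurableT (integrableRB (integrableRZ _ i1) (integrableRZ _ i2)) i3).
  apply: eq_Rintegral => x _.
  by rewrite (levy_half_sqr _ nu) (solution_levy _ t0); field; rewrite gt_eqF.
move: b1 b3; rewrite !ler_norml => /andP[_ b1] /andP[b3 _].
by have := b1; rewrite -(ler_pM2l fc0); lra.
Qed.

(** Otherwise the dissipation exceeds [eta / t] for all small [t]. Its time integral would then
    diverge logarithmically at 0, whereas the weighted energy stays bounded. *)
Lemma small_dissipation l b T M eta t1 : 0 < l -> 0 < T ->
  (forall s x, 0 < s < T -> `|u s x| <= M) -> 0 < eta -> 0 < t1 < T ->
  exists t, 0 < t < t1 /\ t * weighted_dissipation l b t <= eta.
Proof.
move=> l0 T0 uM eta0 /andP[t10 t1T]; have fc0 := frac_const_gt0 al12.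
apply: contrapT => /forallNP H.
have HD t : 0 < t < t1 -> eta / t < weighted_dissipation l b t.
  move=> tt; have t0 : 0 < t by case/andP: tt.
  by rewrite ltr_pdivrMr// mulrC ltNge; apply/negP => h; apply: (H t).
pose e s := \int[mu]_x (u s x ^+ 2 / 2 * bump (l * x + b)).
have M0 : 0 <= M.
  by apply: le_trans (normr_ge0 (u (T / 2) 0)) (uM _ _ _); apply/andP; split; lra.
have eb s : 0 < s < T -> `|e s| <= M ^+ 2 / 2 / l.
  move=> sT; have s0 : 0 < s by case/andP: sT.
  apply: (norm_Rintegral_le_bump (b := b)) => //.
    apply: measurable_funM.
      apply: measurable_funM => //; apply: measurable_funX; exact: (solution_measurable Su).
    by apply: measurable_continuous; exact: continuous_bump_affine.
  move=> x; rewrite normrM (gtr0_norm (bump_gt0 _)) ler_wpM2r ?(ltW (bump_gt0 _))//.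
  by rewrite normrM normrX [X in _ * X]gtr0_norm// ler_pM2r// lerXn2r ?nnegrE// uM.
set K := frac_const al * (8 * kernel_cst al * (M ^+ 2 / 2) * l `^ (al - 1)) + M ^+ 3 / 3.
pose k := frac_const al / 2 * eta.
have k0 : 0 < k by rewrite mulr_gt0// divr_gt0.
(* Nonincreasing by the energy estimate, yet driven to minus infinity as [s -> 0] by the
   logarithm. *)
pose g s := e s + k * ln s - K * s.
have Dg s : 0 < s < t1 -> exists2 g', is_derive s 1 g g' & g' <= 0.
  move=> /andP[s0 st1]; have sT : 0 < s < T by rewrite s0 (lt_trans st1).
  have [e' [De e'le]] := energy_derivative b l0 sT uM.
  exists (e' + k * s^-1 - K).
    refine (derive_eq (derive_sub (derive_add De (derive_mul (derive_cst k s) (is_derive1_ln s0)))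
      (derive_mul (derive_cst K s) (derive_idfun s))) _).
    by ring.
  have sD := HD s; rewrite s0 st1 in sD; have {}sD := sD isT.
  have : frac_const al / 2 * (eta / s) <= frac_const al / 2 * weighted_dissipation l b s.
    by rewrite ler_wpM2l ?divr_ge0 ?ltW.
  by rewrite mulrA -/k; move: e'le; rewrite -/K; lra.
pose t0 := t1 / 2.
have t00 : 0 < t0 < t1 by apply/andP; rewrite /t0; split; lra.
have gmono s : 0 < s < t0 -> g t0 <= g s.
  move=> /andP[s0 st]; have /andP[_ t0t1] := t00.
  apply: derive_nonincreasing; first exact: ltW.
  by move=> r /andP[r1 r2]; apply: Dg; apply/andP; split; lra.
have t0T : 0 < t0 < T by case/andP: t00 => -> /lt_trans; apply.
pose E := M ^+ 2 / 2 / l.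
have E0 : 0 <= E by rewrite /E divr_ge0 ?divr_ge0 ?sqr_ge0// ltW.
(* Chosen so that [ln s <= X] entails [g s <= g t0 - k], against monotonicity. *)
pose X := (g t0 - E - `|K| * T) / k - 1.
pose s := Num.min (expR X) (t0 / 2).
have /andP[t0p _] := t00.
have s0 : 0 < s by rewrite lt_min expR_gt0/= divr_gt0.
have st0 : s < t0 by rewrite gt_min; apply/orP; right; lra.
have s0t : 0 < s < t0 by rewrite s0.
have sT : 0 < s < T by rewrite s0 (lt_trans st0)//; case/andP: t0T.
have := gmono s s0t; have := eb s sT; rewrite ler_norml => /andP[_ es].
have lns : ln s <= X.
  by rewrite -[leRHS]expRK ler_ln ?posrE ?expR_gt0// ge_min lexx.
have kX : k * ln s <= g t0 - E - `|K| * T - k.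
  have -> : g t0 - E - `|K| * T - k = k * X by rewrite /X; field; rewrite gt_eqF.
  by rewrite ler_wpM2l// ltW.
have Ks : - (K * s) <= `|K| * T.
  apply: le_trans (ler_norm _) _; rewrite normrN normrM ler_wpM2l// gtr0_norm// ltW//.
  by case/andP: sT.
by move: es kX Ks; rewrite /g -/E; lra.
Qed.

End Energy.

(** * Mollification errors *)

Section Trace.
Context {R : realType}.
Notation mu := (@lebesgue_measure R).
Notation itg f := (mu.-integrable [set: R] (EFin \o f)).
Implicit Types (f g h : R -> R) (a b s t x y z c l m B K M T : R).

(** Half of the exponential decay of [bump] pays for the linear factor. *)
Lemma norm_mul_bump_le y : `|y| * bump y <= 4 * bump (2^-1 * y).
Proof.
set a := `|y|; have a0 : 0 <= a by rewrite /a.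
have h1 : a <= expR (a / 2).
  have -> : a / 2 = 2%:R * (a / 4) by field.
  rewrite expRM_natl; have h := expR_ge1Dx (a / 4).
  have : (1 + a / 4) ^+ 2 <= expR (a / 4) ^+ 2 by rewrite lerXn2r ?nnegrE ?expR_ge0//; lra.
  by have := sqr_ge0 (1 - a / 4); rewrite !expr2; lra.
apply: le_trans (bump_lb _).
have -> : `|2^-1 * y| = a / 2 by rewrite normrM gtr0_norm ?invr_gt0// mulrC.
apply: (@le_trans _ _ (a * expR (- a))); first by rewrite ler_wpM2l// bump_ub.
have -> : expR (- a) = expR (- (a / 2)) * expR (- (a / 2)) by rewrite -expRD; congr expR; field.
rewrite mulrA ler_piMl ?expR_ge0//.
by rewrite expRN ler_pdivrMr ?expR_gt0// mul1r.
Qed.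

(** Exponential decay lies below the power decay of the kernel, which lets the dissipation control a
    mollification error. The exponent [1 + al] is less than 3, and 27 comes from
    [(1 + a / 3)^3 <= exp a]. *)
Lemma bump_le_kernel (al l z : R) : 1 < al < 2 -> 0 < l -> z != 0 ->
  l * bump (l * z) <= 27 * l `^ (- al) * kernel al z.
Proof.
move=> /andP[al1 al2] l0 z0; set a := `|l * z|.
have a0 : 0 < a by rewrite normr_gt0 mulf_neq0// gt_eqF.
have h3 : 1 + a ^+ 3 <= 27 * expR a.
  have -> : expR a = expR (a / 3) ^+ 3 by rewrite -expRM_natl; congr expR; field.
  have h := expR_ge1Dx (a / 3).
  have : (1 + a / 3) ^+ 3 <= expR (a / 3) ^+ 3 by rewrite lerXn2r ?nnegrE ?expR_ge0//; lra.
  have : 0 <= a ^+ 2 by rewrite sqr_ge0.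
  have : 0 <= a ^+ 3 by rewrite exprn_ge0// ltW.
  have -> : (1 + a / 3) ^+ 3 = 1 + a + a ^+ 2 / 3 + a ^+ 3 / 27 by field.
  lra.
have hp : a `^ (1 + al) <= 1 + a ^+ 3.
  have [a1|a1] := leP a 1.
    apply: (@le_trans _ _ 1); last by rewrite lerDl exprn_ge0// ltW.
    by rewrite -[leRHS](powRr0 a) ger_powR// ?a0//; lra.
  apply: (@le_trans _ _ (a ^+ 3)); last by rewrite lerDr.
  by rewrite -powR_mulrn ?(ltW a0)// ler_powR ?(ltW a1)//; lra.
have hb : a `^ (1 + al) * bump (l * z) <= 27.
  apply: (@le_trans _ _ (27 * expR a * expR (- a))).
    apply: ler_pM; rewrite ?powR_ge0 ?(ltW (bump_gt0 _)) ?bump_ub//; exact: le_trans hp h3.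
  by rewrite -mulrA -expRD subrr expR0 mulr1.
have ak : a `^ (1 + al) = l `^ (1 + al) * `|z| `^ (1 + al).
  by rewrite /a normrM (gtr0_norm l0) powRM// ltW.
have zp : 0 < `|z| `^ (1 + al) by rewrite powR_gt0// normr_gt0.
rewrite /kernel ler_pdivlMr//.
have lE : l = l `^ (- al) * l `^ (1 + al).
  have e1 : - al + (1 + al) = 1 by ring.
  rewrite -powRD; first by rewrite e1 powRr1// ltW.
  by rewrite (gt_eqF l0) implybT.
rewrite [X in X * bump _ * _]lE.
have -> : l `^ (- al) * l `^ (1 + al) * bump (l * z) * `|z| `^ (1 + al) =
  l `^ (- al) * (a `^ (1 + al) * bump (l * z)) by rewrite ak; ring.
by rewrite [27 * _]mulrC ler_wpM2l// powR_ge0.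
Qed.

Variable al : R.
Hypothesis al12 : 1 < al < 2.

Lemma integral_bump_mass l x : 0 < l -> \int[mu]_y (l * bump (l * y + - (l * x))) = 1.
Proof.
move=> l0; rewrite RintegralZl//; last exact: integrable_bump.
by rewrite /Rintegral integral_bump//= divff ?gt_eqF.
Qed.

(* AM-GM: [|d| <= d^2 / (2 th) + th / 2] *)
Lemma mollify_dissipation f f' M l th x : nice f f' M -> 0 < l -> 0 < th ->
  `|f x - \int[mu]_y (f y * (l * bump (l * y + - (l * x))))| <=
    27 * l `^ (- al) / (2 * th) * dissipation al f x + th / 2.
Proof.
move=> nf l0 th0; have [Df cf' fM f'M _] := nf; have cf := nice_continuous nf.
have mf := measurable_continuous cf.
set b := - (l * x); pose rho y := l * bump (l * y + b).
have irho : itg rho by apply: integrableRZ; exact: integrable_bump.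
have mrho : measurable_fun [set: R] rho.
  by apply: measurable_funM => //; apply: measurable_continuous; exact: continuous_bump_affine.
have rho0 y : 0 <= rho y by rewrite mulr_ge0 ?(ltW l0)// ltW// bump_gt0.
have M0 := nice_ge0 nf.
have ib g B : measurable_fun [set: R] g -> (forall y, `|g y| <= B) -> itg (fun y => g y * rho y).
  move=> mg gB; have := integrableRZ l (integrable_mul_bump b l0 mg gB).
  by congr (mu.-integrable _ (EFin \o _)); apply/funext => y; rewrite /rho; ring.
have if1 : itg (fun y => f y * rho y) := ib f M mf fM.
have -> : f x - \int[mu]_y (f y * rho y) = \int[mu]_y (f x * rho y - f y * rho y).
  rewrite (RintegralB measurableT (integrableRZ _ irho) if1) (RintegralZl _ measurableT irho).
  by rewrite integral_bump_mass// mulr1.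
have msq : measurable_fun [set: R] (fun y => (f y - f x) ^+ 2 / (2 * th)).
  by apply: measurable_funM => //; apply: measurable_funX; exact: measurable_funB.
have fd y : `|f y - f x| <= 2 * M.
  by apply: le_trans (ler_normB _ _) _; rewrite mulr_natl mulr2n lerD.
have isq : itg (fun y => (f y - f x) ^+ 2 / (2 * th) * rho y).
  apply: (ib _ ((2 * M) ^+ 2 / (2 * th))) => // y.
  have t20 : 0 < 2 * th by rewrite mulr_gt0.
  rewrite normrM normrX normfV (gtr0_norm t20) ler_pM2r ?invr_gt0//.
  by rewrite lerXn2r ?nnegrE// mulr_ge0.
apply: le_trans (le_normr_Rintegral measurableT (integrableRB (integrableRZ (f x) irho) if1)) _.
apply: (@le_trans _ _ (\int[mu]_y ((f y - f x) ^+ 2 / (2 * th) * rho y + th / 2 * rho y))).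
  apply: le_Rintegral => //.
  - have := integrable_norm (integrableRB (integrableRZ (f x) irho) if1).
    by apply.
  - exact: (integrableRD isq (integrableRZ (th / 2) irho)).
  - move=> y _; rewrite -mulrBl -mulrDl normrM (ger0_norm (rho0 y)) ler_wpM2r//.
    rewrite distrC -(real_normK (num_real (f y - f x))).
    set d := `|f y - f x|; rewrite -subr_ge0.
    have -> : d ^+ 2 / (2 * th) + th / 2 - d = (d - th) ^+ 2 / (2 * th).
      by field; rewrite gt_eqF.
    by rewrite divr_ge0 ?sqr_ge0// mulr_ge0// ltW.
rewrite (RintegralD measurableT isq (integrableRZ (th / 2) irho)).
rewrite (RintegralZl _ measurableT irho) integral_bump_mass// mulr1 lerD2r.
rewrite -(Rintegral_shift x isq) /dissipation.
have id := integrable_dissipation al12 x nf.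
rewrite -(RintegralZl _ measurableT id); apply: le_Rintegral => //.
- exact: (integrable_shift x isq).
- exact: integrableRZ.
move=> z _; rewrite /sqdiff [z + x]addrC.
have [->|z0] := eqVneq z 0.
  rewrite addr0 subrr expr0n/= !mul0r mulr0//.
have -> : rho (x + z) = l * bump (l * z) by rewrite /rho /b; congr (_ * bump _); ring.
have hk := bump_le_kernel al12 l0 z0.
have -> : 27 * l `^ (- al) / (2 * th) * ((f (x + z) - f x) ^+ 2 * kernel al z) =
  (f (x + z) - f x) ^+ 2 / (2 * th) * (27 * l `^ (- al) * kernel al z).
  by field; rewrite gt_eqF.
by apply: ler_wpM2l => //; rewrite divr_ge0 ?sqr_ge0// mulr_ge0// ltW.
Qed.

(** The error is [Lg] times the first moment of the mollifier. The factor |y - x| is absorbed by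
    passing to the weight of parameter [l / 2], of mass [2 / l]. *)
Lemma mollify_lipschitz g Lg B l x : measurable_fun [set: R] g -> (forall y, `|g y| <= B) ->
  (forall y, `|g y - g x| <= Lg * `|y - x|) -> 0 < l ->
  `|\int[mu]_y (g y * (l * bump (l * y + - (l * x)))) - g x| <= 8 * Lg / l.
Proof.
move=> mg gB gL l0; set b := - (l * x); pose rho y := l * bump (l * y + b).
have irho : itg rho by apply: integrableRZ; exact: integrable_bump.
have ig : itg (fun y => g y * rho y).
  have := integrableRZ l (integrable_mul_bump b l0 mg gB).
  by congr (mu.-integrable _ (EFin \o _)); apply/funext => y; rewrite /rho; ring.
have Lg0 : 0 <= Lg.
  by have := le_trans (normr_ge0 _) (gL (x + 1)); rewrite addrAC subrr add0r normr1 mulr1.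
have -> : \int[mu]_y (g y * rho y) - g x = \int[mu]_y ((g y - g x) * rho y).
  have -> : g x = \int[mu]_y (g x * rho y).
    by rewrite (RintegralZl _ measurableT irho) integral_bump_mass// mulr1.
  rewrite -(RintegralB measurableT ig (integrableRZ (g x) irho)).
  rewrite (RintegralZl _ measurableT irho) integral_bump_mass// mulr1.
  by apply: eq_Rintegral => y _; rewrite mulrBl.
have l20 : 0 < l / 2 by rewrite divr_gt0.
have -> : 8 * Lg / l = 4 * Lg / (l / 2) by field; rewrite gt_eqF.
apply: (norm_Rintegral_le_bump (b := b / 2)) => //.
  apply: measurable_funM; first exact: measurable_funB.
  by apply: measurable_funM => //; apply: measurable_continuous; exact: continuous_bump_affine.
move=> y; have lyb : l * y + b = l * (y - x) by rewrite /b; ring.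
have -> : l / 2 * y + b / 2 = 2^-1 * (l * (y - x)) by rewrite -lyb; field.
rewrite /rho lyb normrM normrM (gtr0_norm l0) (gtr0_norm (bump_gt0 _)).
apply: (@le_trans _ _ (Lg * (`|l * (y - x)| * bump (l * (y - x))))).
  have -> : Lg * (`|l * (y - x)| * bump (l * (y - x))) = Lg * `|y - x| * (l * bump (l * (y - x))).
    by rewrite normrM (gtr0_norm l0); ring.
  by apply: ler_wpM2r => //; rewrite mulr_ge0 ?(ltW l0)// ltW// bump_gt0.
by rewrite [4 * Lg]mulrC -mulrA ler_wpM2l// norm_mul_bump_le.
Qed.

(** By Tonelli the mollifier is integrated in [x] first, with mass 1 since [bump] is even; the
    factor [4^-1] is the sup of the other weight. *)
Lemma integral_mollify_abs f m l b : itg f -> 0 < m -> 0 < l ->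
  let P x := \int[mu]_y (`|f y| * (m * bump (m * y + - (m * x)))) in
  itg (fun x => P x * bump (l * x + b)) /\
  \int[mu]_x (P x * bump (l * x + b)) <= 4^-1 * \int[mu]_y `|f y|.
Proof.
move=> jf m0 l0 P.
have mf : measurable_fun [set: R] f by case/integrableP : jf => /measurable_EFinP.
have mb k c : measurable_fun [set: R] (fun x => bump (k * x + c)).
  by apply: measurable_continuous; exact: continuous_bump_affine.
pose G (p : measurableTypeR R * measurableTypeR R) : \bar R :=
  (`|f p.2| * (m * bump (m * p.2 + - (m * p.1))) * bump (l * p.1 + b))%:E.
have mlin : measurable_fun [set: (measurableTypeR R * measurableTypeR R)%type]
    (fun p : measurableTypeR R * measurableTypeR R => (m * p.2 + - (m * p.1) : R)).
  apply: measurable_funD; first exact: measurable_funM.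
  by apply: measurableT_comp => //; exact: measurable_funM.
have mG : measurable_fun setT G.
  apply/measurable_EFinP; apply: measurable_funM; last exact: (measurableT_comp (mb l b)).
  apply: measurable_funM.
    by apply: measurableT_comp => //; exact: measurableT_comp.
  apply: measurable_funM => //; apply: measurableT_comp mlin.
  by apply: measurable_continuous; exact: continuous_bump.
have b0 (y : R) : 0 <= bump y := ltW (bump_gt0 y).
have G0 p : (0 <= G p)%E.
  by rewrite lee_fin; apply: mulr_ge0 => //; apply: mulr_ge0 => //; apply: mulr_ge0 => //; exact: ltW.
have inorm : itg (fun y => `|f y|) by exact: (integrable_norm jf).
have ifm x : itg (fun y => `|f y| * (m * bump (m * y + - (m * x)))).
  apply: (@le_integrable _ _ _ mu _ _ _ (EFin \o (fun y => m / 4 * `|f y|))) => //.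
  - apply/measurable_EFinP; apply: measurable_funM; first exact: measurableT_comp.
    by apply: measurable_funM => //; exact: mb.
  - move=> y _; rewrite lee_fin (le_trans _ (ler_norm _))// normrM normr_id mulrC ler_wpM2r//.
    by rewrite normrM (gtr0_norm m0) ger0_norm// ler_wpM2l ?(ltW m0)// bump_le.
  - exact: integrableRZ.
have Ex x : (\int[mu]_y G (x, y) = (P x * bump (l * x + b))%:E)%E.
  rewrite /G/=; under eq_integral do rewrite EFinM.
  rewrite integralZr//; last exact: ifm.
  by rewrite [RHS]EFinM; congr (_ * _)%E; rewrite /P /Rintegral fineK//; apply: integrable_fin_num => //; exact: ifm.
have Ey y : (\int[mu]_x G (x, y) <= (4^-1 * `|f y|)%:E)%E.
  have hb (x : R) : bump (m * y + - (m * x)) = bump (m * x + - (m * y)).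
    by rewrite -bumpN; congr bump; ring.
  apply: (@le_trans _ _ (\int[mu]_x ((4^-1 * `|f y| * m) * bump (m * x + - (m * y)))%:E)%E).
    apply: ge0_le_integral => //.
    - apply/measurable_EFinP; apply: measurable_funM; last exact: mb.
      have -> : (fun x : R => `|f (x, y).2| * (m * bump (m * (x, y).2 + - (m * (x, y).1)))) =
          (fun x : R => `|f y| * (m * bump (m * y + - (m * x)))) by [].
      apply: measurable_funM; first exact: measurable_cst.
      have -> : (fun x : R => m * bump (m * y + - (m * x))) = (fun x : R => m * bump (m * x + - (m * y))).
        by apply/funext => x; rewrite hb.
      by apply: measurable_funM; [exact: measurable_cst|exact: mb].
    - by apply/measurable_EFinP; apply: measurable_funM => //; exact: mb.
    - move=> x _; rewrite lee_fin /= hb.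
      have -> : 4^-1 * `|f y| * m * bump (m * x + - (m * y)) =
         `|f y| * (m * bump (m * x + - (m * y))) * 4^-1 by ring.
      by apply: ler_wpM2l; [apply: mulr_ge0 => //; apply: mulr_ge0 => //; exact: ltW|exact: bump_le].
  under eq_integral do rewrite EFinM.
  rewrite ge0_integralZl//.
  - by rewrite integral_bump// -EFinM lee_fin mulfK// gt_eqF.
  - by apply/measurable_EFinP; exact: mb.
  - by move=> x _; rewrite lee_fin.
  - by rewrite lee_fin; apply: mulr_ge0; [apply: mulr_ge0|exact: ltW].
have tot : (\int[mu]_x \int[mu]_y G (x, y) <= (4^-1 * \int[mu]_y `|f y|)%:E)%E.
  rewrite (fubini_tonelli _ mG G0).
  apply: (@le_trans _ _ (\int[mu]_y (4^-1 * `|f y|)%:E)%E).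
    apply: ge0_le_integral => //.
    - by move=> y _; apply: integral_ge0.
    - exact: (measurable_fun_fubini_tonelli_G _ mG G0).
    - by apply/measurable_EFinP; apply: measurable_funM => //; exact: measurableT_comp.
  have i4 := integrableRZ 4^-1 inorm.
  rewrite -(RintegralZl _ measurableT inorm) /Rintegral fineK//.
  exact: integrable_fin_num.
have mP : measurable_fun [set: R] (fun x => (P x * bump (l * x + b))%:E).
  have := @measurable_fun_fubini_tonelli_F _ _ _ _ R mu G mG G0.
  by congr (measurable_fun _ _); apply/funext => x; rewrite /fubini_F Ex.
have P0 x : 0 <= P x * bump (l * x + b).
  apply: mulr_ge0 => //; apply: Rintegral_ge0 => y _; apply: mulr_ge0 => //.
  by apply: mulr_ge0 => //; exact: ltW.
have tot2 : (\int[mu]_x (P x * bump (l * x + b))%:E <= (4^-1 * \int[mu]_y `|f y|)%:E)%E.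
  by apply: le_trans tot; rewrite le_eqVlt; apply/orP; left; apply/eqP; apply: eq_integral => x _; rewrite Ex.
have iP : itg (fun x => P x * bump (l * x + b)).
  apply/integrableP; split; first exact: mP.
  under eq_integral do rewrite /= ger0_norm//.
  by apply: le_lt_trans tot2 _; exact: ltry.
split; first exact: iP.
by rewrite -lee_fin {1}/Rintegral fineK//; apply: integrable_fin_num.
Qed.

End Trace.

(** * Weighted L1 trace along a sequence of times *)

Section InitialTrace.
Context {R : realType}.
Notation mu := (@lebesgue_measure R).
Notation itg f := (mu.-integrable [set: R] (EFin \o f)).
Implicit Types (f g h : R -> R) (a b s t x y z c l m B K M T : R).

Variables (al : R) (u ut ux : R -> R -> R) (u0 w0 : R -> R) (Lw Bw T M : R).
Hypothesis al12 : 1 < al < 2.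
Hypothesis Su : smooth_solution al u ut ux.
Hypothesis T0 : 0 < T.
Hypothesis uM : forall s x, 0 < s < T -> `|u s x| <= M.
Hypothesis mw0 : measurable_fun [set: R] w0.
Hypothesis w0B : forall x, `|w0 x| <= Bw.
Hypothesis w0L : forall x y, `|w0 y - w0 x| <= Lw * `|y - x|.
Hypothesis iuw : itg (fun x => u0 x - w0 x).
Hypothesis weak : forall m b, 0 < m ->
  (fun s => \int[mu]_x (u s x * bump (m * x + b))) s @[s --> 0^'+] -->
     \int[mu]_x (u0 x * bump (m * x + b)).

Let P m x := \int[mu]_y (`|u0 y - w0 y| * (m * bump (m * y + - (m * x)))).
Let C1 := frac_const al * (8 * kernel_cst al * M).

Let M0 : 0 <= M.
Proof.
have h : 0 < T / 2 < T by apply/andP; have := T0; split; lra.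
exact: le_trans (normr_ge0 _) (uM 0 h).
Qed.

Let C10 : 0 <= C1.
Proof.
have fc := ltW (frac_const_gt0 al12); have kc := ltW (kernel_cst_gt0 al12).
by apply: mulr_ge0 => //; apply: mulr_ge0 => //; apply: mulr_ge0.
Qed.

Let Lw0 : 0 <= Lw.
Proof. by have := le_trans (normr_ge0 _) (w0L 0 1); rewrite subr0 normr1 mulr1. Qed.

Let integrable_diff_bump m b : 0 < m -> itg (fun y => (u0 y - w0 y) * bump (m * y + b)).
Proof.
move=> m0.
have mf : measurable_fun [set: R] (fun x => u0 x - w0 x) by case/integrableP : iuw => /measurable_EFinP.
apply: (@le_integrable _ _ _ mu _ _ _ (EFin \o (fun y => `|u0 y - w0 y|))) => //.
- apply/measurable_EFinP; apply: measurable_funM => //.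
  by apply: measurable_continuous; exact: continuous_bump_affine.
- move=> y _; rewrite lee_fin normrM normr_id (gtr0_norm (bump_gt0 _)) ler_piMr//.
  by apply: le_trans (bump_le _) _; rewrite invf_le1//; lra.
- exact: (integrable_norm iuw).
Qed.

Lemma trace_pointwise t m th x : 0 < t < T -> 0 < m -> 0 < th ->
  `|u t x - w0 x| <= 27 * m `^ (- al) / (2 * th) * dissipation al (u t) x +
    (th / 2 + (C1 * m `^ al + M ^+ 2 / 2 * m) * t + 8 * Lw / m) + P m x.
Proof.
move=> tT m0 th0; have /andP[t0 _] := tT.
have [M1 [nu _ _ _]] := solution_at Su t0.
set b := - (m * x); set rho := fun y => m * bump (m * y + b).
have pull g : itg (fun y => g y * bump (m * y + b)) ->
    \int[mu]_y (g y * rho y) = m * \int[mu]_y (g y * bump (m * y + b)).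
  move=> ig; rewrite -(RintegralZl _ measurableT ig).
  by apply: eq_Rintegral => y _; rewrite /rho; ring.
have iu : itg (fun y => u t y * bump (m * y + b)).
  by apply: (integrable_mul_bump b m0 (solution_measurable Su t0)) => y; exact: uM.
have iw : itg (fun y => w0 y * bump (m * y + b)) := integrable_mul_bump b m0 mw0 w0B.
have id := integrable_diff_bump b m0.
have iu0 : itg (fun y => u0 y * bump (m * y + b)).
  have := integrableRD id iw.
  by congr (mu.-integrable _ (EFin \o _)); apply/funext => y; ring.
have h1 := mollify_dissipation al12 x nu m0 th0.
have h2 := @pairing_initial _ al u ut ux al12 Su u0 m b M T t m0 tT uM (@weak m b m0).
have h3 := mollify_lipschitz mw0 w0B (w0L x) m0.
have h4 : `|\int[mu]_y ((u0 y - w0 y) * rho y)| <= P m x.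
  have jd : itg (fun y => (u0 y - w0 y) * rho y).
    have := integrableRZ m id.
    by congr (mu.-integrable _ (EFin \o _)); apply/funext => y; rewrite /rho; ring.
  apply: le_trans (le_normr_Rintegral measurableT jd) _.
  rewrite /P le_eqVlt; apply/orP; left; apply/eqP; apply: eq_Rintegral => y _.
  rewrite normrM (@ger0_norm _ (rho y))// /rho mulr_ge0 ?(ltW m0)//; exact: ltW (bump_gt0 _).
rewrite -/b -/(rho _) in h1; rewrite -/b in h3.
set A := \int[mu]_y (u t y * rho y) in h1.
set W := \int[mu]_y (w0 y * rho y) in h3.
set D := \int[mu]_y ((u0 y - w0 y) * rho y) in h4.
have e2 : A - W - D = m * (\int[mu]_y (u t y * bump (m * y + b)) - \int[mu]_y (u0 y * bump (m * y + b))).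
  rewrite /A /W /D !pull// -!mulrBr; congr (_ * _).
  rewrite -(RintegralB measurableT iu iw) -(RintegralB measurableT (integrableRB iu iw) id).
  by rewrite -(RintegralB measurableT iu iu0); apply: eq_Rintegral => y _; ring.
have h2' : `|A - W - D| <= (C1 * m `^ al + M ^+ 2 / 2 * m) * t.
  rewrite e2 normrM (gtr0_norm m0).
  have -> : (C1 * m `^ al + M ^+ 2 / 2 * m) * t =
     m * ((frac_const al * (8 * kernel_cst al * M * m `^ (al - 1)) + M ^+ 2 / 2) * t).
    have al0 : 0 < al by case/andP: al12 => + _; apply: lt_trans.
    by rewrite -(mulr_powRB1 (ltW m0) al0) /C1; ring.
  by rewrite ler_pM2l.
(* [A], [W] and [D] are the mollifications of [u t], [w0] and [u0 - w0]. The four terms are the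
   error seen by the dissipation, the change in time, the Lipschitz error of [w0] and the mollified
   datum. *)
have -> : u t x - w0 x = (u t x - A) + (A - W - D) + (W - w0 x) + D by ring.
apply: le_trans (ler_normD _ _) _; apply: lerD => //.
apply: le_trans (ler_normD _ _) _; apply: (@le_trans _ _
  ((27 * m `^ (- al) / (2 * th) * dissipation al (u t) x + th / 2) +
   ((C1 * m `^ al + M ^+ 2 / 2 * m) * t) + 8 * Lw / m)); last by lra.
apply: lerD => //; apply: le_trans (ler_normD _ _) _; exact: lerD.
Qed.

Lemma trace_weighted t m th l b : 0 < t < T -> 0 < m -> 0 < th -> 0 < l ->
  \int[mu]_x (`|u t x - w0 x| * bump (l * x + b)) <=
    27 * m `^ (- al) / (2 * th) * weighted_dissipation al u l b t +
    (th / 2 + (C1 * m `^ al + M ^+ 2 / 2 * m) * t + 8 * Lw / m) / l +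
    4^-1 * \int[mu]_x `|u0 x - w0 x|.
Proof.
move=> tT m0 th0 l0; have /andP[t0 _] := tT.
have i1 := integrable_weighted_dissipation al12 Su b t0 l0.
have i2 := integrable_bump b l0.
have [i3 h3] := integral_mollify_abs b iuw m0 l0.
set k1 := 27 * _ / _; set k2 := (X in X / l).
have -> : k2 / l = k2 * \int[mu]_x bump (l * x + b).
  by rewrite /Rintegral integral_bump.
rewrite /weighted_dissipation -(RintegralZl _ measurableT i1) -(RintegralZl _ measurableT i2).
rewrite -(RintegralD measurableT (integrableRZ _ i1) (integrableRZ _ i2)).
apply: (@le_trans _ _ (\int[mu]_x (k1 * (dissipation al (u t) x * bump (l * x + b))
   + k2 * bump (l * x + b)) + \int[mu]_x (P m x * bump (l * x + b)))); last exact: lerD.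
rewrite -(RintegralD measurableT (integrableRD (integrableRZ _ i1) (integrableRZ _ i2)) i3).
apply: le_Rintegral => //.
- have mu_ := solution_measurable Su t0.
  apply: (integrable_mul_bump (B := M + Bw)) => //.
    by apply: measurableT_comp => //; exact: measurable_funB.
  by move=> x; rewrite normr_id (le_trans (ler_normB _ _))// lerD// uM.
- exact: (integrableRD (integrableRD (integrableRZ _ i1) (integrableRZ _ i2)) i3).
move=> x _; have := trace_pointwise x tT m0 th0; rewrite -/k1 -/k2 => h.
apply: (@le_trans _ _ ((k1 * dissipation al (u t) x + k2 + P m x) * bump (l * x + b))).
  by rewrite ler_wpM2r// ltW// bump_gt0.
by rewrite le_eqVlt; apply/orP; left; apply/eqP; rewrite -/(P m x); ring.
Qed.

(** The dissipation term carries [m^(-al)] and the change in time carries [m^al t], so the scale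
    [m^-1] must be balanced. With [m^(-al) = N t] the latter factor is [1 / N], and the former term
    is a constant times [t] times the dissipation, which is small at the times given by
    [small_dissipation]. *)
Lemma initial_trace l b eta t1 : 0 < l -> 0 < eta -> 0 < t1 < T ->
  exists t, 0 < t < t1 /\ \int[mu]_x (`|u t x - w0 x| * bump (l * x + b)) <=
    4^-1 * \int[mu]_x `|u0 x - w0 x| + eta.
Proof.
move=> l0 eta0 /andP[t10 t1T]; have /andP[al1 al2] := al12.
have el0 : 0 < eta * l by rewrite mulr_gt0.
pose th := eta * l / 2; have th0 : 0 < th by rewrite divr_gt0.
(* Large enough that the change in time, at most [(C1 + M^2 / 2) / N] before division by [l], costs
   no more than [eta / 4]. *)
pose N := 4 * (C1 + M ^+ 2 / 2 + 1) / (eta * l).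
have C1M : 0 <= C1 + M ^+ 2 / 2 by rewrite addr_ge0// divr_ge0 ?sqr_ge0.
have N0 : 0 < N by rewrite divr_gt0// mulr_gt0//; lra.
(* A cap on the scale [r]: at most 1, so that [m t <= m^al t], and small enough for the Lipschitz
   error. *)
pose kap := Num.min 1 (eta * l / (32 * (Lw + 1))).
have Lw1 : 0 < Lw + 1 by rewrite ltr_wpDl.
have kap0 : 0 < kap by rewrite lt_min ltr01/= divr_gt0// mulr_gt0.
(* Four errors share [eta] equally; this is the share of the dissipation term divided by its factor
   [27 N / (2 th)]. *)
pose eta' := eta / 4 * (2 * th) / (27 * N).
have eta'0 : 0 < eta'.
  by apply: divr_gt0; [apply: mulr_gt0; [exact: divr_gt0|exact: mulr_gt0]|exact: mulr_gt0].
pose t2 := Num.min t1 (kap `^ al / N).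
have t20 : 0 < t2 by rewrite lt_min t10/= divr_gt0// powR_gt0.
have t2T : 0 < t2 < T by rewrite t20/= gt_min t1T.
have [t [/andP[t0 tt2] tD]] := small_dissipation al12 Su b l0 T0 uM eta'0 t2T.
have [tt1 ttk] : t < t1 /\ t < kap `^ al / N by move: tt2; rewrite lt_min => /andP[].
exists t; split; first by rewrite t0.
have tT : 0 < t < T by rewrite t0 (lt_trans tt1).
pose r := (N * t) `^ al^-1.
have Nt0 : 0 < N * t by rewrite mulr_gt0.
have r0 : 0 < r by rewrite powR_gt0.
have al0 : al != 0 by rewrite gt_eqF// (lt_trans _ al1).
have ral : r `^ al = N * t by rewrite /r -powRrM mulVf// powRr1// ltW.
have rk : r <= kap.
  have : N * t <= kap `^ al by rewrite mulrC -ler_pdivlMr// ltW.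
  rewrite -ral => h; rewrite leNgt; apply/negP => hk.
  have : kap `^ al < r `^ al by rewrite gt0_ltr_powR ?nnegrE ?ltW//; lra.
  by rewrite ltNge h.
have r1 : r <= 1 by apply: le_trans rk _; rewrite ge_min lexx.
have rL : r <= eta * l / (32 * (Lw + 1)) by apply: le_trans rk _; rewrite ge_min lexx orbT.
pose m := r^-1; have m0 : 0 < m by rewrite invr_gt0.
have m1 : 1 <= m by rewrite /m invf_ge1.
have mr e : m `^ e = (r `^ e)^-1.
  by rewrite /m -powR_inv1 ?(ltW r0)// -powRrM mulN1r powRN.
have mal : m `^ (- al) = N * t by rewrite mr powRN invrK ral.
have mal2 : m `^ al * t = N^-1 by rewrite mr ral invfM -mulrA mulVf ?mulr1// gt_eqF.
have mt : m * t <= N^-1.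
  rewrite -mal2 ler_pM2r// -[X in X <= _]powRr1 ?(ltW m0)// ler_powR//; exact: ltW.
apply: le_trans (trace_weighted b tT m0 th0 l0) _.
have q1 : 27 * m `^ (- al) / (2 * th) * weighted_dissipation al u l b t <= eta / 4.
  have -> : 27 * m `^ (- al) / (2 * th) * weighted_dissipation al u l b t =
     27 * N / (2 * th) * (t * weighted_dissipation al u l b t) by rewrite mal; field; rewrite gt_eqF.
  have -> : eta / 4 = 27 * N / (2 * th) * eta' by rewrite /eta'; field; rewrite !gt_eqF.
  by apply: ler_wpM2l => //; apply: ltW; apply: divr_gt0; exact: mulr_gt0.
have q2 : th / 2 / l = eta / 4 by rewrite /th; field; rewrite gt_eqF.
have q3 : (C1 * m `^ al + M ^+ 2 / 2 * m) * t / l <= eta / 4.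
  rewrite ler_pdivrMr//.
  have -> : (C1 * m `^ al + M ^+ 2 / 2 * m) * t = C1 * (m `^ al * t) + M ^+ 2 / 2 * (m * t) by ring.
  apply: (@le_trans _ _ ((C1 + M ^+ 2 / 2) * N^-1)).
    rewrite mulrDl mal2 lerD2l ler_wpM2l// divr_ge0 ?sqr_ge0//.
  rewrite ler_pdivrMr//.
  have -> : eta / 4 * l * N = C1 + M ^+ 2 / 2 + 1 by rewrite /N; field; rewrite !gt_eqF.
  by rewrite lerDl.
have q4 : 8 * Lw / m / l <= eta / 4.
  rewrite /m invrK ler_pdivrMr//.
  have : 8 * (Lw + 1) * r <= 8 * (Lw + 1) * (eta * l / (32 * (Lw + 1))).
    by rewrite ler_wpM2l// mulr_ge0// ltW.
  have -> : 8 * (Lw + 1) * (eta * l / (32 * (Lw + 1))) = eta / 4 * l by field; rewrite gt_eqF.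
  by apply: le_trans; rewrite ler_wpM2r ?(ltW r0)//; lra.
have -> : (th / 2 + (C1 * m `^ al + M ^+ 2 / 2 * m) * t + 8 * Lw / m) / l =
  eta / 4 + (C1 * m `^ al + M ^+ 2 / 2 * m) * t / l + 8 * Lw / m / l.
  by rewrite -q2 -2!mulrDl.
by lra.
Qed.

End InitialTrace.

(** * The smooth profile *)

Section Profile.
Context {R : realType}.
Notation mu := (@lebesgue_measure R).
Notation itg f := (mu.-integrable [set: R] (EFin \o f)).
Implicit Types (f g h : R -> R) (a b s t x y z l m B K M T tau : R).

Lemma sigmoid_mono x z : 0 <= z -> sigmoid x <= sigmoid (x + z).
Proof.
move=> z0; have [y _ h] := mean_value_dist x z (@is_derive_sigmoid R).
by rewrite -subr_ge0 h mulr_ge0// ltW// bump_gt0.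
Qed.

Lemma softplus_incr x z : 0 <= z -> 0 <= softplus (x + z) - softplus x <= z.
Proof.
move=> z0; have [y _ ->] := mean_value_dist x z (@is_derive_softplus R).
by rewrite mulr_ge0 ?(ltW (sigmoid_gt0 _))//= ler_piMl// ltW// sigmoid_lt1.
Qed.

(** As [sigmoid] is monotone, its value at the intermediate point is no further from [sigmoid x]
    than [sigmoid (x + z)] is. Integration in [x] then yields z^2 without any second derivative. *)
Lemma taylor1_softplus_le x z :
  `|taylor1 softplus sigmoid x z| <= `|z| * `|sigmoid (x + z) - sigmoid x|.
Proof.
rewrite /taylor1; have [y [y1 y2 ->]] := mean_value x z (@is_derive_softplus R).
rewrite -mulrBl normrM mulrC ler_wpM2l//.
have mono (p q : R) : p <= q -> sigmoid p <= sigmoid q.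
  by move=> pq; have -> : q = p + (q - p) by [ring|]; apply: sigmoid_mono; rewrite subr_ge0.
have [z0|z0] := leP 0 z.
  have xz : x <= x + z by rewrite lerDl.
  rewrite (min_idPl xz) in y1; rewrite (max_idPr xz) in y2.
  by rewrite !ger0_norm ?subr_ge0 ?mono// lerD2r mono.
have xz : x + z <= x by rewrite gerDl ltW.
rewrite (min_idPr xz) in y1; rewrite (max_idPl xz) in y2.
by rewrite !ler0_norm ?subr_le0 ?mono// !opprB lerD2l lerN2 mono.
Qed.

Lemma integral_sigmoid_diff b z :
  (\int[mu]_x `|sigmoid (x + b + z) - sigmoid (x + b)|%:E <= `|z|%:E)%E.
Proof.
have [z0|z0] := leP 0 z.
  under eq_integral do rewrite ger0_norm ?subr_ge0 ?sigmoid_mono//.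
  by rewrite ger0_norm//; exact: integral_sigmoid_incr.
have nz0 : 0 <= - z by rewrite oppr_ge0 ltW.
have := integral_sigmoid_incr (b + z) nz0.
rewrite (ltr0_norm z0); apply: le_trans; rewrite le_eqVlt; apply/orP; left; apply/eqP.
apply: eq_integral => x _; congr EFin.
have -> : x + (b + z) + - z = x + b by ring.
have -> : x + (b + z) = x + b + z by ring.
rewrite distrC ger0_norm// subr_ge0.
have {2}-> : x + b = x + b + z + - z by ring.
exact: sigmoid_mono.
Qed.

Variables (c d : R).
Hypothesis cd : c < d.

(** Since [softplus] is the positive part convolved with [bump], this is the rarefaction wave at
    time [tau] convolved with [bump]. Equivalently, it is [c] plus the integral of
    [sigmoid (x - k * tau)] over the speeds [k] from [c] to [d]. *)
Definition profile tau x := c + (softplus (x - c * tau) - softplus (x - d * tau)) / tau.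
Definition profile_dx tau x := (sigmoid (x - c * tau) - sigmoid (x - d * tau)) / tau.
Definition profile_dt tau x := - (softplus (x - c * tau) - softplus (x - d * tau)) / tau ^+ 2
   + (d * sigmoid (x - d * tau) - c * sigmoid (x - c * tau)) / tau.
(** One crude constant, valid for [tau >= 1], for the profile, its first derivatives in time and
    space and its Taylor remainders. *)
Definition profile_bound := 2 * (`|c| + `|d|) + 1.

Let shiftE tau x : x - c * tau = x - d * tau + (d - c) * tau. Proof. ring. Qed.

Lemma profile_between tau x : 0 < tau -> c <= profile tau x <= d.
Proof.
move=> t0; have l0 : 0 <= (d - c) * tau by apply: mulr_ge0; [rewrite subr_ge0|]; exact: ltW.
have := softplus_incr (x - d * tau) l0; rewrite -shiftE /profile => /andP[h1 h2].
apply/andP; split; first by rewrite lerDl divr_ge0// ltW.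
by rewrite -lerBrDl ler_pdivrMr.
Qed.

Lemma profile_dx_bound tau x : 0 < tau -> 0 <= profile_dx tau x <= tau^-1.
Proof.
move=> t0; have l0 : 0 <= (d - c) * tau by apply: mulr_ge0; [rewrite subr_ge0|]; exact: ltW.
have := sigmoid_mono (x - d * tau) l0; rewrite -shiftE /profile_dx => h.
rewrite divr_ge0 ?subr_ge0 ?(ltW t0)//= ler_pdivrMr// mulVf ?gt_eqF//.
have := sigmoid_lt1 (x - c * tau); have := sigmoid_gt0 (x - d * tau); lra.
Qed.

Lemma derive_shift (f f' : R -> R) b x : (forall y, is_derive y 1 f (f' y)) ->
  is_derive x 1 (fun y => f (y - b)) (f' (x - b)).
Proof.
move=> Df; refine (derive_eq (derive_compose (g := fun y => y - b) (Df _)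
  (derive_sub (derive_idfun x) (derive_cst b x))) _).
by ring.
Qed.

Lemma is_derive_profile tau x : is_derive x 1 (profile tau) (profile_dx tau x).
Proof.
refine (derive_eq (derive_add (derive_cst c x) (derive_mul (derive_sub
  (derive_shift (c * tau) x (@is_derive_softplus R)) (derive_shift (d * tau) x (@is_derive_softplus R)))
  (derive_cst tau^-1 x))) _).
by rewrite /profile_dx; ring.
Qed.

Lemma is_derive_profile_dx tau x : is_derive x 1 (profile_dx tau)
  ((bump (x - c * tau) - bump (x - d * tau)) / tau).
Proof.
refine (derive_eq (derive_mul (derive_sub
  (derive_shift (c * tau) x (@is_derive_sigmoid R)) (derive_shift (d * tau) x (@is_derive_sigmoid R)))
  (derive_cst tau^-1 x)) _).
by ring.
Qed.

Lemma is_derive_profile_time t x : 0 <= t ->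
  is_derive t 1 (fun s => profile (1 + s) x) (profile_dt (1 + t) x).
Proof.
move=> t0; have tn0 : 1 + t != 0 by rewrite gt_eqF//; lra.
have Dl k : is_derive t 1 (fun s => x - k * (1 + s)) (- k).
  refine (derive_eq (derive_sub (derive_cst x t) (derive_mul (derive_cst k t)
    (derive_add (derive_cst 1 t) (derive_idfun t)))) _).
  by ring.
have Ds k : is_derive t 1 (fun s => softplus (x - k * (1 + s))) (sigmoid (x - k * (1 + t)) * - k).
  exact: (derive_compose (g := fun s => x - k * (1 + s)) (is_derive_softplus _) (Dl k)).
have Di : is_derive t 1 (fun s => (1 + s)^-1) (- 1 / (1 + t) ^+ 2).
  refine (derive_eq (derive_inv (f := fun s => 1 + s) tn0 (derive_add (derive_cst 1 t) (derive_idfun t))) _).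
  by rewrite add0r.
refine (derive_eq (derive_add (derive_cst c t) (derive_mul (derive_sub (Ds c) (Ds d)) Di)) _).
by rewrite /profile_dt; field.
Qed.

Lemma profile_nice tau : 1 <= tau -> nice (profile tau) (profile_dx tau) profile_bound.
Proof.
move=> t1; have t0 : 0 < tau by lra.
have ti1 : tau^-1 <= 1 by rewrite invf_le1.
have c0 := normr_ge0 c; have d0 := normr_ge0 d.
split.
- by move=> x; exact: is_derive_profile.
- exact: derive_continuous (is_derive_profile_dx tau).
- move=> x; have /andP[h1 h2] := profile_between x t0.
  have := ler_norm c; have := ler_norm (- c); have := ler_norm d; have := ler_norm (- d).
  by rewrite /profile_bound !normrN ler_norml => *; apply/andP; split; lra.
- move=> x; have /andP[h1 h2] := profile_dx_bound x t0.
  by rewrite ger0_norm// /profile_bound; lra.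
- move=> x z; apply: (taylor1_le2 (is_derive_profile tau) (is_derive_profile_dx tau)).
  move=> y _; rewrite normrM normfV (gtr0_norm t0) ler_pdivrMr//.
  have := bump_gt0 (y - c * tau); have := bump_gt0 (y - d * tau).
  have := bump_le (y - c * tau); have := bump_le (y - d * tau).
  move=> b1 b2 b3 b4; apply: (@le_trans _ _ 1); first by rewrite ler_norml; apply/andP; split; lra.
  by rewrite -[leLHS]mulr1 ler_pM// /profile_bound; lra.
Qed.

Lemma profile_dt_bound tau x : 1 <= tau -> `|profile_dt tau x| <= profile_bound.
Proof.
move=> t1; have t0 : 0 < tau by lra.
have ti1 : tau^-1 <= 1 by rewrite invf_le1.
have ti0 : 0 < tau^-1 by rewrite invr_gt0.
have /andP[h1 h2] := profile_between x t0.
have -> : profile_dt tau x = (- (profile tau x - c) +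
    (d * sigmoid (x - d * tau) - c * sigmoid (x - c * tau))) / tau.
  by rewrite /profile_dt /profile; field; rewrite gt_eqF.
have sb k : `|k * sigmoid (x - k * tau)| <= `|k|.
  by rewrite normrM (gtr0_norm (sigmoid_gt0 _)) ler_piMr// ltW// sigmoid_lt1.
rewrite normrM (gtr0_norm ti0) ler_pdivrMr//.
apply: (@le_trans _ _ profile_bound); last first.
  by rewrite ler_peMr// /profile_bound addr_ge0// mulr_ge0// addr_ge0.
apply: le_trans (ler_normD _ _) _; rewrite normrN.
apply: (@le_trans _ _ ((`|c| + `|d|) + (`|d| + `|c|))); last by rewrite /profile_bound; lra.
apply: lerD; last by apply: le_trans (ler_normB _ _) _; apply: lerD; exact: sb.
rewrite ger0_norm ?subr_ge0//; have := ler_norm d; have := ler_norm (- c); rewrite normrN; lra.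
Qed.

Lemma continuous_shift_fun (f : R -> R) b : continuous f -> continuous (fun x => f (x - b)).
Proof.
move=> cf x; apply: (@continuous_comp _ _ _ (fun y => y - b) f); last exact: cf.
by apply: cvgB; [exact: cvg_id|exact: cvg_cst].
Qed.

Lemma continuous_profile_dt tau : continuous (profile_dt tau).
Proof.
have cs (b : R) : continuous (fun x : R => softplus (x - b)).
  by apply: continuous_shift_fun; exact: continuous_softplus.
have cg (b : R) : continuous (fun x : R => sigmoid (x - b)).
  by apply: continuous_shift_fun; exact: continuous_sigmoid.
move=> x; apply: cvgD; (apply: cvgM; last exact: cvg_cst).
  by apply: cvgN; apply: cvgB; exact: cs.
by apply: cvgB; (apply: cvgM; [exact: cvg_cst|exact: cg]).
Qed.

(** On the left [softplus] decays exponentially; on the right [sigmoid (- y)] does, at twice the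
    rate of [bump (y / 2)], which leaves room for the linear growth of [softplus]. With
    [e = expR (y / 2)] the factors are at most [2 e] and [2 / (1 + e)^2]. *)
Lemma softplus_sigmoid_le y : softplus y * sigmoid (- y) <= 4 * bump (2^-1 * y).
Proof.
have -> : 2^-1 * y = y / 2 by rewrite mulrC.
set e := expR (y / 2); have e0 : 0 < e by exact: expR_gt0.
have ee : expR y = e ^+ 2 by rewrite /e -expRM_natl; congr expR; field.
have eN : expR (- (y / 2)) = e^-1 by rewrite expRN.
have s2 : softplus y <= 2 * e.
  rewrite /softplus -[leRHS](@expRK R) ler_ln ?posrE ?addr_gt0 ?expR_gt0//.
  rewrite ee; apply: (@le_trans _ _ ((1 + e) ^+ 2)); first by rewrite !expr2; nra.
  have -> : expR (2 * e) = expR e ^+ 2 by rewrite -expRM_natl.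
  have e1 : 0 <= 1 + e by lra.
  by rewrite lerXn2r ?nnegrE ?expR_ge0// expR_ge1Dx.
have -> : 4 * bump (y / 2) = 2 * e * (2 / (1 + 2 * e + e ^+ 2)).
  have -> : bump (y / 2) = e / (1 + 2 * e + e ^+ 2).
    rewrite bumpE eN -/e -[RHS]invf_div; congr (_^-1); field.
    by rewrite gt_eqF.
  by ring.
apply: ler_pM => //; [exact: softplus_ge0|exact: ltW (sigmoid_gt0 _)|].
rewrite /sigmoid opprK ee ler_pdivlMr; last by rewrite expr2; nra.
rewrite mulrC ler_pdivrMr; last by rewrite expr2; nra.
by have := sqr_ge0 (1 - e); rewrite !expr2; nra.
Qed.

Lemma profile_error_le tau x : 1 <= tau ->
  `|profile_dt tau x + profile tau x * profile_dx tau x| <=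
     4 / tau ^+ 2 * bump (2^-1 * x + - (2^-1 * (c * tau))) +
     4 / tau ^+ 2 * bump (2^-1 * x + - (2^-1 * (d * tau))).
Proof.
move=> t1; have t0 : 0 < tau by lra.
set p := x - c * tau; set q := x - d * tau.
have /andP[h1 h2] := profile_between x t0.
have -> : 2^-1 * x + - (2^-1 * (c * tau)) = 2^-1 * p by rewrite /p; ring.
have -> : 2^-1 * x + - (2^-1 * (d * tau)) = 2^-1 * q by rewrite /q; ring.
have wc : profile tau x - c <= softplus p / tau.
  have -> : profile tau x - c = (softplus p - softplus q) / tau by rewrite /profile -/p -/q; ring.
  by rewrite ler_pM2r ?invr_gt0// lerBlDr lerDl softplus_ge0.
have wd : d - profile tau x <= softplus (- q) / tau.
  have -> : d - profile tau x = (softplus (- q) - softplus (- p)) / tau.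
    by rewrite !softplusN /profile -/p -/q /p /q; field; rewrite gt_eqF.
  by rewrite ler_pM2r ?invr_gt0// lerBlDr lerDl softplus_ge0.
(* In the residual of the inviscid equation, [w - c] meets a factor that is small to the right of
   the corner [c tau], and [d - w] one that is small to the left of the corner [d tau]. Each product
   is thus localised at its corner. *)
have -> : profile_dt tau x + profile tau x * profile_dx tau x =
  (- ((profile tau x - c) * sigmoid (- p)) + (d - profile tau x) * sigmoid q) / tau.
  by rewrite -onem_sigmoid /profile_dt /profile_dx /profile -/p -/q; field; rewrite gt_eqF.
have ti0 : 0 < tau^-1 by rewrite invr_gt0.
have sq : sigmoid q = sigmoid (- - q) by rewrite opprK.
rewrite normrM (gtr0_norm ti0) ler_pdivrMr//.
apply: (@le_trans _ _ (softplus p / tau * sigmoid (- p) + softplus (- q) / tau * sigmoid q)).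
  apply: le_trans (ler_normD _ _) _; rewrite normrN.
  rewrite !normrM !(gtr0_norm (sigmoid_gt0 _)) !ger0_norm ?subr_ge0//.
  by apply: lerD; rewrite ler_wpM2r// ltW// sigmoid_gt0.
have e1 := softplus_sigmoid_le p; have e2 := softplus_sigmoid_le (- q).
have eq2 : bump (2^-1 * - q) = bump (2^-1 * q) by rewrite mulrN bumpN.
rewrite eq2 -sq in e2.
have -> : (4 / tau ^+ 2 * bump (2^-1 * p) + 4 / tau ^+ 2 * bump (2^-1 * q)) * tau =
   4 * bump (2^-1 * p) / tau + 4 * bump (2^-1 * q) / tau by field; rewrite gt_eqF.
have -> : softplus p / tau * sigmoid (- p) + softplus (- q) / tau * sigmoid q =
  softplus p * sigmoid (- p) / tau + softplus (- q) * sigmoid q / tau by ring.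
by apply: lerD; rewrite ler_pM2r.
Qed.

Lemma profile_error_integral tau : 1 <= tau ->
  (\int[mu]_x `|profile_dt tau x + profile tau x * profile_dx tau x|%:E <= (16 / tau ^+ 2)%:E)%E.
Proof.
move=> t1; have t0 : 0 < tau by lra.
have h0 : 0 < 2^-1 :> R by rewrite invr_gt0.
have cw : continuous (profile tau) := derive_continuous (is_derive_profile tau).
have cwx : continuous (profile_dx tau) := derive_continuous (is_derive_profile_dx tau).
have mb b : measurable_fun [set: R] (fun x => (4 / tau ^+ 2 * bump (2^-1 * x + b))%:E).
  apply/measurable_EFinP; apply: measurable_funM => //.
  by apply: measurable_continuous; exact: continuous_bump_affine.
have k0 : 0 <= 4 / tau ^+ 2 by rewrite divr_ge0// sqr_ge0.
have ib b : (\int[mu]_x (4 / tau ^+ 2 * bump (2^-1 * x + b))%:E = (8 / tau ^+ 2)%:E)%E.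
  under eq_integral do rewrite EFinM.
  rewrite ge0_integralZl//.
  - rewrite integral_bump// -EFinM; congr EFin; field; rewrite gt_eqF//.
  - by apply/measurable_EFinP; apply: measurable_continuous; exact: continuous_bump_affine.
  - by move=> x _; rewrite lee_fin ltW// bump_gt0.
apply: (@le_trans _ _ (\int[mu]_x ((4 / tau ^+ 2 * bump (2^-1 * x + - (2^-1 * (c * tau))))%:E +
     (4 / tau ^+ 2 * bump (2^-1 * x + - (2^-1 * (d * tau))))%:E))%E).
  apply: ge0_le_integral => //.
  - apply/measurable_EFinP; apply: measurableT_comp => //; apply: measurable_continuous => x.
    by apply: cvgD; [exact: continuous_profile_dt|apply: cvgM; [exact: cw|exact: cwx]].
  - by apply: emeasurable_funD; exact: mb.
  - by move=> x _; rewrite -EFinD lee_fin; exact: profile_error_le.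
have b0 b x : (0 <= (4 / tau ^+ 2 * bump (2^-1 * x + b))%:E)%E.
  by rewrite lee_fin mulr_ge0// ltW// bump_gt0.
rewrite ge0_integralD//; first by rewrite !ib -EFinD lee_fin; lra.
all: exact: mb.
Qed.

(** A double increment of [softplus], in [z] and in the step [ell]. The mean value theorem in [ell]
    leaves an increment of [sigmoid] at an unknown point; monotonicity replaces it by the increment
    over an interval containing every possible position, whose lower end uses [Num.min z 0] to allow
    both signs of [z]. *)
Lemma profile_diff_le tau x z : 0 < tau ->
  `|profile tau (x + z) - profile tau x| <= (d - c) *
    `|sigmoid (x + (- (d * tau) + Num.min z 0) + ((d - c) * tau + `|z|))
      - sigmoid (x + (- (d * tau) + Num.min z 0))|.
Proof.
move=> t0; set ell := (d - c) * tau; have ell0 : 0 < ell by rewrite mulr_gt0// subr_gt0.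
pose F y := softplus (y + z) - softplus y.
have DF y : is_derive y 1 F (sigmoid (y + z) - sigmoid y).
  apply: derive_sub; last exact: is_derive_softplus.
  have := derive_shift (- z) y (@is_derive_softplus R).
  by under eq_fun do rewrite opprK; rewrite opprK.
have [y [y1 y2 h]] := mean_value (x - d * tau) ell DF.
have ql : x - d * tau <= x - d * tau + ell by rewrite lerDl ltW.
rewrite (min_idPl ql) in y1; rewrite (max_idPr ql) in y2.
have -> : profile tau (x + z) - profile tau x = (F (x - d * tau + ell) - F (x - d * tau)) / tau.
  rewrite /F /profile -/ell -shiftE.
  have -> : x + z - c * tau = x - c * tau + z by ring.
  have -> : x + z - d * tau = x - d * tau + z by ring.
  by ring.
rewrite h.
have -> : (sigmoid (y + z) - sigmoid y) * ell / tau = (d - c) * (sigmoid (y + z) - sigmoid y).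
  by rewrite /ell; field; rewrite gt_eqF.
rewrite normrM gtr0_norm ?subr_gt0// ler_pM2l ?subr_gt0//.
set lo := x + _; set hi := lo + _.
have mono (p q : R) : p <= q -> sigmoid p <= sigmoid q.
  by move=> pq; have -> : q = p + (q - p) by [ring|]; apply: sigmoid_mono; rewrite subr_ge0.
have m1 : Num.min z 0 <= z by rewrite ge_min lexx.
have m2 : Num.min z 0 <= 0 by rewrite ge_min lexx orbT.
have m3 : z <= Num.min z 0 + `|z|.
  by have := ler_norm z; have := normr_ge0 z; rewrite /Num.min; case: ifP => _; lra.
have m4 : 0 <= Num.min z 0 + `|z|.
  by have := ler_norm (- z); have := normr_ge0 z; rewrite normrN /Num.min; case: ifP => _; lra.
have a1 : sigmoid lo <= sigmoid (y + z) by apply: mono; rewrite /lo; lra.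
have a2 : sigmoid lo <= sigmoid y by apply: mono; rewrite /lo; lra.
have a3 : sigmoid (y + z) <= sigmoid hi by apply: mono; rewrite /hi /lo; lra.
have a4 : sigmoid y <= sigmoid hi by apply: mono; rewrite /hi /lo; lra.
rewrite (@ger0_norm _ (sigmoid hi - _)); last by rewrite subr_ge0 (le_trans a2).
by rewrite ler_norml; apply/andP; split; lra.
Qed.

(** The quadratic bound gains [tau^-1] from the variation of [sigmoid]. The linear bound follows
    from it if |z| <= tau; otherwise increment and gradient term are bounded apart, and |z| > tau
    absorbs the length [(d - c) tau] of the wave. *)
Lemma integral_taylor1_profile tau z : 1 <= tau ->
  (\int[mu]_x `|taylor1 (profile tau) (profile_dx tau) x z|%:E <=
    (Num.min ((2 + (d - c) * (d - c + 2)) * `|z|) (2 / tau * z ^+ 2))%:E)%E.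
Proof.
move=> t1; have t0 : 0 < tau by lra.
have ti0 : 0 < tau^-1 by rewrite invr_gt0.
set ell := (d - c) * tau; have ell0 : 0 < ell by rewrite mulr_gt0// subr_gt0.
have dc0 : 0 < d - c by rewrite subr_gt0.
have cw : continuous (profile tau) := derive_continuous (is_derive_profile tau).
have cwx : continuous (profile_dx tau) := derive_continuous (is_derive_profile_dx tau).
have mt : measurable_fun [set: R] (fun x => `|taylor1 (profile tau) (profile_dx tau) x z|%:E).
  by apply/measurable_EFinP; apply: measurableT_comp => //; exact: measurable_taylor1_left.
pose S b k x : R := `|sigmoid (x + b + k) - sigmoid (x + b)|.
have mS b k : measurable_fun [set: R] (S b k).
  have cg (e : R) : continuous (fun x : R => sigmoid (x - e)).
    by apply: continuous_shift_fun; exact: continuous_sigmoid.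
  apply: measurableT_comp => //; apply: measurable_continuous => x; apply: cvgB.
    have -> : (fun y => sigmoid (y + b + k)) = (fun y => sigmoid (y - (- (b + k)))).
      by apply/funext => y; congr sigmoid; ring.
    have -> : x + b + k = x - (- (b + k)) by ring.
    exact: cg.
  have -> : (fun y => sigmoid (y + b)) = (fun y => sigmoid (y - - b)).
    by apply/funext => y; rewrite opprK.
  by rewrite -[b in x + b]opprK; exact: cg.
have iS b k m : 0 <= m -> (\int[mu]_x (m * S b k x)%:E <= (m * `|k|)%:E)%E.
  move=> m0; under eq_integral do rewrite EFinM.
  rewrite ge0_integralZl//.
  - by rewrite [leRHS]EFinM; apply: lee_wpmul2l; [rewrite lee_fin|exact: integral_sigmoid_diff].
  - by apply/measurable_EFinP; exact: mS.
  - by move=> x _; rewrite lee_fin; exact: normr_ge0.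
have mmS m b k : measurable_fun [set: R] (fun x => (m * S b k x)%:E).
  by apply/measurable_EFinP; apply: measurable_funM; [exact: measurable_cst|exact: mS].
have S0 m b k x : 0 <= m -> (0 <= (m * S b k x)%:E)%E.
  by move=> m0; rewrite lee_fin; apply: mulr_ge0 => //; exact: normr_ge0.
have hsq : (\int[mu]_x `|taylor1 (profile tau) (profile_dx tau) x z|%:E <= (2 / tau * z ^+ 2)%:E)%E.
  have zt0 : 0 <= `|z| / tau by rewrite divr_ge0// ltW.
  apply: (@le_trans _ _ (\int[mu]_x ((`|z| / tau * S (- (c * tau)) z x)%:E +
      (`|z| / tau * S (- (d * tau)) z x)%:E))%E).
    apply: ge0_le_integral => //; first by apply: emeasurable_funD; exact: mmS.
    move=> x _; rewrite -EFinD lee_fin.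
    have -> : taylor1 (profile tau) (profile_dx tau) x z =
      (taylor1 softplus sigmoid (x - c * tau) z - taylor1 softplus sigmoid (x - d * tau) z) / tau.
      rewrite /taylor1 /profile /profile_dx.
      have -> : x + z - c * tau = x - c * tau + z by ring.
      have -> : x + z - d * tau = x - d * tau + z by ring.
      by ring.
    rewrite normrM (gtr0_norm ti0) ![`|z| / tau * _]mulrAC -mulrDl ler_pM2r//.
    apply: le_trans (ler_normB _ _) _; apply: lerD; exact: taylor1_softplus_le.
  rewrite ge0_integralD//; try by [move=> x _; exact: S0|exact: mmS].
  apply: le_trans (leeD (iS _ _ _ zt0) (iS _ _ _ zt0)) _.
  rewrite -EFinD lee_fin -(real_normK (num_real z)) expr2 le_eqVlt.
  by apply/orP; left; apply/eqP; ring.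
have hlin : (\int[mu]_x `|taylor1 (profile tau) (profile_dx tau) x z|%:E <=
   ((2 + (d - c) * (d - c + 2)) * `|z|)%:E)%E.
  have [zt|zt] := leP `|z| tau.
    apply: le_trans hsq _; rewrite lee_fin -(real_normK (num_real z)) expr2.
    have q : 2 / tau * (`|z| * `|z|) <= 2 * `|z|.
      have -> : 2 / tau * (`|z| * `|z|) = 2 * `|z| * (`|z| / tau) by ring.
      by rewrite ler_piMr ?mulr_ge0// ler_pdivrMr// mul1r.
    apply: le_trans q _; rewrite ler_wpM2r// lerDl mulr_ge0 ?(ltW dc0)//; lra.
  have zt0 : 0 <= `|z| / tau by rewrite divr_ge0// ltW.
  apply: (@le_trans _ _ (\int[mu]_x (((d - c) * S (- (d * tau) + Num.min z 0) (ell + `|z|) x)%:E +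
      (`|z| / tau * S (- (d * tau)) ell x)%:E))%E).
    apply: ge0_le_integral => //; first by apply: emeasurable_funD; exact: mmS.
    move=> x _; rewrite -EFinD lee_fin; apply: le_trans (ler_normB _ _) _; apply: lerD; last first.
      rewrite normrM /profile_dx normrM (gtr0_norm ti0) shiftE -/ell /S.
      by rewrite le_eqVlt; apply/orP; left; apply/eqP; ring.
    exact: profile_diff_le.
  rewrite ge0_integralD//; try by [move=> x _; apply: S0; rewrite ?(ltW dc0)|exact: mmS].
  apply: le_trans (leeD (iS _ _ _ (ltW dc0)) (iS _ _ _ zt0)) _.
  rewrite -EFinD lee_fin (ger0_norm (addr_ge0 (ltW ell0) (normr_ge0 z))) (gtr0_norm ell0).
  have -> : `|z| / tau * ell = `|z| * (d - c) by rewrite /ell; field; rewrite gt_eqF.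
  have : (d - c) * ell <= (d - c) * ((d - c) * `|z|) by rewrite ler_pM2l// /ell ler_pM2l// ltW.
  have := normr_ge0 z; lra.
by rewrite /Num.min; case: ifP => _; [exact: hlin|exact: hsq].
Qed.

Variable al : R.
Hypothesis al12 : 1 < al < 2.

Definition profile_levy_cst := kernel_cst al * (2 + (d - c) * (d - c + 2) + 2).

(** Tonelli, and a splitting of the increments at |z| = [tau], where the linear and the quadratic
    bound are comparable. The power [tau^(1 - al)] found here integrates in time to the growth
    [t^(2 - al)]. *)
Lemma integral_levy_profile tau : 1 <= tau ->
  (\int[mu]_x `|levy al (profile tau) (profile_dx tau) x|%:E <=
    (profile_levy_cst * tau `^ (1 - al))%:E)%E.
Proof.
move=> t1; have t0 : 0 < tau by lra.
have cw : continuous (profile tau) := derive_continuous (is_derive_profile tau).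
have cwx : continuous (profile_dx tau) := derive_continuous (is_derive_profile_dx tau).
have nw := profile_nice t1.
pose G (p : measurableTypeR R * measurableTypeR R) : \bar R :=
  (`|taylor1 (profile tau) (profile_dx tau) p.1 p.2| * kernel al p.2)%:E.
have mG : measurable_fun setT G.
  apply/measurable_EFinP; apply: measurable_funM.
    by apply: measurableT_comp; [exact: normr_measurable|exact: measurable_taylor1_2].
  by apply: (measurableT_comp (measurable_kernel al)).
have G0 p : (0 <= G p)%E by rewrite lee_fin mulr_ge0 ?kernel_ge0.
have mg x : measurable_fun [set: R] (fun z => (`|taylor1 (profile tau) (profile_dx tau) x z| * kernel al z)%:E).
  apply/measurable_EFinP; apply: measurable_funM; last exact: measurable_kernel.
  by apply: measurableT_comp; [exact: normr_measurable|exact: measurable_taylor1].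
have mt z : measurable_fun [set: R] (fun x => `|taylor1 (profile tau) (profile_dx tau) x z|%:E).
  by apply/measurable_EFinP; apply: measurableT_comp; [exact: normr_measurable|exact: measurable_taylor1_left].
have mlevy : measurable_fun [set: R] (fun x => `|levy al (profile tau) (profile_dx tau) x|).
  by apply: measurableT_comp; [exact: normr_measurable|exact: (measurable_levy al12 nw)].
apply: (@le_trans _ _ (\int[mu]_x \int[mu]_z G (x, z))%E).
  apply: ge0_le_integral; first exact: measurableT.
  - by move=> x _; rewrite lee_fin; exact: normr_ge0.
  - by apply/measurable_EFinP; exact: mlevy.
  - exact: (@measurable_fun_fubini_tonelli_F _ _ _ _ R mu G mG G0).
  - move=> x _; rewrite /levy EFin_normr_Rintegral//; last exact: integrable_levy nw.
    apply: le_trans (le_abse_integral _ _ _) _ => //.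
      by case/integrableP : (integrable_levy al12 x nw).
    rewrite le_eqVlt; apply/orP; left; apply/eqP; apply: eq_integral => z _.
    by rewrite /= normrM [X in _ * X]ger0_norm ?kernel_ge0.
rewrite (fubini_tonelli _ mG G0).
set a := 2 + (d - c) * (d - c + 2).
have dc0 : 0 < d - c by rewrite subr_gt0.
have a0 : 0 <= a by rewrite addr_ge0// mulr_ge0// ?(ltW dc0)//; lra.
have b0 : 0 <= 2 / tau by rewrite divr_ge0// ltW.
have mm : measurable_fun [set: R] (fun z => Num.min (a * `|z|) (2 / tau * z ^+ 2)).
  by apply: measurable_minr; apply: measurable_funM => //; exact: measurable_funX.
have m0 z : 0 <= Num.min (a * `|z|) (2 / tau * z ^+ 2).
  by rewrite le_min; apply/andP; split; apply: mulr_ge0 => //; exact: sqr_ge0.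
apply: (@le_trans _ _ (\int[mu]_z (Num.min (a * `|z|) (2 / tau * z ^+ 2) * kernel al z)%:E)%E).
  apply: ge0_le_integral; first exact: measurableT.
  - by move=> z _; apply: integral_ge0.
  - exact: (measurable_fun_fubini_tonelli_G _ mG G0).
  - by apply/measurable_EFinP; apply: measurable_funM => //; exact: measurable_kernel.
  - move=> z _; rewrite /G/=.
    under eq_integral do rewrite EFinM.
    rewrite ge0_integralZr;
      [|exact: measurableT|exact: mt|by move=> x _; rewrite lee_fin|by rewrite lee_fin kernel_ge0].
    rewrite [leRHS]EFinM; apply: lee_wpmul2r; first by rewrite lee_fin kernel_ge0.
    exact: integral_taylor1_profile.
have ha z : Num.min (a * `|z|) (2 / tau * z ^+ 2) <= a * `|z| by rewrite ge_min lexx.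
have hb z : Num.min (a * `|z|) (2 / tau * z ^+ 2) <= 2 / tau * z ^+ 2 by rewrite ge_min lexx orbT.
have H := integral_kernel_le al12 t0 a0 b0 mm m0 ha hb.
apply: le_trans H _.
rewrite lee_fin /profile_levy_cst -/a -mulrA ler_wpM2l ?(ltW (kernel_cst_gt0 al12))//.
have -> : 2 / tau * tau `^ (2 - al) = 2 * tau `^ (1 - al).
  have al0 : 0 < 2 - al by case/andP: al12 => ? ?; lra.
  rewrite -(mulr_powRB1 (ltW t0) al0).
  have -> : 2 - al - 1 = 1 - al by ring.
  by field; rewrite gt_eqF.
by rewrite -mulrDl.
Qed.

End Profile.

(** * Growth of the distance to the profile *)

Section SoftAbs.
Context {R : realType}.
Implicit Types (f g h : R -> R) (a b s t x y z l m B K M T : R).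

Lemma softplus_max y : softplus y = Num.max y 0 + softplus (- `|y|).
Proof.
case: (ger0P y) => y0; first by rewrite softplusN; ring.
by rewrite opprK add0r.
Qed.

Lemma softplus_le_expR y : softplus y <= expR y.
Proof. by apply: le_ln1Dx; rewrite (lt_trans _ (expR_gt0 _))// ltrN10. Qed.

Lemma softplus_convex x z : softplus x + sigmoid x * z <= softplus (x + z).
Proof.
have [y [y1 y2 h]] := mean_value x z (@is_derive_softplus R).
rewrite -lerBrDl h; have [z0|z0] := leP 0 z.
  rewrite ler_wpM2r//; have xz : x <= x + z by rewrite lerDl.
  rewrite (min_idPl xz) in y1.
  have -> : y = x + (y - x) by ring.
  by apply: sigmoid_mono; rewrite subr_ge0.
rewrite ler_wnM2r ?(ltW z0)//; have xz : x + z <= x by rewrite gerDl ltW.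
rewrite (max_idPl xz) in y2; have -> : x = y + (x - y) by ring.
by apply: sigmoid_mono; rewrite subr_ge0.
Qed.

(* A smooth convex approximation of [`|y|] at scale [m]; [soft_sgn] is its derivative. *)
Definition soft_abs m y := m * (2 * softplus (m^-1 * y) - m^-1 * y).
Definition soft_sgn m y := 2 * sigmoid (m^-1 * y) - 1.

Variable m : R.
Hypothesis m0 : 0 < m.
Let mn0 : m != 0. Proof. by rewrite gt_eqF. Qed.

Let scale x : is_derive x 1 (fun y => m^-1 * y) m^-1.
Proof.
by refine (derive_eq (derive_mul (derive_cst m^-1 x) (derive_idfun x)) _); ring.
Qed.

Lemma is_derive_soft_abs x : is_derive x 1 (soft_abs m) (soft_sgn m x).
Proof.
refine (derive_eq (derive_mul (derive_cst m x) (derive_sub (derive_mul (derive_cst 2 x)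
  (derive_compose (g := fun y => m^-1 * y) (is_derive_softplus _) (scale x))) (scale x))) _).
by rewrite /soft_sgn; field.
Qed.

Lemma is_derive_soft_sgn x : is_derive x 1 (soft_sgn m) (2 * bump (m^-1 * x) / m).
Proof.
refine (derive_eq (derive_sub (derive_mul (derive_cst 2 x)
  (derive_compose (g := fun y => m^-1 * y) (is_derive_sigmoid _) (scale x))) (derive_cst 1 x)) _).
by ring.
Qed.

(** With [s = y / m], the excess over |y| is exactly [2 m softplus(-|s|)]. *)
Lemma soft_abs_bounds y : `|y| <= soft_abs m y <= `|y| + 2 * m.
Proof.
set s := m^-1 * y; have ys : y = m * s by rewrite /s mulrA divff// mul1r.
have -> : `|y| = m * `|s| by rewrite ys normrM gtr0_norm.
have -> : soft_abs m y = m * (`|s| + 2 * softplus (- `|s|)).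
  congr (m * _); rewrite -/s softplus_max.
  by case: (ger0P s) => s0; ring.
have h1 := softplus_ge0 (- `|s|); have h2 := softplus_le_expR (- `|s|).
have h3 : expR (- `|s|) <= 1 by rewrite -expR0 ler_expR oppr_le0.
rewrite ler_pM2l//; apply/andP; split; first by lra.
by have -> : m * `|s| + 2 * m = m * (`|s| + 2) by [ring|]; rewrite ler_pM2l//; lra.
Qed.

Lemma soft_sgn_le1 y : `|soft_sgn m y| <= 1.
Proof.
have h1 := sigmoid_gt0 (m^-1 * y); have h2 := sigmoid_lt1 (m^-1 * y).
by rewrite /soft_sgn ler_norml; apply/andP; split; lra.
Qed.

(** A defect of homogeneity: for |y| and its sign the difference is 0. It arises when the difference
    of fluxes is put in divergence form. *)
Lemma soft_abs_euler y : `|y * soft_sgn m y - soft_abs m y| <= 2 * m.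
Proof.
set s := m^-1 * y; have ys : y = m * s by rewrite /s mulrA divff// mul1r.
have -> : y * soft_sgn m y - soft_abs m y = - (2 * m * (softplus s - s * sigmoid s)).
  by rewrite /soft_sgn /soft_abs -/s {1}ys; ring.
have k1 : softplus s - s * sigmoid s <= 1.
  have := softplus_convex s (- s); rewrite subrr => h.
  have := softplus_le_expR (0 : R).
  rewrite expR0 => h0; apply: le_trans h0; apply: le_trans h; rewrite le_eqVlt.
  by apply/orP; left; apply/eqP; ring.
have k0 : 0 <= softplus s - s * sigmoid s.
  have g := ltW (sigmoid_gt0 s); have [s0|s0] := leP s 0.
    by rewrite subr_ge0; apply: le_trans (softplus_ge0 s); rewrite mulr_le0_ge0.
  have := softplus_ge0 (- s); have := ltW (sigmoid_lt1 s); rewrite softplusN => h1 h2.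
  by have : s * sigmoid s <= s * 1; [rewrite ler_wpM2l// ltW|lra].
rewrite normrN normrM (gtr0_norm (mulr_gt0 _ m0))// ger0_norm//.
by rewrite ler_piMr// mulr_ge0// ltW.
Qed.

Lemma soft_abs_convex y z : 0 <= soft_abs m z - soft_abs m y - soft_sgn m y * (z - y).
Proof.
have := softplus_convex (m^-1 * y) (m^-1 * (z - y)).
have -> : m^-1 * y + m^-1 * (z - y) = m^-1 * z by ring.
set p := softplus (m^-1 * z); set q := softplus (m^-1 * y).
have -> : soft_abs m z - soft_abs m y - soft_sgn m y * (z - y) =
   2 * m * (p - (q + sigmoid (m^-1 * y) * (m^-1 * (z - y)))).
  by rewrite /soft_abs /soft_sgn -/p -/q; field.
by move=> h; rewrite mulr_ge0 ?subr_ge0// mulr_ge0// ltW.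
Qed.

Lemma soft_abs_gap y z : `|soft_abs m z - soft_abs m y - soft_sgn m y * (z - y)| <= m^-1 * (z - y) ^+ 2.
Proof.
have hC x : `|x - y| <= `|z - y| -> `|2 * bump (m^-1 * x) / m| <= m^-1.
  move=> _; rewrite normrM [X in _ * X]gtr0_norm ?invr_gt0// ler_piMl ?invr_ge0 ?(ltW m0)//.
  by have := bump_gt0 (m^-1 * x); have := bump_le (m^-1 * x) => h1 h2; rewrite gtr0_norm; lra.
have := taylor1_le2 is_derive_soft_abs is_derive_soft_sgn hC.
by rewrite /taylor1; have -> : y + (z - y) = z by ring.
Qed.

(** The bound grows like [m^-1], but this is harmless: in [levy_bump] it serves integrability, while
    the estimate there uses the sup alone. *)
Lemma nice_soft_abs f f' M : nice f f' M ->
  nice (fun x => soft_abs m (f x)) (fun x => soft_sgn m (f x) * f' x) (M + 2 * m + m^-1 * M ^+ 2).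
Proof.
move=> nf; have [Df cf' fM f'M fT] := nf; have cf := nice_continuous nf.
have M0 := nice_ge0 nf; have mi0 : 0 < m^-1 by rewrite invr_gt0.
have mM0 : 0 <= m^-1 * M ^+ 2 by rewrite mulr_ge0 ?sqr_ge0// ltW.
have csg : continuous (soft_sgn m) := derive_continuous is_derive_soft_sgn.
split.
- by move=> x; exact: (derive_compose (g := f) (is_derive_soft_abs _) (Df x)).
- move=> x; apply: cvgM; last exact: cf'.
  by apply: (@continuous_comp _ _ _ f (soft_sgn m)); [exact: cf|exact: csg].
- move=> x; have /andP[h1 h2] := soft_abs_bounds (f x).
  rewrite ger0_norm; last exact: le_trans h1.
  by have := fM x; lra.
- move=> x; apply: (@le_trans _ _ M); first last.
    by rewrite -addrA lerDl addr_ge0// mulr_ge0// ltW.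
  rewrite normrM; apply: (@le_trans _ _ (1 * `|f' x|)); last by rewrite mul1r.
  by rewrite ler_wpM2r// soft_sgn_le1.
- move=> x z.
  have -> : taylor1 (fun y => soft_abs m (f y)) (fun y => soft_sgn m (f y) * f' y) x z =
    soft_sgn m (f x) * taylor1 f f' x z +
     (soft_abs m (f (x + z)) - soft_abs m (f x) - soft_sgn m (f x) * (f (x + z) - f x)).
    by rewrite /taylor1; ring.
  apply: le_trans (ler_normD _ _) _.
  have h1 : `|soft_sgn m (f x) * taylor1 f f' x z| <= M * z ^+ 2.
    rewrite normrM -[leRHS]mul1r; apply: ler_pM => //; exact: soft_sgn_le1.
  have h2 : (f (x + z) - f x) ^+ 2 <= M ^+ 2 * z ^+ 2.
    rewrite -[z ^+ 2](real_normK (num_real z)) -exprMn.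
    rewrite -[leLHS](real_normK (num_real _)) lerXn2r ?nnegrE ?mulr_ge0//.
    exact: nice_dist nf.
  have h4 : m^-1 * (f (x + z) - f x) ^+ 2 <= m^-1 * (M ^+ 2 * z ^+ 2) by rewrite ler_pM2l.
  have h5 : 0 <= m * z ^+ 2 by rewrite mulr_ge0 ?sqr_ge0// ltW.
  apply: le_trans (lerD h1 (le_trans (soft_abs_gap _ _) h4)) _.
  have -> : (M + 2 * m + m^-1 * M ^+ 2) * z ^+ 2 =
    M * z ^+ 2 + m^-1 * (M ^+ 2 * z ^+ 2) + 2 * (m * z ^+ 2) by ring.
  by rewrite lerDl mulr_ge0.
Qed.

(** Kato's inequality: the graph of the convex [soft_abs] lies above its tangents, which is applied
    to each increment and integrated against the kernel. *)
Lemma soft_sgn_levy_le al f f' M x : 1 < al < 2 -> nice f f' M ->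
  soft_sgn m (f x) * levy al f f' x <=
    levy al (fun y => soft_abs m (f y)) (fun y => soft_sgn m (f y) * f' y) x.
Proof.
move=> al12 nf; have i1 := integrable_levy al12 x nf.
have i2 := integrable_levy al12 x (nice_soft_abs nf).
rewrite /levy -(RintegralZl _ measurableT i1).
apply: le_Rintegral => //; first exact: integrableRZ.
move=> z _; rewrite mulrA ler_wpM2r ?kernel_ge0// -subr_ge0.
have := soft_abs_convex (f x) (f (x + z)).
by congr (0 <= _); rewrite /taylor1; ring.
Qed.

End SoftAbs.

(** * Differential inequality for the weighted distance *)

Section L1Growth.
Context {R : realType}.
Notation mu := (@lebesgue_measure R).
Notation itg f := (mu.-integrable [set: R] (EFin \o f)).
Implicit Types (f g h : R -> R) (a b s t x y z l m B K M T : R).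

Lemma integral_weight_le h g K l b : 0 < l -> measurable_fun [set: R] h ->
  measurable_fun [set: R] g -> (forall x, `|h x| <= 1) -> (\int[mu]_x `|g x|%:E <= K%:E)%E ->
  itg (fun x => h x * g x * bump (l * x + b)) /\
  `|\int[mu]_x (h x * g x * bump (l * x + b))| <= K / 4.
Proof.
move=> l0 mh mg h1 gK.
have mb : measurable_fun [set: R] (fun x => bump (l * x + b)).
  by apply: measurable_continuous; exact: continuous_bump_affine.
have mf : measurable_fun [set: R] (fun x => h x * g x * bump (l * x + b)).
  by apply: measurable_funM => //; exact: measurable_funM.
have ma : measurable_fun [set: R] (fun x => `|g x|%:E).
  by apply/measurable_EFinP; exact: measurableT_comp.
have B : (\int[mu]_x `|h x * g x * bump (l * x + b)|%:E <= (K / 4)%:E)%E.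
  apply: (@le_trans _ _ (\int[mu]_x (4^-1%:E * `|g x|%:E))%E).
    apply: ge0_le_integral => //.
    - by apply/measurable_EFinP; exact: measurableT_comp.
    - by apply: emeasurable_funM.
    - move=> x _; rewrite -EFinM lee_fin normrM (gtr0_norm (bump_gt0 _)) normrM [leRHS]mulrC.
      apply: ler_pM => //; [exact: ltW (bump_gt0 _)| |exact: bump_le].
      by rewrite ler_piMl.
  rewrite ge0_integralZl//.
  by rewrite [(K / 4)%:E]EFinM muleC; apply: lee_wpmul2r => //; rewrite lee_fin.
have jf : itg (fun x => h x * g x * bump (l * x + b)).
  apply/integrableP; split; first exact/measurable_EFinP.
  by apply: le_lt_trans B _; exact: ltry.
by split => //; exact: norm_Rintegral_le.
Qed.

Variables (al c d : R) (u ut ux : R -> R -> R) (T M : R).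
Hypothesis al12 : 1 < al < 2.
Hypothesis cd : c < d.
Hypothesis Su : smooth_solution al u ut ux.
Hypothesis uM : forall s x, 0 < s < T -> `|u s x| <= M.

Let w s x := profile c d (1 + s) x.
Let wx s x := profile_dx c d (1 + s) x.
Let wt s x := profile_dt c d (1 + s) x.
Let pb := profile_bound c d.
Let fc := frac_const al.
Let v s x := u s x - w s x.

Let pb0 : 0 <= pb.
Proof. by rewrite /pb /profile_bound addr_ge0// mulr_ge0// addr_ge0. Qed.

Lemma profile_abs_le s x : 0 < s -> `|w s x| <= pb.
Proof.
move=> s0; have s1 : 1 <= 1 + s by lra.
have [_ _ h _ _] := profile_nice cd s1; exact: h. Qed.

Definition soft_mass m l s : R := \int[mu]_x (soft_abs m (v s x) * bump (l * x + 0)).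

(** The L1 bounds on the two residuals of the profile, inviscid and fractional, times the sup of the
    weight. *)
Definition growth_rate s : R :=
  4^-1 * (16 / (1 + s) ^+ 2 + fc * (profile_levy_cst c d al * (1 + s) `^ (1 - al))).

(** Errors due to the weight and the smoothing: for bounded [m] the first vanishes with [l], and the
    second vanishes with [m] at fixed [l]. *)
Definition growth_error m l K : R :=
  fc * (8 * kernel_cst al * (M + pb + 2 * m) * l `^ (al - 1)) + 2 * m * (K + pb) / l.

(** The difference of the fluxes is [(u + w) / 2] times [v]. Multiplied by the smoothed sign, its
    derivative is that of [(u + w) / 2] times [soft_abs m v], up to the homogeneity defect times
    [(u + w)_x / 2]. This defect alone brings the gradient bound [K] into the estimate, with a
    factor [m]. *)
Lemma soft_mass_derivative m l s K : 0 < m -> 0 < l -> 0 < s < T -> (forall x, `|ux s x| <= K) ->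
  exists2 Y', is_derive s 1 (soft_mass m l) Y' &
    Y' <= (M + pb) * l * soft_mass m l s + growth_error m l K + growth_rate s.
Proof.
move=> m0 l0 sT uxK; have /andP[s0 _] := sT; have fc0 : 0 < fc := frac_const_gt0 al12.
have s1 : 1 <= 1 + s by lra.
have [M1 [nu Dut utM cut]] := solution_at Su s0.
have nw := profile_nice cd s1; have nv : nice (v s) (fun x => ux s x - wx s x) (M1 + pb) := niceB nu nw.
have nphi := nice_soft_abs m0 nv.
have [Du cux uM1 uxM _] := nu; have [Dw cwx wM wxM _] := nw.
have [Dv cvx vM1 vxM _] := nv; have [Dp cpx pM1 pxM _] := nphi.
have cu := nice_continuous nu; have cw := nice_continuous nw.
have cv := nice_continuous nv; have cp := nice_continuous nphi.
have uMs x : `|u s x| <= M := uM x sT.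
have M0 : 0 <= M := le_trans (normr_ge0 _) (uMs 0).
have K0 : 0 <= K := le_trans (normr_ge0 _) (uxK 0).
have csg : continuous (fun x => soft_sgn m (v s x)).
  move=> x; apply: (@continuous_comp _ _ _ (v s) (soft_sgn m)); first exact: cv.
  exact: (derive_continuous (@is_derive_soft_sgn _ m)).
have cwt : continuous (wt s) by exact: continuous_profile_dt.
exists (\int[mu]_x (soft_sgn m (v s x) * (ut s x - wt s x) * bump (l * x + 0))).
  case: (Su) => _ S _ _; have [|M2 HM] := S (s / 2) (s + 1); first by apply/andP; split; lra.
  apply: (@is_derive_integral_bump _ (fun s x => soft_abs m (v s x))
     (fun s x => soft_sgn m (v s x) * (ut s x - wt s x)) (s / 2) (s + 1) (M2 + pb + 2 * m)).
  - exact: l0.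
  - by apply/andP; split; lra.
  - move=> r x rs; have [_ Dr _ _] := HM r rs; have r0 : 0 <= r by case/andP: rs; lra.
    exact: (derive_compose (g := fun q => v q x) (is_derive_soft_abs m0 _)
      (derive_sub (Dr x) (is_derive_profile_time c d x r0))).
  - move=> r x rs; have [[_ _ ur _ _] _ _ _] := HM r rs; have r0 : 0 < r by case/andP: rs; lra.
    have /andP[h1 h2] := soft_abs_bounds m0 (v r x).
    rewrite ger0_norm; last exact: le_trans h1.
    apply: le_trans h2 _; rewrite lerD2r; apply: le_trans (ler_normB _ _) _.
    by apply: lerD; [exact: ur|exact: profile_abs_le].
  - move=> r x rs; have [_ _ utr _] := HM r rs; have r1 : 1 <= 1 + r by case/andP: rs; lra.
    have h : `|ut r x - wt r x| <= M2 + pb.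
      by apply: le_trans (ler_normB _ _) _; apply: lerD; [exact: utr|exact: profile_dt_bound].
    rewrite normrM; apply: (@le_trans _ _ (1 * (M2 + pb))).
      by apply: ler_pM => //; exact: soft_sgn_le1.
    by rewrite mul1r lerDl mulr_ge0// ltW.
  - move=> r rs; have r0 : 0 < r by case/andP: rs; lra.
    have r1 : 1 <= 1 + r by lra.
    apply: measurable_continuous => x; apply: (@continuous_comp _ _ _ (v r) (soft_abs m)).
      by apply: cvgB; [exact: (solution_continuous Su r0)|exact: (nice_continuous (profile_nice cd r1))].
    exact: (derive_continuous (is_derive_soft_abs m0)).
have phiM x : `|soft_abs m (v s x)| <= M + pb + 2 * m.
  have /andP[h1 h2] := soft_abs_bounds m0 (v s x).
  rewrite ger0_norm; last exact: le_trans h1.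
  apply: le_trans h2 _; rewrite lerD2r; apply: le_trans (ler_normB _ _) _.
  by apply: lerD; [exact: uMs|exact: wM].
have sgn1 x : `|soft_sgn m (v s x)| <= 1 by exact: soft_sgn_le1.
have msg : measurable_fun [set: R] (fun x => soft_sgn m (v s x)) := measurable_continuous csg.
set Phi := fun x => soft_abs m (v s x) in phiM *.
set Phix := fun x => soft_sgn m (v s x) * (ux s x - wx s x) in Dp cpx pxM.
have [i1 b1] := levy_bump al12 0 nphi phiM l0.
have mwl : measurable_fun [set: R] (levy al (w s) (wx s)) := measurable_levy al12 nw.
have [i2 b2] := integral_weight_le 0 l0 msg mwl sgn1 (integral_levy_profile cd al12 s1).
pose E0 x := wt s x + w s x * wx s x.
have mE0 : measurable_fun [set: R] E0.
  apply: measurable_continuous => x; apply: cvgD; first exact: cwt.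
  by apply: cvgM; [exact: cw|exact: cwx].
have [i3 b3] := integral_weight_le 0 l0 msg mE0 sgn1 (profile_error_integral cd s1).
pose F x := 2^-1 * (u s x + w s x) * Phi x.
pose F' x := 2^-1 * (ux s x + wx s x) * Phi x + 2^-1 * (u s x + w s x) * Phix x.
have DF x : is_derive x 1 F (F' x).
  have Dw' : is_derive x 1 (w s) (wx s x) := Dw x.
  have Dp' : is_derive x 1 Phi (Phix x) := Dp x.
  refine (derive_eq (derive_mul (derive_mul (derive_cst 2^-1 x) (derive_add (Du x) Dw')) Dp') _).
  by rewrite /F'; ring.
have cF' : continuous F'.
  move=> x; apply: cvgD; apply: cvgM; [|exact: cp| |exact: cpx].
    by apply: cvgM; [exact: cvg_cst|apply: cvgD; [exact: cux|exact: cwx]].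
  by apply: cvgM; [exact: cvg_cst|apply: cvgD; [exact: cu|exact: cw]].
have bM x : `|2^-1 * (u s x + w s x)| <= M + pb.
  rewrite normrM gtr0_norm//; have h : `|u s x + w s x| <= M + pb.
    by apply: le_trans (ler_normD _ _) _; apply: lerD; [exact: uMs|exact: wM].
  by have := normr_ge0 (u s x + w s x); move: h; lra.
have bxM x : `|2^-1 * (ux s x + wx s x)| <= K + pb.
  rewrite normrM gtr0_norm//; have h : `|ux s x + wx s x| <= K + pb.
    by apply: le_trans (ler_normD _ _) _; apply: lerD; [exact: uxK|exact: wxM].
  by have := normr_ge0 (ux s x + wx s x); move: h; lra.
have FM x : `|F x| <= (M + pb) * (M + pb + 2 * m) 
  by rewrite /F normrM; apply: ler_pM; [exact: normr_ge0|exact: normr_ge0|exact: bM|exact: phiM].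
have F'M x : `|F' x| <= (K + pb) * (M + pb + 2 * m) + (M + pb) * (M1 + pb + 2 * m + m^-1 * (M1 + pb) ^+ 2).
  apply: le_trans (ler_normD _ _) _; apply: lerD; rewrite normrM; apply: ler_pM;
    [exact: normr_ge0|exact: normr_ge0|exact: bxM|exact: phiM|
     exact: normr_ge0|exact: normr_ge0|exact: bM|exact: pxM].
have i4 := integrable_mul_bump 0 l0 (measurable_continuous cF') F'M.
have iP := integrable_mul_bump 0 l0 (measurable_continuous cp) phiM.
have ibp := integration_by_parts_bump 0 l0 DF cF' FM F'M.
have cF : continuous F := derive_continuous DF.
have i5 := integrable_mul_bump1 0 l0 (measurable_continuous cF) FM.
have b4 : `|\int[mu]_x (F' x * bump (l * x + 0))| <= (M + pb) * l * soft_mass m l s.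
  rewrite ibp normrN; apply: le_trans (le_normr_Rintegral measurableT i5) _.
  rewrite /soft_mass -(RintegralZl _ measurableT iP).
  apply: le_Rintegral; [exact: measurableT|exact: (integrable_norm i5)|exact: integrableRZ|].
  move=> x _; rewrite normrM; apply: (@le_trans _ _ ((M + pb) * Phi x * (l * bump (l * x + 0)))).
    apply: ler_pM; [exact: normr_ge0|exact: normr_ge0| |exact: bump1_affine_bound].
    rewrite /F normrM; apply: ler_pM; [exact: normr_ge0|exact: normr_ge0|exact: bM|].
    have /andP[h1 _] := soft_abs_bounds m0 (v s x).
    by rewrite ger0_norm; [exact: lexx|exact: le_trans (normr_ge0 _) h1].
  by rewrite -/(Phi x) le_eqVlt; apply/orP; left; apply/eqP; ring.
have i6 := integrable_bump 0 l0.
have vtM x : `|soft_sgn m (v s x) * (ut s x - wt s x)| <= 1 * (M1 + pb).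
  rewrite normrM; apply: ler_pM; [exact: normr_ge0|exact: normr_ge0|exact: sgn1|].
  apply: le_trans (ler_normB _ _) _; apply: lerD; [exact: utM|exact: profile_dt_bound].
have mvt : measurable_fun [set: R] (fun x => soft_sgn m (v s x) * (ut s x - wt s x)).
  by apply: measurable_continuous => x; apply: cvgM; [exact: csg|apply: cvgB; [exact: cut|exact: cwt]].
have i7 := integrable_mul_bump 0 l0 mvt vtM.
set k := 2 * m * (K + pb).
set I1 := \int[mu]_x (levy al _ _ x * _) in b1.
set I2 := \int[mu]_x (_ * levy al _ _ x * _) in b2.
set I3 := \int[mu]_x (_ * E0 x * _) in b3.
set I4 := \int[mu]_x (F' x * _) in b4.
have le1 : \int[mu]_x (soft_sgn m (v s x) * (ut s x - wt s x) * bump (l * x + 0)) <=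
   fc * I1 + fc * I2 - I3 - I4 + k * \int[mu]_x bump (l * x + 0).
  rewrite /I1 /I2 /I3 /I4 -(RintegralZl _ measurableT i1) -(RintegralZl _ measurableT i2).
  rewrite -(RintegralZl _ measurableT i6).
  have j12 := integrableRD (integrableRZ fc i1) (integrableRZ fc i2).
  have j123 := integrableRB j12 i3; have j1234 := integrableRB j123 i4.
  rewrite -(RintegralD measurableT (integrableRZ fc i1) (integrableRZ fc i2)).
  rewrite -(RintegralB measurableT j12 i3) -(RintegralB measurableT j123 i4).
  rewrite -(RintegralD measurableT j1234 (integrableRZ k i6)).
  apply: le_Rintegral; [exact: measurableT|exact: i7|exact: (integrableRD j1234 (integrableRZ k i6))|].
  move=> x _.
  have hL : soft_sgn m (v s x) * (fc^-1 * (ut s x + u s x * ux s x) - levy al (w s) (wx s) x) <=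
      levy al Phi Phix x.
    rewrite -(solution_levy al12 Su x s0) -(levyB al12 x nu nw).
    exact: (soft_sgn_levy_le m0 x al12 nv).
  set L := levy al Phi Phix x in hL.
  have euler := soft_abs_euler m0 (v s x).
  have hk : `|2^-1 * (ux s x + wx s x) * (v s x * soft_sgn m (v s x) - soft_abs m (v s x))| <= k.
    rewrite normrM /k mulrC; apply: ler_pM; [exact: normr_ge0|exact: normr_ge0|exact: euler|exact: bxM].
  (* An exact splitting into the Kato term, the fractional residual, the inviscid residual, a
     divergence and the homogeneity defect. *)
  have e1 : soft_sgn m (v s x) * (ut s x - wt s x) =
    fc * (soft_sgn m (v s x) * (fc^-1 * (ut s x + u s x * ux s x) - levy al (w s) (wx s) x))
    + fc * (soft_sgn m (v s x) * levy al (w s) (wx s) x) - soft_sgn m (v s x) * E0 x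
    - F' x - 2^-1 * (ux s x + wx s x) * (v s x * soft_sgn m (v s x) - soft_abs m (v s x)).
    by rewrite /F' /E0 /Phi /Phix /v; field; rewrite gt_eqF.
  have hL2 := hL; rewrite -(ler_pM2l fc0) in hL2.
  have hk2 := hk; rewrite ler_norml in hk2; case/andP: hk2 => hk2 _.
  have e2 : fc * (L * bump (l * x + 0)) + fc * (soft_sgn m (v s x) * levy al (w s) (wx s) x * bump (l * x + 0))
    - soft_sgn m (v s x) * E0 x * bump (l * x + 0) - F' x * bump (l * x + 0) + k * bump (l * x + 0) =
    (fc * L + fc * (soft_sgn m (v s x) * levy al (w s) (wx s) x) - soft_sgn m (v s x) * E0 x - F' x + k)
      * bump (l * x + 0) by ring.
  apply: (@le_trans _ _ ((fc * L + fc * (soft_sgn m (v s x) * levy al (w s) (wx s) x) - soft_sgn m (v s x) * E0 x - F' x + k)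
      * bump (l * x + 0))); last by rewrite -e2; exact: lexx.
  apply: ler_wpM2r; first exact: ltW (bump_gt0 _).
  by rewrite e1; clear -hL2 hk2 Su uM cd al12 pb0; lra.
apply: le_trans le1 _.
have -> : \int[mu]_x bump (l * x + 0) = l^-1 by rewrite /Rintegral integral_bump.
move: b1 b2 b3 b4; rewrite !ler_norml => /andP[_ b1] /andP[_ b2] /andP[b3 _] /andP[b4 _].
have := b1; rewrite -(ler_pM2l fc0) => {}b1; have := b2; rewrite -(ler_pM2l fc0) => {}b2.
rewrite /growth_error -/k /growth_rate; move: b1 b2 b3 b4.
set p := _ `^ (al - 1); set q := _ `^ (1 - al); set r := 16 / _.
by clear -Su uM cd al12 pb0; lra.
Qed.

End L1Growth.

(** * Gronwall argument and removal of the weight *)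

Section L1Bound.
Context {R : realType}.
Notation mu := (@lebesgue_measure R).
Notation itg f := (mu.-integrable [set: R] (EFin \o f)).
Implicit Types (f g h : R -> R) (a b s t x y z l m B K M T : R).

(** Fatou's lemma as the weights flatten: they converge pointwise to [bump 0 = 4^-1], which accounts
    for the factor 4. *)
Lemma ge0_integral_le_bump f (l r : nat -> R) (X : R) : measurable_fun [set: R] f ->
  (forall x, 0 <= f x) -> l n @[n --> \oo] --> (0 : R) -> r n @[n --> \oo] --> X / 4 ->
  (forall n, (\int[mu]_x (f x * bump (l n * x + 0))%:E <= (r n)%:E)%E) ->
  (\int[mu]_x (f x)%:E <= X%:E)%E.
Proof.
move=> mf f0 l0 rX fr.
pose F n x := (f x * bump (l n * x + 0))%:E.
have mF n : measurable_fun [set: R] (F n).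
  apply/measurable_EFinP; apply: measurable_funM => //.
  by apply: measurable_continuous; exact: continuous_bump_affine.
have F0 n x : [set: R] x -> (0 <= F n x)%E.
  by move=> _; rewrite lee_fin mulr_ge0// ltW// bump_gt0.
have lF x : F n x @[n --> \oo] --> (f x / 4)%:E.
  apply: cvg_EFin; first exact: nearW.
  apply: cvgM; first exact: cvg_cst.
  have b0 : bump 0 = 4^-1 :> R by rewrite bumpE oppr0 expR0; congr (_^-1); ring.
  rewrite -b0; apply: (@cvg_comp _ _ _ (fun n => l n * x + 0) bump _ (nbhs (0 : R))); last exact: continuous_bump.
  have -> : nbhs (0 : R) = nbhs (0 * x + 0) by rewrite mul0r addr0.
  by apply: cvgD; [apply: cvgM => //; exact: cvg_cst|exact: cvg_cst].
have h := fatou mu measurableT mF F0.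
have e1 : (\int[mu]_x limn_einf (F^~ x) = \int[mu]_x (f x / 4)%:E)%E.
  by apply: eq_integral => x _; have [-> _] := cvg_limn_einf_sup (lF x).
have h2 : (limn_einf (fun n => \int[mu]_x F n x) <= (X / 4)%:E)%E.
  rewrite limn_einf_lim.
  have rc : (r n)%:E @[n --> \oo] --> (X / 4)%:E by apply: cvg_EFin => //; exact: nearW.
  rewrite -(cvg_lim _ rc)//; apply: lee_lim; [exact: is_cvg_einfs|exact: cvgP rc|].
  apply: nearW => n; apply: le_trans (fr n); rewrite /einfs/=; apply: ereal_inf_lbound.
  by exists n => /=.
rewrite e1 in h; have := le_trans h h2.
have -> : (\int[mu]_x (f x / 4)%:E = 4^-1%:E * \int[mu]_x (f x)%:E)%E.
  under eq_integral do rewrite mulrC EFinM.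
  rewrite ge0_integralZl//; first exact/measurable_EFinP.
  by move=> x _; rewrite lee_fin.
have -> : (X / 4)%:E = (4^-1%:E * X%:E)%E by rewrite -EFinM mulrC.
by rewrite lee_pmul2l// ?lte_fin// fin_num_fun.
Qed.

Variables (al c d : R) (u ut ux : R -> R -> R) (u0 : R -> R) (T M : R).
Hypothesis al12 : 1 < al < 2.
Hypothesis cd : c < d.
Hypothesis Su : smooth_solution al u ut ux.
Hypothesis uM : forall s x, 0 < s < T -> `|u s x| <= M.
Hypothesis iuw : itg (fun x => u0 x - profile c d 1 x).
Hypothesis weak : forall m b, 0 < m ->
  (fun s => \int[mu]_x (u s x * bump (m * x + b))) s @[s --> 0^'+] -->
     \int[mu]_x (u0 x * bump (m * x + b)).

Let pb := profile_bound c d.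
Let fc := frac_const al.
Let Y m l s := soft_mass c d u m l s.
Let V l s := \int[mu]_x (`|u s x - profile c d (1 + s) x| * bump (l * x + 0)).

Let pb0 : 0 <= pb.
Proof. by rewrite /pb /profile_bound addr_ge0// mulr_ge0// addr_ge0. Qed.

(** An upper bound for the integral of [growth_rate] from 0 to [t], obtained from its primitive by
    dropping negative terms. *)
Definition growth_total al c d t : R :=
  4^-1 * (16 + frac_const al * (profile_levy_cst c d al * ((1 + t) `^ (2 - al) / (2 - al)))).

Let Hs s : R := 4^-1 * (- 16 / (1 + s) + fc * (profile_levy_cst c d al * ((1 + s) `^ (2 - al) / (2 - al)))).

Let plc0 : 0 <= profile_levy_cst c d al.
Proof.
have dc0 : 0 < d - c by rewrite subr_gt0.
rewrite /profile_levy_cst; apply: mulr_ge0; first exact: ltW (kernel_cst_gt0 al12).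
by rewrite addr_ge0// addr_ge0// mulr_ge0// ltW//; lra.
Qed.

Let DHs s : 0 < s -> is_derive s 1 Hs (growth_rate al c d s).
Proof.
move=> s0; have t0 : 0 < 1 + s by lra.
have tn0 : 1 + s != 0 by rewrite gt_eqF.
have Dl : is_derive s 1 (fun s => 1 + s) 1.
  by refine (derive_eq (derive_add (derive_cst 1 s) (derive_idfun s)) _); rewrite add0r.
have Dp := derive_compose (g := fun s => 1 + s) (is_derive1_powR (2 - al) t0) Dl.
refine (derive_eq (derive_mul (derive_cst 4^-1 s) (derive_add
  (derive_mul (derive_cst (- 16) s) (derive_inv (f := fun s => 1 + s) tn0 Dl))
  (derive_mul (derive_cst fc s) (derive_mul (derive_cst (profile_levy_cst c d al) s)
   (derive_mul Dp (derive_cst (2 - al)^-1 s)))))) _).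
have -> : 2 - al - 1 = 1 - al by ring.
rewrite /growth_rate -/fc; set p := (1 + s) `^ (1 - al); set q := (1 + s) `^ (2 - al).
have al2 : 2 - al != 0 by case/andP: al12 => _ ?; apply/eqP => ?; lra.
by field; apply/andP; split.
Qed.

Lemma soft_mass_growth m l t0 t K : 0 < m -> 0 < l -> 0 < t0 < t -> t < T -> 0 <= K ->
  (forall s x, t0 <= s <= t -> `|ux s x| <= K) ->
  soft_mass c d u m l t <= expR ((M + pb) * l * t) * (soft_mass c d u m l t0 +
     growth_error al c d M m l K * t + growth_total al c d t).
Proof.
move=> m0 l0 /andP[t00 t0t] tT K0 uxK; set k := (M + pb) * l; set A := growth_error _ _ _ _ _ _ _.
have t_0 : 0 < t by lra.
have M0 : 0 <= M.
  have t00T : 0 < t0 < T by apply/andP; split; lra.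
  exact: le_trans (normr_ge0 _) (uM 0 t00T).
have k0 : 0 <= k by apply: mulr_ge0; [exact: addr_ge0|exact: ltW].
have fc0 : 0 < fc := frac_const_gt0 al12.
have A0 : 0 <= A.
  have kc := ltW (kernel_cst_gt0 al12).
  rewrite /A /growth_error addr_ge0//.
    apply: mulr_ge0; first exact: ltW.
    apply: mulr_ge0; last exact: powR_ge0.
    apply: mulr_ge0; first exact: mulr_ge0.
    by apply: addr_ge0; [exact: addr_ge0|apply: mulr_ge0 => //; exact: ltW].
  apply: divr_ge0; last exact: ltW.
  by apply: mulr_ge0; [apply: mulr_ge0 => //; exact: ltW|exact: addr_ge0].
have rate0 s : 0 < s -> 0 <= growth_rate al c d s.
  move=> s0; rewrite /growth_rate mulr_ge0// addr_ge0//.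
    by rewrite divr_ge0// sqr_ge0.
  by rewrite mulr_ge0 ?(ltW fc0)// mulr_ge0// powR_ge0.
pose Z s := expR (- (k * s)) * Y m l s - A * s - Hs s.
have Zle : Z t <= Z t0.
  apply: derive_nonincreasing; first exact: ltW.
  move=> s /andP[s1 s2]; have s0 : 0 < s by exact: lt_le_trans t00 s1.
  have sT : 0 < s < T by rewrite s0 (le_lt_trans s2).
  have uxs x : `|ux s x| <= K by apply: uxK; apply/andP; split.
  have [Y' DY Y'le] := soft_mass_derivative al12 cd Su uM m0 l0 sT uxs.
  have DY' : is_derive s 1 (Y m l) Y' := DY.
  have De : is_derive s 1 (fun s => expR (- (k * s))) (expR (- (k * s)) * - k).
    have Dk : is_derive s 1 (fun s => - (k * s)) (- k).
      refine (derive_eq (derive_opp (derive_mul (derive_cst k s) (derive_idfun s))) _); ring.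
    exact: (derive_compose (g := fun s => - (k * s)) (is_derive_expR _) Dk).
  exists (expR (- (k * s)) * Y' + Y m l s * (expR (- (k * s)) * - k) - A - growth_rate al c d s).
    refine (derive_eq (derive_sub (derive_sub (derive_mul De DY')
      (derive_mul (derive_cst A s) (derive_idfun s))) (DHs s0)) _).
    by ring.
  rewrite -/pb -/k -/A -/(Y m l s) in Y'le.
  set e := expR _; have e0 : 0 < e by exact: expR_gt0.
  have e1 : e <= 1 by rewrite /e -expR0 ler_expR oppr_le0 mulr_ge0// ltW.
  have h1 : e * Y' <= e * (k * Y m l s + A + growth_rate al c d s) by rewrite ler_pM2l.
  have AG : 0 <= A + growth_rate al c d s by apply: addr_ge0 => //; exact: rate0.
  have h2 : e * (A + growth_rate al c d s) <= A + growth_rate al c d s by rewrite ler_piMl.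
  have h3 : e * (k * Y m l s + A + growth_rate al c d s) =
     e * (A + growth_rate al c d s) + Y m l s * (e * k) by ring.
  by rewrite mulrN; lra.
have Yt0 : 0 <= Y m l t0.
  apply: Rintegral_ge0 => x _; apply: mulr_ge0; last exact: ltW (bump_gt0 _).
  by have /andP[h _] := soft_abs_bounds m0 (u t0 x - profile c d (1 + t0) x); exact: le_trans h.
have et0 : expR (- (k * t0)) * Y m l t0 <= Y m l t0.
  by rewrite ler_piMl// -expR0 ler_expR oppr_le0 mulr_ge0// ltW.
have HG : Hs t - Hs t0 <= growth_total al c d t.
  have p0 : 0 <= fc * (profile_levy_cst c d al * ((1 + t0) `^ (2 - al) / (2 - al))).
    rewrite mulr_ge0 ?(ltW fc0)// mulr_ge0// divr_ge0 ?powR_ge0//.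
    by case/andP: al12 => _ ?; lra.
  have q0 : 0 <= 16 / (1 + t) :> R by rewrite divr_ge0//; lra.
  have q1 : 16 / (1 + t0) <= 16 :> R by rewrite ler_pdivrMr; lra.
  by rewrite /Hs /growth_total -/fc !mulNr; lra.
have At0 : 0 <= A * t0 by rewrite mulr_ge0// ltW.
have fin : expR (- (k * t)) * Y m l t <= Y m l t0 + A * t + growth_total al c d t.
  by move: Zle; rewrite /Z; lra.
rewrite -/(Y m l t) -/(Y m l t0).
have -> : Y m l t = expR (k * t) * (expR (- (k * t)) * Y m l t).
  by rewrite mulrA -expRD subrr expR0 mul1r.
by rewrite ler_pM2l ?expR_gt0.
Qed.

Let mv s : 0 < s -> measurable_fun [set: R] (fun x => u s x - profile c d (1 + s) x).
Proof.
move=> s0; apply: measurable_funB; first exact: (solution_measurable Su s0).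
by apply: measurable_continuous; exact: (derive_continuous (is_derive_profile c d (1 + s))).
Qed.

Let vM s x : 0 < s < T -> `|u s x - profile c d (1 + s) x| <= M + pb.
Proof.
move=> sT; have s0 : 0 < s by case/andP: sT.
apply: le_trans (ler_normB _ _) _; apply: lerD; [exact: uM|exact: profile_abs_le].
Qed.

Let iV l s : 0 < l -> 0 < s < T ->
  itg (fun x => `|u s x - profile c d (1 + s) x| * bump (l * x + 0)).
Proof.
move=> l0 sT; have s0 : 0 < s by case/andP: sT.
apply: (integrable_mul_bump 0 l0 (B := M + pb)).
  by apply: measurableT_comp; [exact: normr_measurable|exact: mv].
by move=> x; rewrite normr_id; exact: vM.
Qed.

Let iY m l s : 0 < m -> 0 < l -> 0 < s < T ->
  itg (fun x => soft_abs m (u s x - profile c d (1 + s) x) * bump (l * x + 0)).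
Proof.
move=> m0 l0 sT; have s0 : 0 < s by case/andP: sT.
apply: (integrable_mul_bump 0 l0 (B := M + pb + 2 * m)).
  apply: (measurableT_comp (measurable_continuous _) (mv s0)).
  exact: (derive_continuous (is_derive_soft_abs m0)).
move=> x; have /andP[h1 h2] := soft_abs_bounds m0 (u s x - profile c d (1 + s) x).
rewrite ger0_norm; last exact: le_trans h1.
by apply: le_trans h2 _; rewrite lerD2r; exact: vM.
Qed.

Let V_le_Y m l s : 0 < m -> 0 < l -> 0 < s < T -> V l s <= Y m l s.
Proof.
move=> m0 l0 sT; apply: le_Rintegral; [exact: measurableT|exact: iV|exact: iY|].
move=> x _; apply: ler_wpM2r; first exact: ltW (bump_gt0 _).
by have /andP[] := soft_abs_bounds m0 (u s x - profile c d (1 + s) x).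
Qed.

Let Y_le_V m l s : 0 < m -> 0 < l -> 0 < s < T -> Y m l s <= V l s + 2 * m / l.
Proof.
move=> m0 l0 sT; have i1 := iV l0 sT; have i2 := integrable_bump 0 l0.
have -> : 2 * m / l = 2 * m * \int[mu]_x bump (l * x + 0) by rewrite /Rintegral integral_bump.
rewrite /V -(RintegralZl _ measurableT i2) -(RintegralD measurableT i1 (integrableRZ _ i2)).
apply: le_Rintegral; [exact: measurableT|exact: iY|exact: (integrableRD i1 (integrableRZ _ i2))|].
move=> x _; rewrite -mulrDl; apply: ler_wpM2r; first exact: ltW (bump_gt0 _).
by have /andP[] := soft_abs_bounds m0 (u s x - profile c d (1 + s) x).
Qed.

(** The limit [m -> 0] at fixed [l] and [t0]: the gradient bound [K] depends on [t0], but occurs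
    only multiplied by [m]. *)
Lemma abs_mass_growth l t0 t : 0 < l -> 0 < t0 < t -> t < T ->
  V l t <= expR ((M + pb) * l * t) * (V l t0 +
     fc * (8 * kernel_cst al * (M + pb) * l `^ (al - 1)) * t + growth_total al c d t).
Proof.
move=> l0 /andP[t00 t0t] tT; case: (Su) => _ S _ _.
have [|K HK] := S (t0 / 2) (t + 1); first by apply/andP; split; lra.
have uxK s x : t0 <= s <= t -> `|ux s x| <= K.
  move=> /andP[s1 s2]; have ss : t0 / 2 < s < t + 1 by apply/andP; split; lra.
  by have [[_ _ _ h _] _ _ _] := HK s ss; exact: h.
have K0 : 0 <= K.
  have tt : t0 <= t <= t by apply/andP; split; lra.
  exact: le_trans (normr_ge0 _) (uxK t 0 tt).
have t0T : 0 < t0 < T by apply/andP; split; lra.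
have tTT : 0 < t < T by apply/andP; split; lra.
set e := expR _; have e0 : 0 < e by exact: expR_gt0.
set a := fc * _.
(* The total coefficient of [m] among the errors, so that [m = eps / (D + 1)] costs at most
   [eps]. *)
pose D := e * (2 / l + (fc * (8 * kernel_cst al * 2 * l `^ (al - 1)) + 2 * (K + pb) / l) * t).
have fc0 : 0 < fc := frac_const_gt0 al12; have kc := kernel_cst_gt0 al12.
have D0 : 0 <= D.
  apply: mulr_ge0; first exact: ltW.
  apply: addr_ge0; first by apply: divr_ge0 => //; exact: ltW.
  apply: mulr_ge0; last by lra.
  apply: addr_ge0.
    apply: mulr_ge0; first exact: ltW.
    by apply: mulr_ge0; [apply: mulr_ge0 => //; apply: mulr_ge0 => //; exact: ltW|exact: powR_ge0].
  by apply: divr_ge0; [apply: mulr_ge0 => //; exact: addr_ge0|exact: ltW].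
apply/ler_addgt0Pr => eps eps0; pose m := eps / (D + 1).
have D1 : 0 < D + 1 by lra.
have m0 : 0 < m by rewrite divr_gt0.
apply: le_trans (V_le_Y m0 l0 tTT) _.
apply: (le_trans (soft_mass_growth m0 l0 _ tT K0 uxK)); first by rewrite t00.
rewrite -/e; have h := Y_le_V m0 l0 t0T; have mD : m * D <= eps.
  by rewrite /m mulrAC ler_pdivrMr// ler_pM2l//; lra.
apply: le_trans (lerD (lexx _) mD); rewrite /D.
have -> : m * (e * (2 / l + (fc * (8 * kernel_cst al * 2 * l `^ (al - 1)) + 2 * (K + pb) / l) * t)) =
  e * (m * (2 / l + (fc * (8 * kernel_cst al * 2 * l `^ (al - 1)) + 2 * (K + pb) / l) * t)) by ring.
rewrite -mulrDr ler_pM2l// /growth_error -/fc -/pb /a -/(Y m l t0).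
have -> : fc * (8 * kernel_cst al * (M + pb + 2 * m) * l `^ (al - 1)) + 2 * m * (K + pb) / l =
  fc * (8 * kernel_cst al * (M + pb) * l `^ (al - 1)) +
  m * (fc * (8 * kernel_cst al * 2 * l `^ (al - 1)) + 2 * (K + pb) / l) by ring.
rewrite [m * (2 / l + _)]mulrDr; move: h.
have -> : m * (2 / l) = 2 * m / l by ring.
set q := fc * (8 * kernel_cst al * 2 * _) + _; set p := fc * (8 * _ * (M + pb) * _).
by lra.
Qed.

(** The order of the limits is forced: first [m -> 0], then the starting time, then [l -> 0], since
    the gradient bound depends on the starting time and the choice of the latter on [l]. *)
Lemma integral_profile_dist t : 0 < t < T ->
  (\int[mu]_x `|u t x - profile c d (1 + t) x|%:E <=
    (\int[mu]_x `|u0 x - profile c d 1 x| + 4 * growth_total al c d t)%:E)%E.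
Proof.
move=> tT; have /andP[t0 tT'] := tT; have T0 : 0 < T by lra.
set D0 := Rintegral _ _ _; set G := growth_total al c d t.
have p1 : 1 <= 1 :> R by [].
have [Dw0 _ w0B w0x _] := profile_nice cd p1.
have mw0 : measurable_fun [set: R] (profile c d 1).
  by apply: measurable_continuous; exact: derive_continuous Dw0.
have w0L x y : `|profile c d 1 y - profile c d 1 x| <= pb * `|y - x|.
  have := lipschitz_derive x (y - x) Dw0 w0x.
  by have -> : x + (y - x) = y by ring.
have M0 : 0 <= M := le_trans (normr_ge0 _) (uM 0 tT).
have fc0 : 0 < fc := frac_const_gt0 al12; have kc := kernel_cst_gt0 al12.
pose r l := expR ((M + pb) * l * t) * (4^-1 * D0 + fc * (8 * kernel_cst al * (M + pb) * l `^ (al - 1)) * t + G).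
have Vr l : 0 < l -> V l t <= r l.
  move=> l0; set e := expR ((M + pb) * l * t); have e0 : 0 < e by exact: expR_gt0.
  apply/ler_addgt0Pr => eps eps0; pose eta := eps / (2 * e).
  have eta0 : 0 < eta by apply: divr_gt0 => //; exact: mulr_gt0.
  (* [initial_trace] compares [u] with the profile at time 0. A start before [t1] keeps the drift of
     the profile, at most [pb * s / l] in the weighted norm, below [eta]. *)
  pose t1 := Num.min t (eta * l / (pb + 1)).
  have pb1 : 0 < pb + 1 := ltr_wpDl pb0 ltr01.
  have t10 : 0 < t1 by rewrite lt_min t0/=; apply: divr_gt0 => //; exact: mulr_gt0.
  have t1t : t1 <= t by rewrite ge_min lexx.
  have t1e : t1 <= eta * l / (pb + 1) by rewrite ge_min lexx orbT.
  have t1T : 0 < t1 < T by rewrite t10 (le_lt_trans t1t).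
  have [s [/andP[s0 st1] sV]] := initial_trace al12 Su T0 uM mw0 w0B w0L iuw weak 0 l0 eta0 t1T.
  have st : 0 < s < t by rewrite s0 (lt_le_trans st1).
  have sT : 0 < s < T by rewrite s0 (lt_trans _ tT')//; case/andP: st.
  apply: le_trans (abs_mass_growth l0 st tT') _; rewrite /r -/e -/G.
  have Vs : V l s <= 4^-1 * D0 + 2 * eta.
    have i1 : itg (fun x => `|u s x - profile c d 1 x| * bump (l * x + 0)).
      apply: (integrable_mul_bump 0 l0 (B := M + pb)).
        apply: measurableT_comp; first exact: normr_measurable.
        by apply: measurable_funB => //; exact: (solution_measurable Su s0).
      move=> x; rewrite normr_id; apply: le_trans (ler_normB _ _) _.
      by apply: lerD; [exact: uM|exact: w0B].
    have i2 := integrable_bump 0 l0.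
    have h1 : V l s <= \int[mu]_x (`|u s x - profile c d 1 x| * bump (l * x + 0) +
         pb * s * bump (l * x + 0)).
      apply: le_Rintegral; [exact: measurableT|exact: iV|exact: (integrableRD i1 (integrableRZ _ i2))|].
      move=> x _; rewrite -mulrDl; apply: ler_wpM2r; first exact: ltW (bump_gt0 _).
      have wL : `|profile c d 1 x - profile c d (1 + s) x| <= pb * s.
        pose gg r := profile c d (1 + r) x.
        have Dg (q : R) : 0 <= q -> is_derive q 1 gg (profile_dt c d (1 + q) x).
          by move=> q0; exact: is_derive_profile_time.
        have cg : {within `[0, s], continuous gg}.
          apply: continuous_in_subspaceT => q; rewrite mem_setE in_itv/= => /andP[q0 _].
          by apply/differentiable_continuous/derivable1_diffP; case: (Dg q q0).
        have hD (q : R) : q \in `]0, s[%R -> is_derive q 1 gg (profile_dt c d (1 + q) x).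
          by rewrite in_itv/= => /andP[q0 _]; apply: Dg; exact: ltW.
        have [q] := MVT_segment (ltW s0) hD cg.
        rewrite in_itv/= => /andP[q0 _] hq.
        have e10 : profile c d 1 x = gg 0 by rewrite /gg addr0.
        rewrite distrC e10 -/(gg s) hq subr0 normrM (gtr0_norm s0) ler_wpM2r// ?(ltW s0)//.
        by apply: profile_dt_bound => //; lra.
      have -> : u s x - profile c d (1 + s) x =
        (u s x - profile c d 1 x) + (profile c d 1 x - profile c d (1 + s) x) by ring.
      by apply: le_trans (ler_normD _ _) _; rewrite lerD2l.
    apply: le_trans h1 _.
    rewrite (RintegralD measurableT i1 (integrableRZ _ i2)) (RintegralZl _ measurableT i2).
    have -> : \int[mu]_x bump (l * x + 0) = l^-1 by rewrite /Rintegral integral_bump.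
    have h2 : pb * s / l <= eta.
      rewrite ler_pdivrMr//; have s1 : s <= eta * l / (pb + 1) by exact: ltW (lt_le_trans st1 t1e).
      have : (pb + 1) * s <= (pb + 1) * (eta * l / (pb + 1)) by rewrite ler_pM2l.
      have -> : (pb + 1) * (eta * l / (pb + 1)) = eta * l by field; rewrite gt_eqF.
      by rewrite mulrDl mul1r; move: s0; lra.
    have -> : 4^-1 * D0 + 2 * eta = 4^-1 * D0 + eta + eta by ring.
    by apply: lerD.
  have -> : eps = e * (2 * eta) by rewrite /eta; field; rewrite gt_eqF.
  by rewrite -mulrDr ler_pM2l//; move: Vs; lra.
pose ln (n : nat) : R := n.+1%:R^-1.
have ln0 n : 0 < ln n by rewrite invr_gt0.
have cln : ln n @[n --> \oo] --> (0 : R) by exact: cvg_harmonic.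
apply: (@ge0_integral_le_bump (fun x => `|u t x - profile c d (1 + t) x|) ln (fun n => r (ln n))).
- by apply: measurableT_comp; [exact: normr_measurable|exact: mv].
- by move=> x; exact: normr_ge0.
- exact: cln.
- have -> : (D0 + 4 * G) / 4 = expR ((M + pb) * 0 * t) *
    (4^-1 * D0 + fc * (8 * kernel_cst al * (M + pb) * 0) * t + G).
    by rewrite !(mulr0, mul0r) expR0; field.
  apply: cvgM.
    apply: (@cvg_comp _ _ _ (fun n => (M + pb) * ln n * t) (@expR R) _ (nbhs ((M + pb) * 0 * t : R))).
      by apply: cvgM; [apply: cvgM; [exact: cvg_cst|exact: cln]|exact: cvg_cst].
    exact: continuous_expR.
  apply: cvgD; last exact: cvg_cst.
  apply: cvgD; first exact: cvg_cst.
  apply: cvgM; last exact: cvg_cst.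
  apply: cvgM; first exact: cvg_cst.
  apply: cvgM; first exact: cvg_cst.
  have al1 : 0 < al - 1 by case/andP: al12 => ? _; lra.
  by have /cvg_at_rightP := powR_cvg0 al1; apply.
- move=> n; have tTn : 0 < t < T := tT.
  have := Vr (ln n) (ln0 n); rewrite -lee_fin /V /Rintegral fineK//.
  by apply: integrable_fin_num => //; exact: iV.
Qed.

End L1Bound.

(** * Oleinik's inequality *)

Section Oleinik.
Context {R : realType}.
Notation mu := (@lebesgue_measure R).
Notation itg f := (mu.-integrable [set: R] (EFin \o f)).
Implicit Types (f g : R -> R) (a b s t x y z h k q r l m B K M T : R).

(** A maximum over a closed time interval may sit at the final time, where only difference quotients
    from the left are at hand. *)
Lemma derive_ge0_left g l a s : a < s -> is_derive s 1 g l ->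
  (forall r, a < r < s -> g r <= g s) -> 0 <= l.
Proof.
move=> as_ Dg gs.
have D : derivable g s 1 by case: Dg.
have cv : (r^-1 *: (g (r *: (1:R) + s) - g s)) @[r --> 0^'] --> l.
  by rewrite -(@derive_val _ _ _ _ _ _ _ Dg); exact: D.
have cv2 := cvg_dnbhs_at_left cv.
rewrite -(cvg_lim _ cv2)//; apply: limr_ge; first exact: cvgP cv2.
near=> r.
have r0 : r < 0 by near: r; exact: nbhs_left_lt.
have ra : a - s < r by near: r; apply: nbhs_left_gt; rewrite subr_lt0.
rewrite [_ *: 1]mulr1; apply: mulr_le0; first by rewrite invr_le0 ltW.
by rewrite subr_le0; apply: gs; apply/andP; split; lra.
Unshelve. all: by end_near. Qed.

Lemma derive_max_eq0 g l a b x : (forall y, a < y < b -> derivable g y 1) ->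
  a < x < b -> is_derive x 1 g l -> (forall y, a < y < b -> g y <= g x) -> l = 0.
Proof.
move=> Dg xab Dx gx; have ab : a <= b by case/andP: xab; lra.
have DD y : y \in `]a, b[%R -> derivable g y 1 by rewrite in_itv/=; exact: Dg.
have MM y : y \in `]a, b[%R -> g y <= g x by rewrite in_itv/=; exact: gx.
have xi : x \in `]a, b[%R by rewrite in_itv.
have D0 := derive1_at_max ab DD xi MM.
by rewrite -(@derive_val _ _ _ _ _ _ _ Dx) (@derive_val _ _ _ _ _ _ _ D0).
Qed.

Variables (al : R) (u ut ux : R -> R -> R).
Hypothesis al12 : 1 < al < 2.
Hypothesis Su : smooth_solution al u ut ux.
Let fc := frac_const al.
Let chi := @soft_abs R 1.
Let chi' := @soft_sgn R 1.

(** [chi] grows linearly, so it is not [nice]; but the kernel estimate needs only a bounded first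
    derivative for large increments and a bounded second one for small increments. *)
Lemma integral_taylor1_chi x :
  itg (fun z => taylor1 chi chi' x z * kernel al z) /\ `|levy al chi chi' x| <= kernel_cst al * 3.
Proof.
have D1 : forall x, is_derive x 1 chi (chi' x) := is_derive_soft_abs ltr01.
have D2 : forall x, is_derive x 1 chi' (2 * bump (1^-1 * x) / 1) := @is_derive_soft_sgn R 1.
have B1 z : `|taylor1 chi chi' x z| <= 2 * `|z|.
  have h := taylor1_le1 x z D1 (soft_sgn_le1 1); rewrite mulr1 in h; exact: h.
have B2 z : `|taylor1 chi chi' x z| <= 1 * z ^+ 2.
  apply: (taylor1_le2 D1 D2) => y _; rewrite divr1 gtr0_norm; last first.
    by rewrite mulr_gt0// bump_gt0.
  by have := bump_le (1^-1 * y); lra.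
have mt : measurable_fun [set: R] (taylor1 chi chi' x).
  by apply: measurable_taylor1; exact: derive_continuous D1.
have i := integrable_kernel al12 mt B1 B2.
split; first exact: i.
apply: norm_Rintegral_le => //.
under eq_integral do rewrite normrM [X in _ * X]ger0_norm ?kernel_ge0//.
apply: (le_trans (integral_kernel_le al12 (@ltr01 R) _ _ (J := fun z => `|taylor1 chi chi' x z|) _ _ B1 B2)) => //.
- exact: measurableT_comp.
- by rewrite !powR1 lee_fin ler_wpM2l ?(ltW (kernel_cst_gt0 al12))//; lra.
Qed.

Section MaximumPrinciple.
Variables (a t1 M be ga : R).
Hypothesis at1 : 0 < a < t1.
Hypothesis be0 : 0 < be.
Hypothesis ga0 : 0 < ga.
Hypothesis HM : forall t, a / 2 < t < t1 + 1 ->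
     [/\ nice (u t) (ux t) M, forall x, is_derive t 1 (fun s => u s x) (ut t x),
       forall x, `|ut t x| <= M & continuous (ut t)].

(* [be * chi] confines the maximum to a compact set, [ga] makes the time derivative strict there. *)
Definition barrier s x h := (s - a) * (u s (x + h) - u s x) - h - be * chi x - ga * (s - a).

Let uM s x : a <= s <= t1 -> `|u s x| <= M.
Proof.
move=> /andP[s1 s2]; case/andP: at1 => a0 at_.
have ss : a / 2 < s < t1 + 1 by apply/andP; split; lra.
by have [[_ _ h _ _] _ _ _] := HM ss.
Qed.

Let M0 : 0 <= M.
Proof.
by apply: le_trans (normr_ge0 (u a 0)) (uM _ _); case/andP: at1 => *; apply/andP; split; lra.
Qed.

Let chi_ge x : `|x| <= chi x.
Proof. by have /andP[] := soft_abs_bounds (@ltr01 R) x. Qed.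

Let barrier_le s x h : a <= s <= t1 -> barrier s x h <= 2 * M * (t1 - a) - h - be * `|x|.
Proof.
move=> sat; have /andP[s1 s2] := sat.
have h1 : (s - a) * (u s (x + h) - u s x) <= (t1 - a) * (2 * M).
  apply: (@le_trans _ _ ((s - a) * (2 * M))).
    rewrite ler_wpM2l ?subr_ge0//.
    have := uM (x + h) sat; have := uM x sat; rewrite !ler_norml => /andP[? ?] /andP[? ?]; lra.
  by rewrite ler_wpM2r ?mulr_ge0// lerD2r.
have h2 : be * `|x| <= be * chi x by rewrite ler_pM2l.
have h3 : 0 <= ga * (s - a) by rewrite mulr_ge0 ?subr_ge0// ltW.
by rewrite /barrier; lra.
Qed.

(** Positivity excludes [s = a] and [h = 0]. Stationarity in [h] and [x] makes [(s - a) u_x] equal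
    to 1 at [x + h] and to [1 - be * chi' x] at [x], so the convection terms reproduce the
    difference [u s (x + h) - u s x] that arises from differentiating [s - a], and cancel it. What
    is left is of order [be], and [ga] is assumed larger. *)
Lemma barrier_max_contra s x h : be * (fc * (kernel_cst al * 3) + M) < ga ->
  a <= s <= t1 -> 0 <= h -> 0 < barrier s x h ->
  (forall r y k, a <= r <= t1 -> 0 <= k -> barrier r y k <= barrier s x h) -> False.
Proof.
move=> small sat h0 pos mx; have /andP[s1 s2] := sat; have /andP[a0 at_] := at1.
have cx0 : 0 <= be * chi x.
  by apply: mulr_ge0; [exact: ltW|exact: le_trans (normr_ge0 x) (chi_ge x)].
have sa : a < s.
  rewrite lt_neqAle s1 andbT; apply/eqP => e; move: pos.
  rewrite /barrier -e subrr !(mul0r, mulr0); lra.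
have hp : 0 < h.
  rewrite lt_neqAle h0 andbT; apply/eqP => e; move: pos.
  have : 0 <= ga * (s - a) by rewrite mulr_ge0 ?subr_ge0// ltW.
  rewrite /barrier -e addr0 subrr mulr0; lra.
have ss : a / 2 < s < t1 + 1 by apply/andP; split; lra.
have [nu Dut utM cut] := HM ss; have [Du cux _ _ _] := nu.
have Dush k y : is_derive y 1 (fun q => u s (q + k)) (ux s (y + k)).
  refine (derive_eq (derive_compose (g := fun q => q + k) (Du _)
    (derive_add (derive_idfun y) (derive_cst k y))) _); ring.
have Dchi y : is_derive y 1 chi (chi' y) := is_derive_soft_abs ltr01 y.
have eh : (s - a) * ux s (x + h) = 1.
  have D k : is_derive k 1 (barrier s x) ((s - a) * ux s (x + k) - 1).
    have Dk : is_derive k 1 (fun q => u s (x + q)) (ux s (x + k)).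
      by have := Dush x k; rewrite (addrC k); under eq_fun do rewrite addrC.
    refine (derive_eq (derive_sub (derive_sub (derive_sub (derive_mul (derive_cst (s - a) k)
      (derive_sub Dk (derive_cst (u s x) k))) (derive_idfun k)) (derive_cst (be * chi x) k))
      (derive_cst (ga * (s - a)) k)) _); ring.
  have e1 y : 0 < y < h + 1 -> derivable (barrier s x) y 1 by move=> _; case: (D y).
  have e2 : 0 < h < h + 1 by rewrite hp ltrDl ltr01.
  have e3 y : 0 < y < h + 1 -> barrier s x y <= barrier s x h.
    by move=> /andP[y0 _]; apply: mx => //; exact: ltW.
  by have := derive_max_eq0 e1 e2 (D h) e3; lra.
have ex : (s - a) * (ux s (x + h) - ux s x) = be * chi' x.
  have D y : is_derive y 1 (fun q => barrier s q h)
      ((s - a) * (ux s (y + h) - ux s y) - be * chi' y).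
    refine (derive_eq (derive_sub (derive_sub (derive_sub (derive_mul (derive_cst (s - a) y)
      (derive_sub (Dush h y) (Du y))) (derive_cst h y)) (derive_mul (derive_cst be y) (Dchi y)))
      (derive_cst (ga * (s - a)) y)) _); ring.
  have e1 y : x - 1 < y < x + 1 -> derivable (fun q => barrier s q h) y 1 by move=> _; case: (D y).
  have e2 : x - 1 < x < x + 1 by rewrite ltrDl gtrDl ltrN10 ltr01.
  have e3 y : x - 1 < y < x + 1 -> barrier s y h <= barrier s x h by move=> _; exact: mx.
  by have := derive_max_eq0 e1 e2 (D x) e3; lra.
have es : 0 <= (u s (x + h) - u s x) + (s - a) * (ut s (x + h) - ut s x) - ga.
  have D : is_derive s 1 (fun r => barrier r x h)
      ((u s (x + h) - u s x) + (s - a) * (ut s (x + h) - ut s x) - ga).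
    have Dsa : is_derive s 1 (fun r => r - a) 1.
      refine (derive_eq (derive_sub (derive_idfun s) (derive_cst a s)) _); ring.
    refine (derive_eq (derive_sub (derive_sub (derive_sub (derive_mul Dsa
      (derive_sub (Dut (x + h)) (Dut x))) (derive_cst h s)) (derive_cst (be * chi x) s))
      (derive_mul (derive_cst ga s) Dsa)) _); ring.
  apply: (derive_ge0_left sa D) => r /andP[r1 r2]; apply: mx => //.
  by rewrite ltW//= (le_trans (ltW r2)).
(* At fixed [s] and [h] the maximum is compared with the value at every translate [x + z]. The
   gradient terms match by [ex], and the inequality is integrated against the kernel. *)
have elevy : (s - a) * (levy al (u s) (ux s) (x + h) - levy al (u s) (ux s) x) <=
    be * (kernel_cst al * 3).
  have [ichi bchi] := integral_taylor1_chi x.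
  have i1 := integrable_levy al12 (x + h) nu; have i2 := integrable_levy al12 x nu.
  apply: (@le_trans _ _ (be * levy al chi chi' x)); last first.
    by rewrite ler_pM2l//; apply: le_trans (ler_norm _) bchi.
  rewrite /levy -(RintegralB measurableT i1 i2) -(RintegralZl _ measurableT (integrableRB i1 i2)).
  rewrite -(RintegralZl _ measurableT ichi).
  apply: le_Rintegral; [exact: measurableT|exact: (integrableRZ _ (integrableRB i1 i2))|
    exact: (integrableRZ _ ichi)|].
  move=> z _; rewrite -mulrBl !mulrA; apply: ler_wpM2r; first exact: kernel_ge0.
  have := mx s (x + z) h sat h0; rewrite /barrier /taylor1.
  have -> : x + z + h = x + h + z by ring.
  have : (s - a) * (ux s (x + h) - ux s x) * z = be * chi' x * z by rewrite ex.
  by lra.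
have fc0 : 0 < fc := frac_const_gt0 al12.
have [_ _ pde _] := Su; have s0 : 0 < s by exact: lt_trans a0 sa.
have e1 : (s - a) * (ut s (x + h) - ut s x) =
  fc * ((s - a) * (levy al (u s) (ux s) (x + h) - levy al (u s) (ux s) x))
   - (u s (x + h) * ((s - a) * ux s (x + h)) - u s x * ((s - a) * ux s x)).
  by rewrite (pde _ (x + h) s0) (pde _ x s0) -/fc; ring.
have e2 : (s - a) * ux s x = 1 - be * chi' x by rewrite -ex mulrBr eh; ring.
have e3 : `|be * chi' x * u s x| <= be * M.
  rewrite normrM; apply: ler_pM => //; last exact: uM.
  by rewrite normrM (gtr0_norm be0) ler_piMr ?(ltW be0)//; exact: soft_sgn_le1.
have e4 : fc * ((s - a) * (levy al (u s) (ux s) (x + h) - levy al (u s) (ux s) x)) <=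
  fc * (be * (kernel_cst al * 3)) by rewrite ler_pM2l.
move: es; rewrite e1 eh e2; move: e3; rewrite ler_norml => /andP[e3 _]; lra.
Qed.

(** Outside the box given by [X] and [H] the barrier is nonpositive. A positive value would thus
    produce a maximum over a compact set that is positive and global. *)
Lemma barrier_le0 t x h : be * (fc * (kernel_cst al * 3) + M) < ga ->
  a <= t <= t1 -> 0 <= h -> barrier t x h <= 0.
Proof.
move=> small tat h0; rewrite leNgt; apply/negP => pos.
have /andP[a0 at_] := at1; have /andP[t_1 t_2] := tat.
pose H := 2 * M * (t1 - a); pose X := H / be.
have H0 : 0 <= H by rewrite !mulr_ge0// subr_ge0 ltW.
have out s y k : a <= s <= t1 -> 0 <= k -> (H < k \/ X < `|y|) -> barrier s y k <= 0.
  move=> sat k0 hor; apply: le_trans (barrier_le y k sat) _; rewrite -/H.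
  have y0 : 0 <= be * `|y| by apply: mulr_ge0 => //; exact: ltW.
  case: hor => [hk|hy]; first by lra.
  have : H < be * `|y| by move: hy; rewrite /X ltr_pdivrMr// mulrC.
  lra.
pose A : set (R * (R * R)) := `[a, t1]%classic `*` (`[- X, X]%classic `*` `[0, H]%classic).
have X0 : 0 <= X by apply: divr_ge0 => //; exact: ltW.
have inA s y k : A (s, (y, k)) <-> [/\ a <= s <= t1, - X <= y <= X & 0 <= k <= H].
  by rewrite /A /= !in_itv/=; split=> [[? [? ?]]|[? ? ?]].
have cA : compact A.
  by apply: compact_setX; [|apply: compact_setX]; exact: segment_compact.
have nA : A !=set0.
  by exists (a, (0, 0)); apply/inA; split; apply/andP; split=> //; rewrite ?oppr_le0// ltW.
pose f (p : R * (R * R)) := barrier p.1 p.2.1 p.2.2.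
have cf : {within A, continuous f}.
  apply: continuous_in_subspaceT => -[s [y k]]; rewrite inE => /inA[/andP[s1 s2] _ _].
  have s0 : 0 < s by lra.
  have c1 : {for (s, (y, k)), continuous (fun p : R * (R * R) => p.1)} by exact: cvg_fst.
  have c2 : {for (s, (y, k)), continuous (fun p : R * (R * R) => p.2.1)}.
    by apply: (@continuous_comp _ _ _ snd fst); [exact: cvg_snd|exact: cvg_fst].
  have c3 : {for (s, (y, k)), continuous (fun p : R * (R * R) => p.2.2)}.
    by apply: (@continuous_comp _ _ _ snd snd); exact: cvg_snd.
  have [_ _ _ cu] := Su.
  have c4 : {for (s, (y, k)), continuous (fun p : R * (R * R) => u p.1 p.2.1)}.
    apply: (@continuous_comp _ _ _ (fun p : R * (R * R) => (p.1, p.2.1)) (fun q : R * R => u q.1 q.2)).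
      exact: (cvg_pair c1 c2).
    exact: cu.
  have c5 : {for (s, (y, k)), continuous (fun p : R * (R * R) => u p.1 (p.2.1 + p.2.2))}.
    apply: (@continuous_comp _ _ _ (fun p : R * (R * R) => (p.1, p.2.1 + p.2.2)) (fun q : R * R => u q.1 q.2)).
      exact: (cvg_pair c1 (cvgD c2 c3)).
    exact: cu.
  have c6 : {for (s, (y, k)), continuous (fun p : R * (R * R) => chi p.2.1)}.
    apply: (@continuous_comp _ _ _ (fun p : R * (R * R) => p.2.1) chi); first exact: c2.
    exact: (derive_continuous (is_derive_soft_abs ltr01)).
  have c7 : {for (s, (y, k)), continuous (fun p : R * (R * R) => p.1 - a)}.
    by apply: cvgB; [exact: c1|exact: cvg_cst].
  apply: cvgB; last by apply: cvgM; [exact: cvg_cst|exact: c7].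
  apply: cvgB; last by apply: cvgM; [exact: cvg_cst|exact: c6].
  apply: cvgB; last exact: c3.
  by apply: cvgM; [exact: c7|apply: cvgB; [exact: c5|exact: c4]].
have [[s [y k]]] := compact_EVT_max nA cA cf.
rewrite inE => /inA[sat yX /andP[k0 kH]] mx.
have mxA r z q : A (r, (z, q)) -> barrier r z q <= barrier s y k.
  by move=> Ar; apply: (mx (r, (z, q))); rewrite inE.
have tin : A (t, (x, h)).
  apply/inA; split => //.
    rewrite -ler_norml leNgt; apply/negP => hx.
    by have := out t x h tat h0 (or_intror hx); rewrite leNgt pos.
  by rewrite h0/= leNgt; apply/negP => hx; have := out t x h tat h0 (or_introl hx); rewrite leNgt pos.
have pos' : 0 < barrier s y k by exact: lt_le_trans pos (mxA _ _ _ tin).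
apply: (barrier_max_contra small sat k0 pos') => r z q rat q0.
have [Xz|zX] := ltP X `|z|; first by apply: le_trans (out r z q rat q0 (or_intror Xz)) (ltW pos').
have [Hq|qH] := ltP H q; first by apply: le_trans (out r z q rat q0 (or_introl Hq)) (ltW pos').
by apply: mxA; apply/inA; split => //; [rewrite -ler_norml|rewrite q0].
Qed.

End MaximumPrinciple.

(** The barrier starts at a time [a > 0], where derivatives are bounded. First [be -> 0] with [ga]
    proportional to it, then [a -> 0]. *)
Lemma solution_oleinik t x h : 0 < t -> 0 <= h -> u t (x + h) - u t x <= h / t.
Proof.
move=> t0 h0.
have key a : 0 < a < t -> (t - a) * (u t (x + h) - u t x) <= h.
  move=> at1; have /andP[a0 at_] := at1; case: (Su) => _ S _ _.
  have [|M HM] := S (a / 2) (t + 1); first by apply/andP; split; lra.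
  have tt : a <= t <= t by apply/andP; split; lra.
  have M0 : 0 <= M.
    have ss : a / 2 < t < t + 1 by apply/andP; split; lra.
    by have [nu _ _ _] := HM t ss; exact: nice_ge0 nu.
  set K := fc * (kernel_cst al * 3) + M.
  have K0 : 0 <= K.
    have fc0 := ltW (frac_const_gt0 al12); have kc0 := ltW (kernel_cst_gt0 al12).
    by apply: addr_ge0 => //; apply: mulr_ge0 => //; exact: mulr_ge0.
  have K1 : 0 < K + 1 by lra.
  (* With [ga = be * (K + 1)], the two penalties at the given point amount to [be * C]. *)
  pose C := chi x + (K + 1) * (t - a).
  have C0 : 0 <= C.
    have /andP[h1 _] := soft_abs_bounds (@ltr01 R) x.
    apply: addr_ge0; first exact: le_trans h1.
    by apply: mulr_ge0; [exact: ltW|lra].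
  apply/ler_addgt0Pr => eps eps0; pose be := eps / (C + 1).
  have be0 : 0 < be by apply: divr_gt0 => //; lra.
  have ga0 : 0 < be * (K + 1) by exact: mulr_gt0.
  have small : be * K < be * (K + 1) by rewrite ltr_pM2l//; lra.
  have := barrier_le0 at1 be0 ga0 HM x small tt h0; rewrite /barrier.
  have : be * C <= eps by rewrite /be mulrAC ler_pdivrMr ?ler_pM2l//; lra.
  rewrite /C mulrDr mulrA; lra.
rewrite ler_pdivlMr//; apply/ler_addgt0Pr => eps eps0.
set D := u t (x + h) - u t x.
have D1 : 0 < `|D| + 1 by have := normr_ge0 D; lra.
pose a := Num.min (t / 2) (eps / (`|D| + 1)).
have a0 : 0 < a by rewrite lt_min divr_gt0//= divr_gt0.
have a1 : a <= t / 2 by rewrite ge_min lexx.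
have a2 : a * (`|D| + 1) <= eps by rewrite -ler_pdivlMr// ge_min lexx orbT.
have at_ : 0 < a < t by apply/andP; split; lra.
have := key a at_; rewrite -/D.
have : a * D <= a * (`|D| + 1) by rewrite ler_pM2l//; have := ler_norm D; lra.
lra.
Qed.

End Oleinik.

(** * The rarefaction wave *)

Section RarefactionDistance.
Context {R : realType}.
Notation mu := (@lebesgue_measure R).
Notation itg f := (mu.-integrable [set: R] (EFin \o f)).
Implicit Types (f g : R -> R) (a b s t x y z h l m B K M T tau : R).
Variables (c d : R).
Hypothesis cd : c < d.

(** The same shape as [profile], with the positive part in place of [softplus]. *)
Lemma rarefactionE t x :
  rarefaction c d t x = c + Num.max (x / t - c) 0 - Num.max (x / t - d) 0.
Proof.
have cd' := cd; rewrite /rarefaction; set y := x / t; case: leP => h1.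
  have -> : Num.max (y - c) 0 = 0 by apply/max_idPr; lra.
  have -> : Num.max (y - d) 0 = 0 by apply/max_idPr; lra.
  by ring.
have -> : Num.max (y - c) 0 = y - c by apply/max_idPl; lra.
case: leP => h2.
  have -> : Num.max (y - d) 0 = 0 by apply/max_idPr; lra.
  by ring.
have -> : Num.max (y - d) 0 = y - d by apply/max_idPl; lra.
by ring.
Qed.

Lemma measurable_rarefaction t : measurable_fun [set: R] (rarefaction c d t).
Proof.
have -> : rarefaction c d t = (fun x => c + Num.max (x / t - c) 0 - Num.max (x / t - d) 0).
  by apply/funext => x; exact: rarefactionE.
have ml k : measurable_fun [set: R] (fun x => Num.max (x / t - k) 0).
  by apply: measurable_maxr => //; apply: measurable_funB => //; exact: measurable_funM.
by apply: measurable_funB => //; exact: measurable_funD.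
Qed.

Lemma rarefaction_between t x : c <= rarefaction c d t x <= d.
Proof.
have cd' := cd; rewrite /rarefaction; set y := x / t.
by case: (leP y c) => h1; [|case: (leP y d) => h2]; apply/andP; split; lra.
Qed.

Lemma rarefaction_nondecreasing t x h : 0 < t -> 0 <= h ->
  rarefaction c d t x <= rarefaction c d t (x + h).
Proof.
move=> t0 h0; have cd' := cd; have xh : x / t <= (x + h) / t by rewrite ler_pM2r ?invr_gt0// lerDl.
rewrite /rarefaction; move: xh; set y := x / t; set z := (x + h) / t => yz.
by case: (leP y c) => ?; case: (leP z c) => ?; case: (leP y d) => ?; case: (leP z d) => ?; lra.
Qed.

Lemma softplus_max_le y : `|softplus y - Num.max y 0| <= 4 * bump y.
Proof.
have -> : softplus y - Num.max y 0 = softplus (- `|y|) by rewrite softplus_max; ring.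
rewrite ger0_norm ?softplus_ge0//; apply: le_trans (softplus_le_expR _) _.
exact: bump_lb.
Qed.

Lemma profile_rarefaction_le tau x : 0 < tau ->
  `|profile c d tau x - rarefaction c d tau x| <=
    4 / tau * bump (1 * x + - (c * tau)) + 4 / tau * bump (1 * x + - (d * tau)).
Proof.
move=> t0; have ti : 0 < tau^-1 by rewrite invr_gt0.
have e k : Num.max (x / tau - k) 0 = Num.max (x - k * tau) 0 / tau.
  have -> : x / tau - k = (x - k * tau) / tau by field; rewrite gt_eqF.
  by rewrite maxr_pMl ?(ltW ti)// mul0r.
have -> : profile c d tau x - rarefaction c d tau x =
  ((softplus (x - c * tau) - Num.max (x - c * tau) 0) - (softplus (x - d * tau) - Num.max (x - d * tau) 0)) / tau.
  by rewrite rarefactionE !e /profile; ring.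
rewrite normrM (gtr0_norm ti) mul1r.
have -> : 4 / tau * bump (x + - (c * tau)) + 4 / tau * bump (x + - (d * tau)) =
   (4 * bump (x - c * tau) + 4 * bump (x - d * tau)) / tau by ring.
rewrite ler_pM2r//; apply: le_trans (ler_normB _ _) _; apply: lerD; exact: softplus_max_le.
Qed.

Lemma integral_profile_rarefaction tau : 1 <= tau ->
  (\int[mu]_x `|profile c d tau x - rarefaction c d tau x|%:E <= 8%:E)%E.
Proof.
move=> t1; have t0 : 0 < tau by lra.
have mb b : measurable_fun [set: R] (fun x => (4 / tau * bump (1 * x + b))%:E).
  apply/measurable_EFinP; apply: measurable_funM => //.
  by apply: measurable_continuous; exact: continuous_bump_affine.
have k0 : 0 <= 4 / tau by rewrite divr_ge0// ltW.
have ib b : (\int[mu]_x (4 / tau * bump (1 * x + b))%:E <= 4%:E)%E.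
  under eq_integral do rewrite EFinM.
  rewrite ge0_integralZl//.
  - rewrite integral_bump// -EFinM lee_fin invr1 mulr1 ler_pdivrMr//; lra.
  - by apply/measurable_EFinP; apply: measurable_continuous; exact: continuous_bump_affine.
  - by move=> x _; rewrite lee_fin ltW// bump_gt0.
apply: (@le_trans _ _ (\int[mu]_x ((4 / tau * bump (1 * x + - (c * tau)))%:E +
     (4 / tau * bump (1 * x + - (d * tau)))%:E))%E).
  apply: ge0_le_integral => //.
  - apply/measurable_EFinP; apply: measurableT_comp => //; apply: measurable_funB.
      by apply: measurable_continuous; exact: (derive_continuous (is_derive_profile c d tau)).
    exact: measurable_rarefaction.
  - by apply: emeasurable_funD; exact: mb.
  - by move=> x _; rewrite -EFinD lee_fin; exact: profile_rarefaction_le.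
have b0 b x : (0 <= (4 / tau * bump (1 * x + b))%:E)%E.
  by rewrite lee_fin mulr_ge0// ltW// bump_gt0.
rewrite ge0_integralD//; try exact: mb.
apply: le_trans (leeD (ib _) (ib _)) _; rewrite -EFinD lee_fin; lra.
Qed.

Lemma clamp_lipschitz x y :
  `|(c + Num.max (x - c) 0 - Num.max (x - d) 0) - (c + Num.max (y - c) 0 - Num.max (y - d) 0)|
    <= `|x - y|.
Proof.
have cd' := cd.
wlog yx : x y / y <= x.
  move=> H; have [yx|xy] := leP y x; first exact: H.
  by rewrite distrC [leRHS]distrC; apply: H; exact: ltW.
rewrite [leRHS]ger0_norm ?subr_ge0//.
case: (leP x c) => h1.
  have -> : Num.max (x - c) 0 = 0 by apply/max_idPr; lra.
  have -> : Num.max (x - d) 0 = 0 by apply/max_idPr; lra.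
  have -> : Num.max (y - c) 0 = 0 by apply/max_idPr; lra.
  have -> : Num.max (y - d) 0 = 0 by apply/max_idPr; lra.
  by rewrite subrr normr0 subr_ge0.
have -> : Num.max (x - c) 0 = x - c by apply/max_idPl; lra.
have xd : Num.max (x - d) 0 <= x - y + Num.max (y - d) 0.
  rewrite ge_max; apply/andP; split.
    have : y - d <= Num.max (y - d) 0 by rewrite le_max lexx.
    lra.
  by rewrite addr_ge0 ?subr_ge0// le_max lexx orbT.
have yd : Num.max (y - d) 0 <= Num.max (x - d) 0.
  by rewrite ge_max !le_max lerD2r yx lexx orbT.
have yc : y - c <= Num.max (y - c) 0 by rewrite le_max lexx.
have xd2 : Num.max (x - d) 0 - Num.max (y - d) 0 <= x - c - Num.max (y - c) 0.
  case: (leP x d) => h2.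
    have -> : Num.max (x - d) 0 = 0 by apply/max_idPr; lra.
    have -> : Num.max (y - d) 0 = 0 by apply/max_idPr; lra.
    have : Num.max (y - c) 0 <= x - c by rewrite ge_max; apply/andP; split; lra.
    lra.
  have -> : Num.max (x - d) 0 = x - d by apply/max_idPl; lra.
  have : Num.max (y - c) 0 <= d - c + Num.max (y - d) 0.
    rewrite ge_max; apply/andP; split.
      have : y - d <= Num.max (y - d) 0 by rewrite le_max lexx.
      lra.
    have : 0 <= Num.max (y - d) 0 by rewrite le_max lexx orbT.
    lra.
  lra.
move: xd yd yc xd2; set p := Num.max (x - d) 0; set q := Num.max (y - d) 0; set r := Num.max (y - c) 0.
by move=> *; rewrite ler_norml; apply/andP; split; lra.
Qed.

Let D := `|c| + `|d|.

(** For |x| > [D * (1 + t)] both waves are in the same constant state. Elsewhere 16 times the weight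
    is at least 1, and the difference is at most [d - c], useful for small [t], and at most
    [2 * D / t], because the wave is Lipschitz in [x / t]. *)
Lemma rarefaction_shift_time t x : 0 < t ->
  `|rarefaction c d (1 + t) x - rarefaction c d t x| <=
     16 * Num.min (d - c) (2 * D / t) * bump ((D * (1 + t))^-1 * x + 0).
Proof.
move=> t0; have cd' := cd; have t10 : 0 < 1 + t by lra.
have cD := ler_norm c; have cD' := ler_norm (- c); rewrite normrN in cD'.
have dD := ler_norm d; have dD' := ler_norm (- d); rewrite normrN in dD'.
have D0 : 0 < D by rewrite /D; lra.
set X := D * (1 + t); have X0 : 0 < X by exact: mulr_gt0.
set m := Num.min _ _.
have m0 : 0 <= m by rewrite le_min divr_ge0 ?mulr_ge0 ?(ltW t0) ?(ltW D0)// andbT; lra.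
have b0 := ltW (bump_gt0 (X^-1 * x + 0)).
have /andP[l1 l2] := rarefaction_between t x.
have /andP[l3 l4] := rarefaction_between (1 + t) x.
have [xX|xX] := leP `|x| X; last first.
  have small (r : R) : 0 < r -> r <= 1 + t -> D < x / r \/ x / r < - D.
    move=> r0 rt; have : D * r < `|x|.
      by apply: le_lt_trans xX; rewrite /X ler_pM2l.
    rewrite lter_normr/= => /orP[h|h].
      by left; rewrite ltr_pdivlMr.
    by right; rewrite ltr_pdivrMr//; lra.
  have cD1 : c <= D by rewrite /D; have := normr_ge0 d; lra.
  have dD1 : d <= D by rewrite /D; have := normr_ge0 c; lra.
  have cD2 : - D <= c by rewrite /D; have := normr_ge0 d; lra.
  have hi (r : R) : D < x / r -> rarefaction c d r x = d.
    rewrite /rarefaction; set y := x / r => Dy.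
    by case: (leP y c) => ?; [|case: (leP y d) => ?]; lra.
  have lo (r : R) : x / r < - D -> rarefaction c d r x = c.
    by rewrite /rarefaction; set y := x / r => yD; case: (leP y c) => ?; [|case: (leP y d) => ?]; lra.
  have -> : rarefaction c d (1 + t) x = rarefaction c d t x.
    have tt : t <= 1 + t by rewrite lerDr.
    have [p1|p1] := small _ t10 (lexx _).
      have x0 : 0 < x.
        have : 0 < x / (1 + t) by exact: lt_trans D0 p1.
        by rewrite pmulr_lgt0// invr_gt0.
      have [p2|p2] := small _ t0 tt; first by rewrite !hi.
      have : 0 < x / t by rewrite divr_gt0.
      by set y := x / t in p2 *; lra.
    have x0 : x < 0.
      have : x / (1 + t) < 0 by apply: lt_trans p1 _; rewrite oppr_lt0.
      by rewrite pmulr_llt0// invr_gt0.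
    have [p2|p2] := small _ t0 tt; last by rewrite !lo.
    have : x / t < 0 by rewrite pmulr_llt0 ?invr_gt0.
    by set y := x / t in p2 *; lra.
  by rewrite subrr normr0 mulr_ge0// mulr_ge0.
have hb : 1 <= 16 * bump (X^-1 * x + 0).
  have h1 : `|X^-1 * x + 0| <= 1.
    by rewrite addr0 normrM gtr0_norm ?invr_gt0// mulrC ler_pdivrMr// mul1r.
  have h2 : expR (- 1) <= expR (- `|X^-1 * x + 0|) :> R by rewrite ler_expR lerN2.
  have h3 := bump_lb (X^-1 * x + 0).
  have h4 : 4^-1 <= expR (- 1) :> R.
    by rewrite expRN lef_pV2 ?posrE ?expR_gt0//; exact: expR1_le4.
  lra.
apply: (@le_trans _ _ m); last first.
  by rewrite mulrAC -{1}[m]mul1r ler_wpM2r.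
rewrite le_min; apply/andP; split.
  by rewrite ler_norml; apply/andP; split; lra.
rewrite !rarefactionE; apply: le_trans (clamp_lipschitz _ _) _.
have -> : x / (1 + t) - x / t = - (x / (t * (1 + t))).
  have n1 : t != 0 by rewrite gt_eqF.
  have n2 : 1 + t != 0 by rewrite gt_eqF.
  by field; rewrite n1 n2.
rewrite normrN normrM normfV [`|t * _|]gtr0_norm ?mulr_gt0//.
rewrite ler_pdivrMr ?mulr_gt0//.
have -> : 2 * D / t * (t * (1 + t)) = 2 * X by rewrite /X; field; rewrite gt_eqF.
lra.
Qed.

(** The weight has mass [D * (1 + t)]; the minimum times [1 + t] stays bounded, one of its arguments
    serving for the 1 and the other for the [t]. *)
Lemma integral_rarefaction_shift_time t : 0 < t ->
  (\int[mu]_x `|rarefaction c d (1 + t) x - rarefaction c d t x|%:E <= (64 * D ^+ 2)%:E)%E.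
Proof.
move=> t0; have cd' := cd; have t10 : 0 < 1 + t by lra.
have cD := ler_norm c; have cD' := ler_norm (- c); rewrite normrN in cD'.
have dD := ler_norm d; have dD' := ler_norm (- d); rewrite normrN in dD'.
have D0 : 0 < D by rewrite /D; lra.
have X0 : 0 < (D * (1 + t))^-1 by rewrite invr_gt0; exact: mulr_gt0.
apply: (le_trans (integral_le_bump X0 _ (fun x => rarefaction_shift_time x t0))).
  by apply: measurable_funB; exact: measurable_rarefaction.
rewrite lee_fin invrK; set m := Num.min _ _.
have m1 : m <= d - c by rewrite ge_min lexx.
have m2 : m <= 2 * D / t by rewrite ge_min lexx orbT.
have dcD : d - c <= D by rewrite /D; lra.
have mt : m * (1 + t) <= 4 * D.
  have h : m * t <= 2 * D by rewrite -ler_pdivlMr.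
  by rewrite mulrDr mulr1; lra.
have -> : 16 * m * (D * (1 + t)) = 16 * D * (m * (1 + t)) by ring.
have -> : 64 * D ^+ 2 = 16 * D * (4 * D) by ring.
by rewrite ler_wpM2l// mulr_ge0// ltW.
Qed.

(** At [tau = 1] the profile approaches [c] and [d] exponentially and may replace them. The
    hypotheses live on open half-lines, so the origin is a third piece when measurability and
    integrability are glued together. *)
Lemma integrable_initial_profile g :
  mu.-integrable `]-oo, 0[ (fun x => (g x - c)%:E) ->
  mu.-integrable `]0, +oo[ (fun x => (g x - d)%:E) ->
  itg (fun x => g x - profile c d 1 x).
Proof.
move=> i1 i2.
have mw : measurable_fun [set: R] (profile c d 1).
  by apply: measurable_continuous; exact: (derive_continuous (is_derive_profile c d 1)).
have mS1 : measurable (`]-oo, 0[%classic : set R) by [].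
have mS2 : measurable (`]0, +oo[%classic : set R) by [].
have ib l k : 0 < l -> mu.-integrable [set: R] (fun x => (k * bump (l * x + 0))%:E).
  by move=> l0; have := integrableRZ k (integrable_bump 0 l0).
have j1 : mu.-integrable `]-oo, 0[ (fun x => (g x - profile c d 1 x)%:E).
  have ibS : mu.-integrable `]-oo, 0[ (fun x => (4 * expR (- c) * bump (1 * x + 0))%:E).
    by apply: (@integrableS _ _ _ mu setT) => //; exact: ib.
  have iw : mu.-integrable `]-oo, 0[ (fun x => (profile c d 1 x - c)%:E).
    apply: (@le_integrable _ _ _ mu _ mS1 _ (fun x => (4 * expR (- c) * bump (1 * x + 0))%:E)); last exact: ibS.
      apply/measurable_EFinP; apply: measurable_funTS; exact: measurable_funB.
    move=> x; rewrite /= in_itv/= => x0; rewrite lee_fin.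
    have /andP[h1 _] := profile_between cd x (@ltr01 R).
    rewrite ger0_norm ?subr_ge0// ger0_norm; last first.
      by rewrite mulr_ge0 ?(ltW (bump_gt0 _))// mulr_ge0 ?expR_ge0.
    have -> : profile c d 1 x - c = softplus (x - c) - softplus (x - d).
      by rewrite /profile !mulr1 divr1; ring.
    have h2 := softplus_ge0 (x - d); have h3 := softplus_le_expR (x - c).
    apply: (@le_trans _ _ (expR (x - c))); first by lra.
    rewrite expRD mulrC -mulrA mulrCA ler_wpM2l ?expR_ge0//.
    have := bump_lb x; rewrite ltr0_norm// opprK; by rewrite mul1r addr0.
  have -> : (fun x => (g x - profile c d 1 x)%:E) = ((fun x => (g x - c)%:E) \- (fun x => (profile c d 1 x - c)%:E))%E.
    by apply/funext => x; rewrite /= -EFinB; congr EFin; ring.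
  by apply: integrableB.
have j2 : mu.-integrable `]0, +oo[ (fun x => (g x - profile c d 1 x)%:E).
  have ibS : mu.-integrable `]0, +oo[ (fun x => (4 * expR d * bump (1 * x + 0))%:E).
    by apply: (@integrableS _ _ _ mu setT) => //; exact: ib.
  have iw : mu.-integrable `]0, +oo[ (fun x => (profile c d 1 x - d)%:E).
    apply: (@le_integrable _ _ _ mu _ mS2 _ (fun x => (4 * expR d * bump (1 * x + 0))%:E)); last exact: ibS.
      apply/measurable_EFinP; apply: measurable_funTS; exact: measurable_funB.
    move=> x; rewrite /= in_itv/= andbT => x0; rewrite lee_fin.
    have /andP[_ h1] := profile_between cd x (@ltr01 R).
    rewrite ler0_norm ?subr_le0// opprB ger0_norm; last first.
      by rewrite mulr_ge0 ?(ltW (bump_gt0 _))// mulr_ge0 ?expR_ge0.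
    have -> : d - profile c d 1 x = softplus (- (x - d)) - softplus (- (x - c)).
      by rewrite !softplusN /profile !mulr1 divr1; ring.
    have h2 := softplus_ge0 (- (x - c)); have h3 := softplus_le_expR (- (x - d)).
    apply: (@le_trans _ _ (expR (- (x - d)))); first by lra.
    have -> : - (x - d) = - x + d by ring.
    rewrite expRD mulrC -mulrA mulrCA ler_wpM2l ?expR_ge0//.
    have := bump_lb x; rewrite gtr0_norm//; by rewrite mul1r addr0.
  have -> : (fun x => (g x - profile c d 1 x)%:E) = ((fun x => (g x - d)%:E) \- (fun x => (profile c d 1 x - d)%:E))%E.
    by apply/funext => x; rewrite /= -EFinB; congr EFin; ring.
  by apply: integrableB.
have j0 : mu.-integrable [set (0 : R)] (fun x => (g x - profile c d 1 x)%:E).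
  by apply/integrableP; split; [exact: measurable_fun_set1|rewrite integral_set1].
have eT : [set: R] = `]-oo, 0[%classic `|` ([set 0] `|` `]0, +oo[%classic).
  apply/seteqP; split => // x _; rewrite /= !in_itv/= andbT.
  by have [x0|x0|->] := ltrgtP x 0; [left|right; right|right; left].
have mset0 : measurable [set (0 : R)] by [].
have [/integrableP[m1 f1] /integrableP[m2 f2] /integrableP[m0 f0]] := And3 j1 j2 j0.
have mU : measurable_fun ([set (0:R)] `|` `]0, +oo[%classic) (fun x => (g x - profile c d 1 x)%:E).
  by apply/measurable_funU.
have mT : measurable_fun [set: R] (fun x => (g x - profile c d 1 x)%:E).
  by rewrite eT; apply/measurable_funU => //; exact: measurableU.
apply/integrableP; split => //.
have mTa : measurable_fun [set: R] (fun x => `|(g x - profile c d 1 x)%:E|%E) by exact: measurableT_comp.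
rewrite eT ge0_integral_setU//; last 3 first.
- exact: measurableU.
- by rewrite -eT.
- apply/disj_setPS => x [] /=; rewrite !in_itv/= => x0 [xe|/andP[x1 _]]; last by have := lt_trans x0 x1; rewrite ltxx.
  by rewrite xe ltxx in x0.
apply: lte_add_pinfty => //.
rewrite ge0_integral_setU//; last 2 first.
- by apply: measurable_funTS.
- apply/disj_setPS => x [] /= ->; by rewrite in_itv/= ltxx.
exact: lte_add_pinfty.
Qed.

End RarefactionDistance.

(** * Rates *)

Section Rates.
Context {R : realType}.
Notation mu := (@lebesgue_measure R).
Notation itg f := (mu.-integrable [set: R] (EFin \o f)).
Implicit Types (f g : R -> R) (a b s t x y z h l r q m A B I K M S T : R).

Lemma integral_abs_ge f a b q : a <= b -> 0 <= q -> measurable_fun [set: R] f ->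
  (forall y, a <= y <= b -> q <= `|f y|) -> ((q * (b - a))%:E <= \int[mu]_x `|f x|%:E)%E.
Proof.
move=> ab q0 mf hq; have mJ : measurable (`[a, b]%classic : set R) by [].
have ma : measurable_fun [set: R] (fun x => `|f x|%:E).
  by apply/measurable_EFinP; exact: measurableT_comp.
apply: (@le_trans _ _ (\int[mu]_(x in `[a, b]) q%:E)%E).
  rewrite integral_cst//= lebesgue_measure_itv/= lte_fin.
  have [ab'|ba] := ltP a b; first by rewrite -EFinB -EFinM.
  have -> : b - a = 0 by apply/eqP; rewrite subr_eq0 eq_le ab ba.
  by rewrite mulr0 mule0.
apply: (@le_trans _ _ (\int[mu]_(x in `[a, b]) `|f x|%:E)%E).
  by apply: ge0_le_integral => //; exact: measurable_funTS.
by apply: (@ge0_subset_integral _ _ _ mu _ setT mJ measurableT _ ma).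
Qed.

Lemma one_sided_sup f t I x : 0 < t -> measurable_fun [set: R] f ->
  (forall y h, 0 <= h -> f (y + h) - f y <= h / t) ->
  (\int[mu]_x `|f x|%:E <= I%:E)%E -> `|f x| ^+ 2 * t <= 4 * I.
Proof.
move=> t0 mf os fI; set q := `|f x|; have q0 : 0 <= q by exact: normr_ge0.
have qt : 0 <= q * t / 2 by rewrite divr_ge0// mulr_ge0// ltW.
have inc y h : 0 <= h -> h <= q * t / 2 -> f (y + h) - f y <= q / 2.
  move=> h0 hq; apply: le_trans (os y h h0) _; rewrite ler_pdivrMr//; lra.
have fin a b : b - a = q * t / 2 -> (forall y, a <= y <= b -> q / 2 <= `|f y|) -> q ^+ 2 * t <= 4 * I.
  move=> ba hq; have ab : a <= b by rewrite -subr_ge0 ba.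
  have q20 : 0 <= q / 2 by rewrite divr_ge0.
  have := le_trans (integral_abs_ge ab q20 mf hq) fI; rewrite lee_fin ba expr2.
  have -> : q / 2 * (q * t / 2) = q * q * t / 4 by field.
  lra.
(* The bound forbids only fast increase: a positive value has to be reached slowly from the left,
   and a negative one can be left only slowly to the right. *)
have [f0|f0] := leP 0 (f x).
  apply: (fin (x - q * t / 2) x); first by ring.
  move=> y /andP[y1 y2]; apply: le_trans (ler_norm _).
  have := inc y (x - y) _ _; have -> : y + (x - y) = x by ring.
  have -> : f x = q by rewrite /q ger0_norm.
  have e1 : 0 <= x - y by lra.
  have e2 : x - y <= q * t / 2 by lra.
  by move=> /(_ e1 e2); lra.
apply: (fin x (x + q * t / 2)); first by ring.
move=> y /andP[y1 y2]; have := ler_norm (- f y); rewrite normrN; apply: le_trans.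
have := inc x (y - x) _ _; have -> : x + (y - x) = y by ring.
have -> : f x = - q by rewrite /q ltr0_norm// opprK.
have e1 : 0 <= y - x by lra.
have e2 : y - x <= q * t / 2 by lra.
by move=> /(_ e1 e2); lra.
Qed.

Lemma Lnorm_pinfty_le f S : 0 <= S -> (forall x, `|f x| <= S) ->
  (Lnorm mu +oo (fun x => (f x)%:E) <= S%:E)%E.
Proof.
move=> S0 fS; rewrite unlock; case: ifP => _; last by rewrite lee_fin.
by apply/ess_supP; apply: nearW => x; rewrite /= lee_fin.
Qed.

Lemma Lnorm_fin_le f r S I : 1 < r -> 0 <= S -> 0 <= I -> measurable_fun [set: R] f ->
  (forall x, `|f x| <= S) -> (\int[mu]_x `|f x|%:E <= I%:E)%E ->
  (Lnorm mu r%:E (fun x => (f x)%:E) <= ((S `^ (r - 1) * I) `^ r^-1)%:E)%E.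
Proof.
move=> r1 S0 I0 mf fS fI; have r0 : 0 < r by lra.
have ma : measurable_fun [set: R] (fun x => `|f x|) by exact: measurableT_comp.
have h : (\int[mu]_x (`|f x| `^ r)%:E <= (S `^ (r - 1) * I)%:E)%E.
  apply: (@le_trans _ _ (\int[mu]_x ((S `^ (r - 1))%:E * `|f x|%:E))%E).
    apply: ge0_le_integral => //.
    - apply/measurable_EFinP.
      by apply: (measurableT_comp (measurable_powR r)).
    - by apply: emeasurable_funM => //; exact/measurable_EFinP.
    - move=> x _; rewrite -EFinM lee_fin -(mulr_powRB1 (normr_ge0 _) r0) mulrC ler_wpM2r//.
      by apply: ge0_ler_powR; rewrite ?nnegrE//; lra.
  rewrite ge0_integralZl//; [|exact/measurable_EFinP|by rewrite lee_fin powR_ge0].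
  by rewrite [leRHS]EFinM; apply: lee_wpmul2l => //; rewrite lee_fin powR_ge0.
rewrite unlock -poweR_EFin.
have e : (\int[mu]_x (`|(f x)%:E| `^ r) = \int[mu]_x (`|f x| `^ r)%:E)%E.
  by apply: eq_integral => x _; rewrite abse_EFin poweR_EFin.
rewrite e; apply: gt0_ler_poweR => //.
- by rewrite invr_ge0 ltW.
- by rewrite in_itv/= leey andbT; apply: integral_ge0 => x _; rewrite lee_fin powR_ge0.
- by rewrite in_itv/= leey andbT lee_fin mulr_ge0// powR_ge0.
Qed.

Lemma powR_ge1 t e : 0 < t <= 1 -> e <= 0 -> 1 <= t `^ e.
Proof.
move=> /andP[t0 t1] e0; rewrite /powR gt_eqF// -expR0 ler_expR.
by apply: mulr_le0 => //; apply: ln_le0.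
Qed.

(** Keeps the logarithmic factor away from 0 as [t -> 0], so that inserting it costs only a
    constant. *)
Lemma ln2t_ge t : 0 < t -> 2^-1 <= ln (2 + t).
Proof.
move=> t0; rewrite -[leLHS]expRK ler_ln ?posrE ?expR_gt0//; last by lra.
apply: (@le_trans _ _ 2); last by lra.
have h := @expR1_le4 R; have e0 := expR_gt0 (2^-1 : R).
have e : expR 1 = expR (2^-1 : R) ^+ 2.
  by rewrite -expRM_natl; congr expR; field.
rewrite -(@ler_pXn2r _ 2) ?nnegrE ?expR_ge0// -e; apply: le_trans h _; rewrite expr2; lra.
Qed.

Variables (al c d : R) (u ut ux : R -> R -> R) (u0 : R -> R).
Hypothesis al12 : 1 < al < 2.
Hypothesis cd : c < d.
Hypothesis Su : smooth_solution al u ut ux.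
Hypothesis iuw : itg (fun x => u0 x - profile c d 1 x).
Hypothesis weak : forall m b, 0 < m ->
  (fun s => \int[mu]_x (u s x * bump (m * x + b))) s @[s --> 0^'+] -->
     \int[mu]_x (u0 x * bump (m * x + b)).

Let v t x := u t x - rarefaction c d t x.

Let mv t : 0 < t -> measurable_fun [set: R] (v t).
Proof.
move=> t0; apply: measurable_funB; first exact: (solution_measurable Su t0).
exact: measurable_rarefaction.
Qed.

Lemma rarefaction_L1 : exists2 B, 0 <= B & forall t, 0 < t ->
  (\int[mu]_x `|u t x - rarefaction c d t x|%:E <= (B * (1 + t) `^ (2 - al))%:E)%E.
Proof.
have [al1 al2] := andP al12; have fc0 := frac_const_gt0 al12; have kc0 := kernel_cst_gt0 al12.
set D0 := \int[mu]_x `|u0 x - profile c d 1 x|.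
set F := frac_const al * (profile_levy_cst c d al * (2 - al)^-1).
set D := 64 * (`|c| + `|d|) ^+ 2.
have D00 : 0 <= D0 by apply: Rintegral_ge0 => x _; exact: normr_ge0.
have Dge0 : 0 <= D by rewrite mulr_ge0// sqr_ge0.
have F0 : 0 <= F.
  have dc0 : 0 < d - c by rewrite subr_gt0.
  apply: mulr_ge0; first exact: ltW.
  apply: mulr_ge0; last by rewrite invr_ge0; lra.
  apply: mulr_ge0; first exact: ltW.
  by rewrite addr_ge0// addr_ge0// mulr_ge0// ltW//; lra.
exists (D0 + 16 + F + 8 + D); first by rewrite !addr_ge0.
move=> t t0; have t1 : 1 <= 1 + t by lra.
have p1 : 1 <= (1 + t) `^ (2 - al).
  by rewrite -[leLHS](powRr0 (1 + t)) ler_powR//; lra.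
have [S _ _ _] := Su; have T0 : 0 < t + 1 by lra.
have [M uM] := S (t + 1) T0; have tT : 0 < t < t + 1 by apply/andP; split; lra.
have h1 := integral_profile_dist al12 cd Su uM iuw weak tT.
have h2 := integral_profile_rarefaction cd t1.
have h3 := integral_rarefaction_shift_time cd t0.
have mp : measurable_fun [set: R] (profile c d (1 + t)).
  by apply: measurable_continuous; exact: (derive_continuous (is_derive_profile c d (1 + t))).
have mr s := measurable_rarefaction cd s.
have mus := solution_measurable Su t0.
have mn f g : measurable_fun [set: R] f -> measurable_fun [set: R] g ->
    measurable_fun [set: R] (fun x => `|f x - g x|%:E).
  move=> mf mg; apply/measurable_EFinP; apply: measurableT_comp; first exact: normr_measurable.
  exact: measurable_funB.
have m1 := mn _ _ mus mp; have m2 := mn _ _ mp (mr (1 + t)); have m3 := mn _ _ (mr (1 + t)) (mr t).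
apply: (@le_trans _ _ (\int[mu]_x (`|u t x - profile c d (1 + t) x|%:E +
   (`|profile c d (1 + t) x - rarefaction c d (1 + t) x|%:E +
    `|rarefaction c d (1 + t) x - rarefaction c d t x|%:E)))%E).
  apply: ge0_le_integral => //.
  - exact: mn.
  - by apply: emeasurable_funD => //; exact: emeasurable_funD.
  - move=> x _; rewrite -!EFinD lee_fin.
    have -> : u t x - rarefaction c d t x = (u t x - profile c d (1 + t) x) +
      ((profile c d (1 + t) x - rarefaction c d (1 + t) x) +
       (rarefaction c d (1 + t) x - rarefaction c d t x)) by ring.
    by apply: le_trans (ler_normD _ _) _; rewrite lerD2l; exact: ler_normD.
rewrite ge0_integralD//; last exact: emeasurable_funD.
  rewrite ge0_integralD//.
  apply: le_trans (leeD h1 (leeD h2 h3)) _.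
  rewrite -!EFinD lee_fin -/D0 -/D /growth_total.
  have -> : frac_const al * (profile_levy_cst c d al * ((1 + t) `^ (2 - al) / (2 - al))) =
     F * (1 + t) `^ (2 - al) by rewrite /F; ring.
  move: p1; set p := (1 + t) `^ (2 - al) => p1.
  have q1 : D0 <= D0 * p by rewrite ler_peMr.
  have q2 : D <= D * p by rewrite ler_peMr.
  lra.
by move=> x _; rewrite -EFinD lee_fin addr_ge0.
Qed.

(** Times [t <= 1] have separate bounds because [t^(2 - al)] vanishes at 0, while the L1 distance
    need not. *)
Lemma rarefaction_rates : exists A B, [/\ 0 <= A /\ 0 <= B,
  forall t x, 0 < t -> `|u t x - rarefaction c d t x| <= A * t `^ (- (al - 1) / 2),
  forall t x, 0 < t <= 1 -> `|u t x - rarefaction c d t x| <= A,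
  forall t, 1 <= t -> (\int[mu]_x `|u t x - rarefaction c d t x|%:E <= (B * t `^ (2 - al))%:E)%E &
  forall t, 0 < t <= 1 -> (\int[mu]_x `|u t x - rarefaction c d t x|%:E <= B%:E)%E].
Proof.
have [al1 al2] := andP al12; have [B B0 HB] := rarefaction_L1.
have [S _ _ _] := Su; have [M uM] := S 2 (ltr0Sn _ 1).
have p2 : 2 `^ (2 - al) <= 2 :> R.
  by rewrite -[leRHS]powRr1// ler_powR//; lra.
have a0 : 0 <= 2 - al by lra.
have L1 t : 1 <= t -> (\int[mu]_x `|v t x|%:E <= (2 * B * t `^ (2 - al))%:E)%E.
  move=> t1; have t0 : 0 < t by lra.
  apply: le_trans (HB t t0) _; rewrite lee_fin [2 * B]mulrC -mulrA ler_wpM2l//.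
  apply: (@le_trans _ _ ((2 * t) `^ (2 - al))).
    by apply: ge0_ler_powR; rewrite ?nnegrE//; lra.
  by rewrite powRM ?(ltW t0)// ler_wpM2r// powR_ge0.
have L0 t : 0 < t <= 1 -> (\int[mu]_x `|v t x|%:E <= (2 * B)%:E)%E.
  move=> /andP[t0 t1]; apply: le_trans (HB t t0) _; rewrite lee_fin [2 * B]mulrC ler_wpM2l//.
  apply: le_trans p2; apply: ge0_ler_powR; rewrite ?nnegrE//; lra.
have M0 : 0 <= M.
  by apply: le_trans (normr_ge0 (u 1 0)) (uM _ _ _); apply/andP; split; lra.
pose M' := M + (`|c| + `|d|).
have M'0 : 0 <= M' by rewrite !addr_ge0.
have B80 : 0 <= 8 * B by rewrite mulr_ge0.
(* The summand 1 gives [A <= A^2], hence [8 * B <= A^2], as the squared sup bound requires; [M']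
   covers [t <= 1]. *)
pose A := 8 * B + 1 + M'.
have A1 : 1 <= A by rewrite /A; lra.
have A0 : 0 <= A by lra.
have sup0 t x : 0 < t <= 1 -> `|v t x| <= A.
  move=> /andP[t0 t1]; apply: (@le_trans _ _ M'); last by rewrite /A; lra.
  apply: le_trans (ler_normB _ _) _; apply: lerD; first by apply: uM; apply/andP; split; lra.
  have /andP[r1 r2] := rarefaction_between cd t x.
  have := ler_norm d; have := ler_norm (- c); rewrite normrN.
  have := normr_ge0 c; have := normr_ge0 d.
  by rewrite ler_norml => *; apply/andP; split; lra.
have os t x h : 0 < t -> 0 <= h -> v t (x + h) - v t x <= h / t.
  move=> t0 h0; have := solution_oleinik al12 Su x t0 h0.
  by have := rarefaction_nondecreasing cd x t0 h0; rewrite /v; set q := h / t; lra.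
exists A, (2 * B); split => //.
- by rewrite mulr_ge0.
- move=> t x t0; have [t1|t1] := leP t 1.
    have tt : 0 < t <= 1 by rewrite t0.
    apply: le_trans (sup0 t x tt) _; rewrite ler_peMr//; apply: powR_ge1 => //; lra.
  have := one_sided_sup x t0 (mv t0) (fun y h => os t y h t0) (L1 t (ltW t1)).
  move=> hs.
  have P0 : 0 <= A * t `^ (- (al - 1) / 2) by rewrite mulr_ge0// powR_ge0.
  rewrite -(@ler_pXn2r _ 2) ?nnegrE// -(ler_pM2r t0); apply: le_trans hs _.
  have -> : (A * t `^ (- (al - 1) / 2)) ^+ 2 * t = A ^+ 2 * (t `^ (- (al - 1) / 2) ^+ 2 * t) by ring.
  have -> : t `^ (- (al - 1) / 2) ^+ 2 * t = t `^ (2 - al).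
    rewrite -powR_mulrn ?powR_ge0// -powRrM.
    have -> : - (al - 1) / 2 * 2%:R = (2 - al) - 1 by field.
    by rewrite mulrC mulr_powRB1// ?ltW// subr_gt0.
  have A8 : 8 * B <= A ^+ 2.
    apply: (@le_trans _ _ A); first by rewrite /A; lra.
    by rewrite expr2 ler_peMr.
  by rewrite !mulrA ler_wpM2r ?powR_ge0//; lra.
Qed.

(** For finite [p = r], interpolation gives the exponent [(- (al - 1) / 2 * (r - 1) + (2 - al)) /
    r], which is the one claimed. The lower bound on [p] makes it nonpositive, so that for [t <= 1]
    the power of [t] is at least 1 and constant bounds suffice. *)
Lemma solution_Lnorm_rate (p : \bar R) : (((3 - al) / (al - 1))%:E < p)%E ->
  exists C : R, 0 < C /\ forall t, 0 < t ->
    (Lnorm mu p (fun x => (u t x - rarefaction c d t x)%:E) <=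
      (C * t `^ (- (al - 1 - (3 - al) * invp p) / 2) * ln (2 + t))%:E)%E.
Proof.
have [al1 al2] := andP al12.
have [A [B [[A0 B0] HS HS1 HI HI1]]] := rarefaction_rates.
have fin Z t e : 0 <= Z -> 0 < t -> Z * t `^ e <= (2 * Z + 1) * t `^ e * ln (2 + t).
  move=> Z0 t0; have P0 := powR_ge0 t e; have L := ln2t_ge t0.
  apply: (@le_trans _ _ ((2 * Z + 1) * t `^ e * 2^-1)).
    have : Z * t `^ e <= (Z + 2^-1) * t `^ e by rewrite ler_wpM2r// lerDl.
    by lra.
  by rewrite ler_wpM2l// mulr_ge0//; lra.
case: p => [r| |//]; last first.
  move=> _; exists (2 * A + 1); split; first by lra.
  move=> t t0; rewrite /= mulr0 subr0.
  apply: (@le_trans _ _ (A * t `^ (- (al - 1) / 2))%:E); last by rewrite lee_fin; exact: fin.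
  by apply: Lnorm_pinfty_le; [rewrite mulr_ge0// powR_ge0|move=> x; exact: HS].
rewrite lte_fin => hr.
have r1 : 1 < r.
  by apply: lt_trans hr; rewrite ltr_pdivlMr; lra.
have rp : 0 < r - 1 by lra.
have rn0 : r != 0 by rewrite gt_eqF//; lra.
have E0 : 0 <= al - 1 - (3 - al) / r.
  rewrite subr_ge0 ler_pdivrMr; last by lra.
  by rewrite mulrC -ler_pdivrMr ?ltW//; lra.
pose Z := (A `^ (r - 1) * B) `^ r^-1.
have Z0 : 0 <= Z by exact: powR_ge0.
exists (2 * Z + 1); split; first by lra.
move=> t t0; rewrite /=; set e := - _ / 2.
apply: (@le_trans _ _ (Z * t `^ e)%:E); last by rewrite lee_fin; exact: fin.
have [t1|t1] := leP t 1.
  have tt : 0 < t <= 1 by rewrite t0.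
  have h := Lnorm_fin_le r1 A0 B0 (mv t0) (fun x => HS1 t x tt) (HI1 t tt).
  apply: le_trans h _; rewrite lee_fin -/Z ler_peMr//; apply: powR_ge1 => //; rewrite /e; lra.
have St : 0 <= A * t `^ (- (al - 1) / 2) by rewrite mulr_ge0// powR_ge0.
have It : 0 <= B * t `^ (2 - al) by rewrite mulr_ge0// powR_ge0.
have h := Lnorm_fin_le r1 St It (mv t0) (fun x => HS t x t0) (HI t (ltW t1)).
apply: le_trans h _; rewrite lee_fin.
have -> : (A * t `^ (- (al - 1) / 2)) `^ (r - 1) = A `^ (r - 1) * t `^ (- (al - 1) / 2 * (r - 1)).
  by rewrite powRM ?powR_ge0// -powRrM.
have tn0 : t != 0 by rewrite gt_eqF.
have -> : A `^ (r - 1) * t `^ (- (al - 1) / 2 * (r - 1)) * (B * t `^ (2 - al)) =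
  A `^ (r - 1) * B * t `^ (- (al - 1) / 2 * (r - 1) + (2 - al)).
  rewrite (@powRD _ t (- (al - 1) / 2 * (r - 1)) (2 - al)); first by ring.
  by rewrite tn0 implybT.
rewrite powRM ?powR_ge0 ?mulr_ge0 ?powR_ge0// -/Z -powRrM.
have -> : (- (al - 1) / 2 * (r - 1) + (2 - al)) * r^-1 = e by rewrite /e; field.
exact: lexx.
Qed.

End Rates.

Theorem theorem1p1 (R : realType) (alpha c : R) (m : {charge set R -> \bar R})
  (u : R -> R -> R) :
  1 < alpha < 2 ->
  lebesgue_measure.-integrable `]-oo, 0[
    (fun x => (init_datum c m x - c)%:E) ->
  lebesgue_measure.-integrable `]0, +oo[
    (fun x => (init_datum c m x - (c + fine (m setT)))%:E) ->
  c < c + fine (m setT) ->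
  is_solution alpha (init_datum c m) u ->
  forall p : \bar R, (((3 - alpha) / (alpha - 1))%:E < p)%E ->
  exists C : R, 0 < C /\
    forall t : R, 0 < t ->
      (Lnorm lebesgue_measure p
          (fun x => (u t x - rarefaction c (c + fine (m setT)) t x)%:E)
       <= (C * t `^ (- (alpha - 1 - (3 - alpha) * invp p) / 2)
             * ln (2 + t))%:E)%E.
Proof.
move=> al12 i1 i2 cd sol.
have Su := is_solution_smooth al12 sol.
have iuw := integrable_initial_profile cd i1 i2.
apply: (solution_Lnorm_rate al12 cd Su iuw) => q b q0.
have [_ weak] := sol.
exact: (weak (fun x => bump (q * x + b)) (integrable_bump b q0)).
Qed.
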